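(* Let $V$ be a quasi-vertex operator algebra over $\mathbf{C}$. Identify $Q(V)$ with $Q\otimes_{\mathbf C} V$ via $g\otimes v\mapsto g(\tau)v$. Then the space $M(V)$ of $V$-valued modular forms is the kernel of the lowering operator $$\Lambda = \frac{12}{2\pi i}\frac{\partial}{\partial E_2}\otimes 1 + 1\otimes L(1)$$ acting on $Q(V)$.
   Context: Vertex algebra over $\mathbf{C}$: a vector space $V$ with a nonzero vector $\mathbf 1$ and bilinear products $(a,b)\mapsto a(n)b$, $n\in\mathbf{Z}$, such that $a(n)b=0$ for $n\gg0$ (depending on $a,b$), $a(n)\mathbf 1=0$ for $n\ge0$, $a(-1)\mathbf 1=a$, and for all $a,b,c\in V$, $r,s,t\in\mathbf{Z}$: $\sum_{i\ge0}\binom ri (a(t+i)b)(r+s-i)c=\sum_{i\ge0}(-1)^i\binom ti\{a(r+t-i)b(s+i)c-(-1)^t b(s+t-i)a(r+i)c\}$. A quasi-vertex operator algebra (QVOA) is a vertex algebra with a grading $V=\bigoplus_{n\in\mathbf{Z}}V_n$ such that $\dim V_n<\infty$, $V_n=0$ for $n\ll0$, $a(n)b\in V_{k+\ell-n-1}$ for $a\in V_k,b\in V_\ell$, together with operators $L(-1),L(0),L(1)$ on $V$ with $L(-1)a=a(-2)\mathbf 1$, $L(0)a=ka$ for $a\in V_k$, $L(1)V_k\subseteq V_{k-1}$, $[L(m),L(n)]=(m-n)L(m+n)$ for $m,n\in\{0,\pm1\}$, and for $a\in V_k$: $[L(-1),a(n)]=(L(-1)a)(n)=-n\,a(n-1)$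 and $[L(1),a(n)]=(L(1)a)(n)+(2k-n-2)a(n+1)$. Let $\mathcal H$ be the upper half-plane, $\Gamma=\mathrm{SL}_2(\mathbf{Z})$, $q=e^{2\pi i\tau}$, $F_NV=\bigoplus_{n\le N}V_n$. For $\gamma=\left(\begin{smallmatrix}a&b\\c&d\end{smallmatrix}\right)\in\Gamma$ put $j=j(\gamma,\tau)=c\tau+d$, $X=X(\gamma,\tau)=c/(c\tau+d)$, and for $f:\mathcal H\to F_NV$ put $f||_k\gamma(\tau)=j^{-k}\,j^{2L(0)}e^{cjL(1)}f(\gamma\tau)$. $M_k(V)$: holomorphic $f:\mathcal H\to F_NV$ (some $N$) with $f||_k\gamma=f$ for all $\gamma\in\Gamma$ and $q$-expansion in $F_NV[[q]]$. $M(V)=\bigoplus_{k\in\mathbf{Z}}M_k(V)$. $Q_k(V)$: holomorphic $f:\mathcal H\to F_NV$ (some $N$) for which there are $s\ge0$ and holomorphic $Q_n(f):\mathcal H\to F_NV$, $0\le n\le s$, with $f||_k\gamma(\tau)=\sum_{n=0}^sX(\gamma,\tau)^nQ_n(f)(\tau)$ for all $\gamma\in\Gamma$, and such that each $Q_n(f)$ (in particular $f=Q_0(f)$) has a $q$-expansion in $F_NV[[q]]$. $Q_k(V)=0$ for odd $k$. $Q(V)=\bigoplus_{k\in\mathbf{Z}}Q_{2k}(V)$. $Q=\mathbf{C}[E_2,E_4,E_6]$ is the algebra of scalar quasi-modular forms, where $E_2=1-24\sum_{n\ge1}\sigma_1(n)q^n$, $E_4=1+240\sum_{n\ge1}\sigma_3(n)q^n$,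 $E_6=1-504\sum_{n\ge1}\sigma_5(n)q^n$ are algebraically independent; $\partial/\partial E_2$ is the partial derivative on this polynomial ring. *)

(* Defs.v *)
From HB Require Import structures.
From mathcomp Require Import all_boot all_order all_algebra.
From mathcomp Require Import complex.
From mathcomp Require Import all_classical all_reals all_analysis.
From mathcomp Require mpoly.
(* The notations of [mpoly] clash with those of [all_analysis]. *)
Import -(notations) mpoly.

Set Implicit Arguments.
Unset Strict Implicit.
Unset Printing Implicit Defensive.

Import Order.TTheory GRing.Theory Num.Theory.
Import numFieldNormedType.Exports.
Local Open Scope classical_set_scope.
Local Open Scope ring_scope.
Local Open Scope complex_scope.

(* The field of complex numbers is [R[i]] with [R : realType].  Its topology
   and its notion of derivative are those of [R[i]^o].

   A sum [\sum_(i \in A) F i] over a possibly infinite set [A] is the sum of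
   the nonzero [F i] when these are finitely many.  It is only used below in
   that situation. *)

(** * Vertex algebras *)

Section VertexAlgebra.
Variable R : realType.

Definition binz (r : int) (i : nat) : R[i] :=
  (\prod_(k < i) (r - k%:Z)%:~R) / i`!%:R.

(* [vprod a n b] is a(n)b *)
Record vertex_algebra (V : lmodType R[i]) := VertexAlgebra {
  vacuum : V ;
  vprod : V -> int -> V -> V ;
  vacuum_neq0 : vacuum != 0 ;
  vprod_linearl : forall n b, linear (fun a => vprod a n b) ;
  vprod_linearr : forall a n, linear (vprod a n) ;
  vprod_trunc : forall a b,
    exists N : int, forall n : int, N <= n -> vprod a n b = 0 ;
  vprod_vacuum : forall a (n : int), 0 <= n -> vprod a n vacuum = 0 ;
  vprod_creation : forall a, vprod a (-1) vacuum = a ;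
  borcherds : forall a b c (r s t : int),
    \sum_(i \in [set: nat])
      binz r i *: vprod (vprod a (t + i%:Z) b) (r + s - i%:Z) c =
    \sum_(i \in [set: nat]) ((-1) ^+ i * binz t i) *:
      (vprod a (r + t - i%:Z) (vprod b (s + i%:Z) c)
       - ((-1) ^ t : R[i]) *: vprod b (s + t - i%:Z) (vprod a (r + i%:Z) c)) }.

Record qvoa (V : lmodType R[i]) := QVOA {
  qvoa_va :> vertex_algebra V ;
  gr : int -> set V ;
  (* each V_n is a subspace of V of finite dimension *)
  gr_findim : forall n : int, exists (d : nat) (e : 'I_d -> V),
    gr n = [set v | exists x : 'I_d -> R[i], v = \sum_i x i *: e i] ;
  gr_direct : forall v : V, exists! c : int -> V,
    [/\ forall n, gr n (c n), finite_set [set n | c n != 0]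
      & v = \sum_(n \in [set: int]) c n] ;
  gr_below : exists N : int, forall n : int, n < N -> gr n = [set 0] ;
  gr_vprod : forall (k l n : int) a b, gr k a -> gr l b ->
    gr (k + l - n - 1) (vprod qvoa_va a n b) ;
  Lm1 : {linear V -> V} ;
  L0 : {linear V -> V} ;
  L1 : {linear V -> V} ;
  Lm1E : forall a, Lm1 a = vprod qvoa_va a (-2) (vacuum qvoa_va) ;
  L0E : forall (k : int) a, gr k a -> L0 a = k%:~R *: a ;
  L1_gr : forall (k : int) a, gr k a -> gr (k - 1) (L1 a) ;
  (* [L(m), L(n)] = (m - n) L(m + n) for m, n in {0, 1, -1}, m > n; the other
     cases follow by antisymmetry *)
  comm_L1_L0 : forall v, L1 (L0 v) - L0 (L1 v) = L1 v ;
  comm_L1_Lm1 : forall v, L1 (Lm1 v) - Lm1 (L1 v) = 2 *: L0 v ;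
  comm_L0_Lm1 : forall v, L0 (Lm1 v) - Lm1 (L0 v) = Lm1 v ;
  comm_Lm1_vprod : forall (k n : int) a b, gr k a ->
    Lm1 (vprod qvoa_va a n b) - vprod qvoa_va a n (Lm1 b)
      = vprod qvoa_va (Lm1 a) n b
    /\ vprod qvoa_va (Lm1 a) n b = - (n%:~R *: vprod qvoa_va a (n - 1) b) ;
  comm_L1_vprod : forall (k n : int) a b, gr k a ->
    L1 (vprod qvoa_va a n b) - vprod qvoa_va a n (L1 b)
      = vprod qvoa_va (L1 a) n b
        + (2 * k - n - 2)%:~R *: vprod qvoa_va a (n + 1) b }.

End VertexAlgebra.

(** * The upper half-plane, the modular group and the Eisenstein series *)

Section Modular.
Variable R : realType.
Implicit Types (tau : R[i]) (g : 'M[int]_2).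

Definition uhp : set R[i] := [set tau | 0 < complex.Im tau].

Definition SL2Z : set 'M[int]_2 := [set g | \det g = 1].

Definition jfac g tau : R[i] := (g 1 0)%:~R * tau + (g 1 1)%:~R.

Definition moebius g tau : R[i] :=
  ((g 0 0)%:~R * tau + (g 0 1)%:~R) / jfac g tau.

Definition Xfac g tau : R[i] := (g 1 0)%:~R / jfac g tau.

Definition cexp (z : R[i]) : R[i] :=
  (expR (complex.Re z))%:C *
  ((cos (complex.Im z))%:C + 'i%C * (sin (complex.Im z))%:C).

Definition twopii : R[i] := (2 * pi)%:C * 'i%C.

Definition qexp tau : R[i] := cexp (twopii * tau).

Definition sigma (k n : nat) : nat := (\sum_(d <- divisors n) d ^ k)%N.

(* sum of sigma_k(n) q^n over n >= 1 *)
Definition sigma_series (k : nat) tau : R[i] :=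
  limn (series (fun n : nat => (sigma k n.+1)%:R * qexp tau ^+ n.+1 : R[i]^o)).

Definition E2 tau : R[i] := 1 - 24 * sigma_series 1 tau.
Definition E4 tau : R[i] := 1 + 240 * sigma_series 3 tau.
Definition E6 tau : R[i] := 1 - 504 * sigma_series 5 tau.

(* The polynomial ring C[E_2, E_4, E_6]: the variables of index 0, 1, 2 stand
   for E_2, E_4, E_6. *)
Definition Qring := mpoly 3 R[i].

Definition Qval (p : Qring) tau : R[i] :=
  meval (fun i : 'I_3 => [:: E2 tau; E4 tau; E6 tau]`_i) p.

Definition dE2 (p : Qring) : Qring := mderiv 0 p.

End Modular.

(** * V-valued modular and quasi-modular forms *)

(* Forms are represented by functions on [R[i]], of which only the values on
   [uhp] matter. *)

Section Forms.
Variables (R : realType) (V : lmodType R[i]) (A : qvoa V).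
Implicit Types (f : R[i] -> V) (N k : int).

Definition eq_uhp (f1 f2 : R[i] -> V) : Prop :=
  forall tau, uhp tau -> f1 tau = f2 tau.

(* [gcomp v n] is the component of v in V_n *)
Definition gcomp (v : V) : int -> V := sval (cid (gr_direct A v)).

Definition filtr N : set V := [set v | forall n : int, N < n -> gcomp v n = 0].

(* z^{2 L(0)} *)
Definition pow2L0 (z : R[i]) (v : V) : V :=
  \sum_(n \in [set: int]) (z ^ (2 * n)) *: gcomp v n.

(* e^{z L(1)}, a finite sum on each vector since L(1) lowers the degree *)
Definition expL1 (z : R[i]) (v : V) : V :=
  \sum_(n \in [set: nat]) (z ^+ n / n`!%:R) *: iter n (L1 A) v.

Definition slash k f (g : 'M[int]_2) (tau : R[i]) : V :=
  jfac g tau ^ (- k) *: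
    pow2L0 (jfac g tau)
      (expL1 ((g 1 0)%:~R * jfac g tau) (f (moebius g tau))).

(* [filtr N] has finite dimension: holomorphy and convergence in it are tested
   on all linear functionals, i.e. on coordinates *)
Definition holomorphic N f : Prop :=
  (forall tau, uhp tau -> filtr N (f tau)) /\
  (forall (l : {scalar V}) tau, uhp tau ->
     derivable (fun z : R[i]^o => l (f z) : R[i]^o) tau 1).

Definition has_qexpansion N f : Prop :=
  exists c : nat -> V,
    (forall n, filtr N (c n)) /\
    (forall (l : {scalar V}) tau, uhp tau ->
       series (fun n => l (c n) * qexp tau ^+ n : R[i]^o) @ \oo
         --> (l (f tau) : R[i]^o)).

Definition modular_form k : set (R[i] -> V) := [set f |
  exists N, [/\ holomorphic N f,
    forall g tau, SL2Z g -> uhp tau -> slash k f g tau = f tau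
  & has_qexpansion N f]].

Definition quasi_modular_form k : set (R[i] -> V) := [set f |
  exists N (s : nat) (Qf : 'I_s.+1 -> R[i] -> V),
    [/\ holomorphic N f,
      forall n, holomorphic N (Qf n) /\ has_qexpansion N (Qf n)
    & forall g tau, SL2Z g -> uhp tau ->
        slash k f g tau = \sum_(n < s.+1) Xfac g tau ^+ n *: Qf n tau]].

(* the sum over k of the spaces P k of functions on the upper half-plane *)
Definition sum_spaces (P : int -> set (R[i] -> V)) : set (R[i] -> V) :=
  [set f | exists (s : seq int) (h : int -> R[i] -> V),
    [/\ uniq s, forall k, k \in s -> P k (h k)
      & eq_uhp f (fun tau => \sum_(k <- s) h k tau)]].

Definition MV : set (R[i] -> V) := sum_spaces modular_form.

Definition QV : set (R[i] -> V) :=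
  sum_spaces (fun k => quasi_modular_form (2 * k)).

(** * The tensor product of Q and V, and the lowering operator *)

(* The sequence [:: (p_1, v_1); ...; (p_m, v_m)] represents the tensor
   p_1 (x) v_1 + ... + p_m (x) v_m. *)
Definition tensor := seq (Qring R * V).

(* Equality in the tensor product over C: two formal sums represent the same
   tensor when no bilinear map separates them. *)
Definition tensor_eq (t u : tensor) : Prop :=
  forall (W : lmodType R[i]) (B : Qring R -> V -> W),
    (forall v, linear (B^~ v)) -> (forall p, linear (B p)) ->
    \sum_(x <- t) B x.1 x.2 = \sum_(x <- u) B x.1 x.2.

(* the identification p (x) v |-> p(E_2(tau), E_4(tau), E_6(tau)) v *)
Definition tensor_fun (t : tensor) (tau : R[i]) : V :=
  \sum_(x <- t) Qval x.1 tau *: x.2.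

(* 12 / (2 pi i) d/dE_2 (x) 1 + 1 (x) L(1) *)
Definition Lambda (t : tensor) : tensor :=
  [seq ((12 / twopii R) *: dE2 x.1, x.2) | x <- t] ++
  [seq (x.1, L1 A x.2) | x <- t].

(* Both maps are well defined on the tensor product. *)

Lemma tensor_fun_eq (t u : tensor) :
  tensor_eq t u -> forall tau, tensor_fun t tau = tensor_fun u tau.
Proof.
move=> tu tau; apply: (tu V (fun p v => Qval p tau *: v)) => [v a p p'|p a v v'].
  by rewrite /Qval linearP /= scalerDl scalerA.
by rewrite scalerDr !scalerA mulrC.
Qed.

Lemma Lambda_eq (t u : tensor) :
  tensor_eq t u -> tensor_eq (Lambda t) (Lambda u).
Proof.
move=> tu W B Bl Br; rewrite /Lambda !big_cat !big_map /= -!big_split /=.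
apply: (tu W (fun p v => B ((12 / twopii R) *: dE2 p) v + B p (L1 A v))).
  move=> v a p p' /=.
  have -> : (12 / twopii R) *: dE2 (a *: p + p') =
            a *: ((12 / twopii R) *: dE2 p) + (12 / twopii R) *: dE2 p'.
    by rewrite /dE2 mderivD mderivZ scalerDr !scalerA mulrC.
  by rewrite !Bl scalerDr addrACA.
by move=> p a v v' /=; rewrite linearP !Br scalerDr addrACA.
Qed.

End Forms.

(* Main.v *)
Require Import Defs.
From HB Require Import structures.
From mathcomp Require Import all_boot all_order all_algebra.
From mathcomp Require Import complex.
From mathcomp Require Import all_classical all_reals all_analysis.
From mathcomp Require Import ring lra zify.
From mathcomp Require mpoly.
Import -(notations) mpoly.
Set Implicit Arguments.
Unset Strict Implicit.
Unset Printing Implicit Defensive.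
Import Order.TTheory GRing.Theory Num.Theory.
Import numFieldNormedType.Exports.
Local Open Scope classical_set_scope.
Local Open Scope ring_scope.
Local Open Scope complex_scope.


(** The operator exp (E_2 L(1) / kap), where kap = 12 / (2 pi i), conjugates
    vector-valued forms into scalar ones. The constant kap is the one in
    E_2 (gamma tau) = j^2 (E_2 (tau) + kap X). The slash action contains the
    factor e^{c j L(1)}, which becomes e^{X L(1)} after commuting with j^{2 L(0)},
    and the shift of E_2 by kap X produces exactly its inverse. So if f is
    quasi-modular of weight k with components Q_n, then the coordinate of
    g = exp (E_2 L(1) / kap) f along a homogeneous vector e of degree d is a scalar
    quasi-modular form of weight k - 2d, and it is modular if f is ([coord_law]).
    Scalar quasi-modular forms are polynomials in E_2, E_4, E_6 ([quasi_rep]) and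
    scalar modular forms are polynomials in E_4, E_6 ([smod_rep]). Hence
    f = exp (- E_2 L(1) / kap) g comes from a tensor.

    The same conjugation turns the lowering operator into a derivative:
    on tensors, Lambda corresponds under exp (x_0 L(1) / kap) to
    kap d/dx_0 ([dE2_coordpoly], [telescope]). So the kernel of Lambda is the
    space of tensors for which the coordinates of g do not involve E_2. Conversely
    every vector E_2^a E_4^b E_6^c exp (- E_2 L(1) / kap) e is quasi-modular, and
    modular for a = 0 ([slash_exp]), and these vectors span the functions that come
    from tensors ([tensor_expand]). That a function determines its tensor is the
    algebraic independence of E_2, E_4, E_6 ([Qval_inj]).

    The scalar theory is developed from the q-expansions that define E_2, E_4, E_6.
    - The sums of (tau + n)^(-k) over n have q-expansions ([lipschitz]). The
      proof is by roots of unity: the average of a rational function over the points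
      z zeta^j, zeta^N = 1, is a value of the same function at z^N, and the average
      becomes the partial fraction series as N grows.
    - Summing over a lattice gives the transformation laws under tau -> -1/tau.
      The double series is absolutely convergent for k >= 4 ([eis_inv4]). For k = 2
      the two orders of summation differ by a limit of the cotangent ([latsum2_inv]);
      with the value of zeta(2) ([zeta2E]) this is the law of E_2 ([E2_inv]).
    - The discriminant is the solution of q dD/dq = E_2 D. It has no zeros
      and is modular of weight 12 by the law of E_2 ([Delta_inv]). Cusp forms are
      divisible by it, and forms of negative weight vanish ([smod_neg]), so that a
      form of weight less than 12 is determined by its constant term. This gives the
      modularity of E_4 and E_6, through the derivatives of E_2 and E_4, without
      values of zeta, as well as E_4^3 - E_6^2 = 1728 D and the structure
      of modular forms.
    - For a scalar quasi-modular form the last component function is modular. It is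
      removed by subtracting a multiple of a power of E_2. *)

(** * The modulus and limits of complex numbers *)

Section Cabs.
Variable R : realType.
Local Notation C := R[i].
Implicit Types (x y z : C) (a b : R).

(** The norm of R[i] takes values in R[i]; estimates are carried out in R. *)
Definition cabs z : R := ComplexField.Normc.normc z.

Lemma cabsE z : `|z| = (cabs z)%:C :> C.
Proof. by case: z. Qed.
Lemma cabs0 : cabs 0 = 0. Proof. exact: ComplexField.Normc.normc0. Qed.
Lemma cabs1 : cabs 1 = 1. Proof. exact: ComplexField.Normc.normc1. Qed.
Lemma cabsM x y : cabs (x * y) = cabs x * cabs y.
Proof. exact: ComplexField.Normc.normcM. Qed.
Lemma cabsV x : cabs x^-1 = (cabs x)^-1.
Proof. exact: ComplexField.Normc.normcV. Qed.
Lemma cabsN x : cabs (- x) = cabs x. Proof. exact: normcN. Qed.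
Lemma cabsD x y : cabs (x + y) <= cabs x + cabs y. Proof. exact: le_normcD. Qed.
Lemma cabsC x y : cabs (x - y) = cabs (y - x).
Proof. by rewrite -cabsN opprB. Qed.
Lemma cabsB x y : cabs (x - y) <= cabs x + cabs y.
Proof. by rewrite -(cabsN y); exact: cabsD. Qed.
Lemma cabs_ge0 x : 0 <= cabs x.
Proof. by case: x => a b; rewrite sqrtr_ge0. Qed.
Hint Resolve cabs_ge0 : core.
Lemma cabs_eq0 x : (cabs x == 0) = (x == 0).
Proof.
by apply/eqP/eqP => [/ComplexField.Normc.eq0_normc//|->]; exact: cabs0.
Qed.
Lemma cabs_gt0 x : (0 < cabs x) = (x != 0).
Proof. by rewrite lt_def cabs_eq0 cabs_ge0 andbT. Qed.
Lemma cabsX x n : cabs (x ^+ n) = cabs x ^+ n.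
Proof. by elim: n => [|n IH]; rewrite ?cabs1// !exprS cabsM IH. Qed.
Lemma cabs_exprz x (n : int) : cabs (x ^ n) = cabs x ^ n.
Proof.
case: n => n; first exact: cabsX.
by rewrite -[LHS]/(cabs (x ^- n.+1)) cabsV cabsX.
Qed.
Lemma cabs_real a : cabs a%:C = `|a|.
Proof. by rewrite /cabs /= expr0n addr0 sqrtr_sqr. Qed.
Lemma cabs_nat n : cabs n%:R = n%:R.
Proof. by rewrite -(rmorph_nat (real_complex R)) cabs_real ger0_norm. Qed.
Lemma cabs_sum I (r : seq I) (P : pred I) (F : I -> C) :
  cabs (\sum_(i <- r | P i) F i) <= \sum_(i <- r | P i) cabs (F i).
Proof.
elim/big_rec2: _ => [|i a x _ ha]; first by rewrite cabs0.
by apply: le_trans (cabsD _ _) _; rewrite lerD2l.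
Qed.
Lemma cabs_Re z : `|complex.Re z| <= cabs z.
Proof.
case: z => a b; rewrite /cabs/= -sqrtr_sqr ler_sqrt ?addr_ge0 ?sqr_ge0//.
by rewrite lerDl sqr_ge0.
Qed.
Lemma cabs_Im z : `|complex.Im z| <= cabs z.
Proof.
case: z => a b; rewrite /cabs/= -sqrtr_sqr ler_sqrt ?addr_ge0 ?sqr_ge0//.
by rewrite lerDr sqr_ge0.
Qed.
Lemma cabs_ReIm z : cabs z <= `|complex.Re z| + `|complex.Im z|.
Proof.
rewrite {1}(complexE z); apply: le_trans (cabsD _ _) _; rewrite cabsM !cabs_real lerD2l.
by rewrite {1}/cabs /= expr0n expr1n add0r sqrtr1 mul1r.
Qed.
Lemma sqr_cabs z : cabs z ^+ 2 = complex.Re z ^+ 2 + complex.Im z ^+ 2.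
Proof. by case: z => a b; rewrite sqr_sqrtr ?addr_ge0 ?sqr_ge0. Qed.
Lemma le_cabsB x y : cabs x - cabs y <= cabs (x - y).
Proof. by rewrite lerBlDr; apply: le_trans (cabsD _ _); rewrite subrK. Qed.

(** Expressed through the real distances to the limit, so that comparison of real
    sequences applies. *)
Definition ctends (u : nat -> C) (l : C) :=
  (fun n => cabs (u n - l)) @ \oo --> (0 : R).

Lemma ctendsP (u : nat -> C) (l : C) :
  ctends u l <-> ((u : nat -> C^o) @ \oo --> (l : C^o)).
Proof.
split=> [/(@cvgrPdist_lt _ R^o) h|/(@cvgrPdist_lt _ C^o) h].
  apply/(@cvgrPdist_lt _ C^o) => e; rewrite ltcE /= => /andP[/eqP ei e0].
  have := h _ e0; apply: filterS => n /=.
  rewrite cabsE sub0r normrN ger0_norm//.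
  by rewrite cabsC ltcE /= ei eqxx.
apply/(@cvgrPdist_lt _ R^o) => e e0; have := h e%:C; rewrite ltcR => /(_ e0).
apply: filterS => n /=; rewrite cabsE ltcR sub0r normrN ger0_norm //.
by rewrite cabsC.
Qed.

Lemma ctends_unique (u : nat -> C) (l l' : C) :
  ctends u l -> ctends u l' -> l = l'.
Proof.
move=> /ctendsP h /ctendsP h'.
exact: (@cvg_unique C^o (@norm_hausdorff _ C^o) _ _ _ _ h h').
Qed.

Lemma eq_ctends (u v : nat -> C) (l : C) :
  (\forall n \near \oo, u n = v n) -> ctends u l -> ctends v l.
Proof.
move=> uv; apply: cvg_trans; apply: near_eq_cvg.
by apply: filterS uv => n ->.
Qed.

Lemma ctends_cst (l : C) : ctends (fun=> l) l.
Proof. by apply/ctendsP; exact: cvg_cst. Qed.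

Lemma ctendsD (u v : nat -> C) (l l' : C) :
  ctends u l -> ctends v l' -> ctends (fun n => u n + v n) (l + l').
Proof. by move=> /ctendsP h /ctendsP h'; apply/ctendsP; exact: (cvgD h h'). Qed.

Lemma ctendsN (u : nat -> C) (l : C) :
  ctends u l -> ctends (fun n => - u n) (- l).
Proof. by move=> /ctendsP h; apply/ctendsP; exact: (cvgN h). Qed.

Lemma ctendsB (u v : nat -> C) (l l' : C) :
  ctends u l -> ctends v l' -> ctends (fun n => u n - v n) (l - l').
Proof. by move=> h /ctendsN; exact: ctendsD. Qed.

Lemma ctendsM (u v : nat -> C) (l l' : C) :
  ctends u l -> ctends v l' -> ctends (fun n => u n * v n) (l * l').
Proof. by move=> /ctendsP h /ctendsP h'; apply/ctendsP; exact: (cvgM h h'). Qed.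

Lemma ctendsZ (a : C) (u : nat -> C) (l : C) :
  ctends u l -> ctends (fun n => a * u n) (a * l).
Proof. exact/ctendsM/ctends_cst. Qed.

Lemma ctendsX k (u : nat -> C) (l : C) :
  ctends u l -> ctends (fun n => u n ^+ k) (l ^+ k).
Proof.
move=> h; elim: k => [|k IH]; first exact: ctends_cst.
rewrite exprS (_ : (fun n => _) = (fun n => u n * u n ^+ k)).
  exact: ctendsM.
by apply/funext => n; rewrite exprS.
Qed.

Lemma ctendsV (u : nat -> C) (l : C) : l != 0 ->
  ctends u l -> ctends (fun n => (u n)^-1) l^-1.
Proof.
by move=> l0 /ctendsP h; apply/ctendsP; exact: (@cvgV C _ _ _ _ _ l0 h).
Qed.

Lemma ctends_shift (u : nat -> C) (l : C) :
  ctends (fun n => u n.+1) l <-> ctends u l.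
Proof. by rewrite /ctends -(cvg_shiftS (fun n => cabs (u n - l))). Qed.

Lemma ctends_sub (u : nat -> C) (l : C) (f : nat -> nat) :
  (forall n, n <= f n)%N -> ctends u l -> ctends (fun n => u (f n)) l.
Proof.
move=> hf h; apply: (@cvg_comp _ _ _ f (fun n => cabs (u n - l)) _ _ _ _ h).
move=> A [N _ hN]; exists N => //= n Nn; apply: hN; exact: leq_trans Nn (hf n).
Qed.

Lemma ctends_le (u : nat -> C) (l : C) (v : nat -> R) :
  (\forall n \near \oo, cabs (u n - l) <= v n) -> v @ \oo --> (0 : R) ->
  ctends u l.
Proof.
move=> uv v0; apply: (@squeeze_cvgr _ _ _ _ (fun=> 0) v _ _ 0 (cvg_cst _) v0).
by apply: filterS uv => n ->; rewrite cabs_ge0.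
Qed.

Lemma ctends_cabs (u : nat -> C) (l : C) :
  ctends u l -> (fun n => cabs (u n)) @ \oo --> cabs l.
Proof.
move=> ul; apply/cvgrPdist_lt => e e0.
have /(@cvgrPdist_lt _ R^o) /(_ e e0) := ul; apply: filterS => n /=.
rewrite sub0r normrN ger0_norm//; apply: le_lt_trans.
rewrite ler_norml; have := le_cabsB l (u n); have := le_cabsB (u n) l.
rewrite (cabsC l) => h1 h2; apply/andP; split; lra.
Qed.

Lemma ctends_norm_le (u : nat -> C) (l : C) (B : R) :
  ctends u l -> (\forall n \near \oo, cabs (u n) <= B) -> cabs l <= B.
Proof.
move=> /ctends_cabs ul uB; rewrite -(cvg_lim _ ul)//; apply: limr_le => //.
by apply/cvg_ex; exists (cabs l).
Qed.

Lemma ctends_ReIm (u : nat -> C) a b :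
  (fun n => complex.Re (u n)) @ \oo --> a ->
  (fun n => complex.Im (u n)) @ \oo --> b -> ctends u (a +i* b).
Proof.
move=> ha hb; apply: (@ctends_le _ _
    (fun n => `|complex.Re (u n) - a| + `|complex.Im (u n) - b|)).
  by near=> n; apply: le_trans (cabs_ReIm _) _; case: (u n).
rewrite -[0]addr0; apply: cvgD.
  have := cvgB ha (cvg_cst a); rewrite subrr => h.
  by have := cvg_norm (h _ _); rewrite normr0; exact.
have := cvgB hb (cvg_cst b); rewrite subrr => h.
by have := cvg_norm (h _ _); rewrite normr0; exact.
Unshelve. all: by end_near. Qed.

End Cabs.
#[global] Hint Resolve cabs_ge0 : core.

(** * Absolutely convergent series of complex numbers *)

Arguments cabs {R} z : simpl never.
Arguments cexp {R} z : simpl never.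
Arguments qexp {R} tau : simpl never.
Arguments twopii R : simpl never.

Section Series.
Variable R : realType.
Local Notation C := R[i].
Implicit Types (u v : nat -> C) (l : C) (b : nat -> R).

Definition csum u : C := limn (series u : nat -> C^o).

Definition csums u l := ctends (fun n => \sum_(0 <= i < n) u i) l.

Lemma csumE u l : csums u l -> csum u = l.
Proof.
move=> /ctendsP h; 
exact: (@cvg_lim C^o (@norm_hausdorff _ C^o) _ _ _ _ _ h).
Qed.

Lemma eq_csum u v : u =1 v -> csum u = csum v.
Proof. by move=> /funext ->. Qed.

Definition dominated u (B : R) := forall n, \sum_(0 <= i < n) cabs (u i) <= B.

(** Absolute convergence is a bound for the partial sums of the moduli; a bound is
    what passes to dominated families. *)
Definition asum u := exists B, dominated u B.

Lemma real_abs_cvg (a : nat -> R) B :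
  (forall n, \sum_(0 <= i < n) `|a i| <= B) -> cvgn (series a).
Proof.
move=> h; apply: normed_cvg; apply: nondecreasing_is_cvgn.
  apply: (@nondecreasing_series _ (fun n => `|a n|) predT 0) => n _ _.
  exact: normr_ge0.
by exists B => _ [n _ <-]; exact: h.
Qed.

Lemma asum_cvg u : asum u -> csums u (csum u).
Proof.
move=> [B hB].
have cr : cvgn (series (fun n => complex.Re (u n))).
  apply: (@real_abs_cvg _ B) => n; apply: le_trans (hB n).
  by apply: ler_sum => i _; exact: cabs_Re.
have ci : cvgn (series (fun n => complex.Im (u n))).
  apply: (@real_abs_cvg _ B) => n; apply: le_trans (hB n).
  by apply: ler_sum => i _; exact: cabs_Im.
suff h : csums u (limn (series (fun n => complex.Re (u n)))
      +i* limn (series (fun n => complex.Im (u n)))) by rewrite (csumE h).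
apply: ctends_ReIm.
  apply: cvg_trans cr; apply: near_eq_cvg; near=> n.
  by rewrite /series /= (raddf_sum (@complex.Re R)).
apply: cvg_trans ci; apply: near_eq_cvg; near=> n.
by rewrite /series /= (raddf_sum (@complex.Im R)).
Unshelve. all: by end_near. Qed.

Lemma dominated_csum u B : dominated u B -> cabs (csum u) <= B.
Proof.
move=> h; apply: (ctends_norm_le (asum_cvg (ex_intro _ B h))).
by near=> n; apply: le_trans (cabs_sum _ _ _) (h n).
Unshelve. all: by end_near. Qed.

Lemma dominated_le u b B : (forall n, cabs (u n) <= b n) ->
  (forall n, \sum_(0 <= i < n) b i <= B) -> dominated u B.
Proof. by move=> ub hB n; apply: le_trans (hB n); apply: ler_sum. Qed.

Lemma asum_le u v : (forall n, cabs (u n) <= cabs (v n)) ->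
  asum v -> asum u.
Proof. by move=> uv [B hB]; exists B; exact: dominated_le uv hB. Qed.

Lemma asumD u v : asum u -> asum v -> asum (fun n => u n + v n).
Proof.
move=> [B hB] [B' hB']; exists (B + B') => n.
apply: le_trans (lerD (hB n) (hB' n)); rewrite -big_split /=.
by apply: ler_sum => i _; exact: cabsD.
Qed.

Lemma asumZ u a : asum u -> asum (fun n => a * u n).
Proof.
move=> [B hB]; exists (cabs a * B) => n.
under eq_bigr do rewrite cabsM; rewrite -mulr_sumr.
by apply: ler_wpM2l; rewrite ?cabs_ge0//; exact: hB.
Qed.

Lemma asumN u : asum u -> asum (fun n => - u n).
Proof. by apply: asum_le => n; rewrite cabsN. Qed.

Lemma csumD u v : asum u -> asum v ->
  csum (fun n => u n + v n) = csum u + csum v.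
Proof.
move=> hu hv; apply: csumE.
apply: eq_ctends (ctendsD (asum_cvg hu) (asum_cvg hv)).
by near=> n; rewrite big_split.
Unshelve. all: by end_near. Qed.

Lemma csumZ u a : asum u -> csum (fun n => a * u n) = a * csum u.
Proof.
move=> hu; apply: csumE; apply: eq_ctends (ctendsZ a (asum_cvg hu)).
by near=> n; rewrite mulr_sumr.
Unshelve. all: by end_near. Qed.

Lemma csumN u : asum u -> csum (fun n => - u n) = - csum u.
Proof.
by move=> hu; rewrite -mulN1r -csumZ//; apply: eq_csum => n; rewrite mulN1r.
Qed.

Lemma csum_sum I (r : seq I) (F : I -> nat -> C) :
  (forall i, asum (F i)) ->
  asum (fun n => \sum_(i <- r) F i n) /\
  csum (fun n => \sum_(i <- r) F i n) = \sum_(i <- r) csum (F i).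
Proof.
move=> hF; elim: r => [|i r [IH1 IH2]].
  split; first by exists 0 => n; rewrite big1 // => i _; rewrite big_nil cabs0.
  rewrite big_nil; apply: csumE.
  apply: eq_ctends (ctends_cst 0); near=> n.
  by rewrite big1 // => k _; rewrite big_nil.
have e : (fun n => \sum_(j <- i :: r) F j n) =
         (fun n => F i n + \sum_(j <- r) F j n).
  by apply/funext => n; rewrite big_cons.
by rewrite big_cons e; split; [exact: asumD | rewrite csumD ?IH2].
Unshelve. all: by end_near. Qed.

Lemma asum_shift u : asum u -> asum (fun n => u n.+1).
Proof.
move=> [B hB]; exists B => n; apply: le_trans (hB n.+1).
by rewrite [leRHS]big_nat_recl//; apply: ler_wpDl; rewrite ?cabs_ge0.
Qed.

Lemma csum_recl u : asum u -> csum u = u 0%N + csum (fun n => u n.+1).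
Proof.
move=> hu; apply/csumE/ctends_shift.
apply: eq_ctends (ctendsD (ctends_cst _) (asum_cvg (asum_shift hu))).
by near=> n; rewrite big_nat_recl.
Unshelve. all: by end_near. Qed.

Lemma csum_split n u : asum u ->
  asum (fun k => u (n + k)%N) /\
  csum u = \sum_(0 <= i < n) u i + csum (fun k => u (n + k)%N).
Proof.
elim: n u => [|n IH] u hu; first by rewrite big_geq// add0r.
have [IH1 IH2] := IH _ (asum_shift hu); split => //.
by rewrite csum_recl// IH2 addrA big_nat_recl.
Qed.

Lemma csum_finite n u : (forall k, u (n + k)%N = 0) ->
  asum u /\ csum u = \sum_(0 <= i < n) u i.
Proof.
move=> un; have su : asum u.
  exists (\sum_(0 <= i < n) cabs (u i)) => m.
  case: (leqP m n) => mn; first by rewrite [leRHS](@big_cat_nat _ _ _ m)//= lerDl sumr_ge0 => // *; exact: cabs_ge0.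
  rewrite (@big_cat_nat _ _ _ n) ?(ltnW mn)//= -[leRHS]addr0 lerD2l.
  rewrite big_nat big1// => i /andP[ni _].
  by rewrite -(subnKC ni) un cabs0.
split=> //; have [_ ->] := csum_split n su.
rewrite (_ : csum _ = 0) ?addr0//; apply: csumE.
apply: eq_ctends (ctends_cst 0); near=> m.
by rewrite big1.
Unshelve. all: by end_near. Qed.

Lemma tail_small b B e : (forall n, 0 <= b n) ->
  (forall n, \sum_(0 <= i < n) b i <= B) -> 0 < e ->
  exists N, forall n, \sum_(0 <= i < n) b (N + i)%N <= e.
Proof.
move=> b0 hB e0.
have cb : cvgn (series b).
  by apply: (@real_abs_cvg _ B) => n; under eq_bigr do rewrite ger0_norm//.
have /(@cvgrPdist_lt _ R^o) /(_ _ e0) [N _ hN] := cb.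
exists N => n.
have h1 : \sum_(0 <= i < N + n) b i <= limn (series b).
  apply: nondecreasing_cvgn_le => //.
  by apply: nondecreasing_series => k _ _.
have := hN N (leqnn _); rewrite /= /series /= => h2.
move: h1; rewrite (@big_cat_nat _ _ _ N)//= ?leq_addr//.
rewrite -{2}[N]add0n big_addn addKn.
under [X in _ + X <= _ -> _]eq_bigr do rewrite addnC.
move: h2; rewrite ltr_norml => /andP[_ h2] h1; lra.
Qed.

Lemma cvg_sum0 (f : nat -> nat -> R) N :
  (forall i, f i @ \oo --> (0 : R)) ->
  (fun K => \sum_(0 <= i < N) f i K) @ \oo --> (0 : R).
Proof.
move=> f0; elim: N => [|N IH].
  rewrite (_ : (fun _ => _) = (fun=> 0)); first exact: cvg_cst.
  by apply/funext => K; rewrite big_geq.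
rewrite (_ : (fun _ => _) = (fun K => \sum_(0 <= i < N) f i K + f N K)).
  by have := cvgD IH (f0 N); rewrite addr0; exact.
by apply/funext => K; rewrite big_nat_recr.
Qed.

(** A tail is small uniformly in K since b dominates it; the finitely many
    remaining terms converge one by one. *)
Lemma tannery (a : nat -> nat -> C) (l : nat -> C) b B :
  (forall n, ctends (fun K => a K n) (l n)) ->
  (\forall K \near \oo, forall n, cabs (a K n) <= b n) ->
  (forall n, \sum_(0 <= i < n) b i <= B) ->
  asum l /\ ctends (fun K => csum (a K)) (csum l).
Proof.
move=> al ab hB.
have lb n : cabs (l n) <= b n.
  by apply: ctends_norm_le (al n) _; apply: filterS ab => K; apply.
have b0 n : 0 <= b n by exact: le_trans (cabs_ge0 _) (lb n).
have sl : asum l by exists B; exact: dominated_le lb hB.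
split=> //; apply/(@cvgrPdist_lt _ R^o) => e e0.
have e4 : 0 < e / 4 by lra.
have [N hN] := tail_small b0 hB e4.
have hfin : (fun K => \sum_(0 <= i < N) cabs (a K i - l i)) @ \oo --> (0 : R).
  by apply: (@cvg_sum0 (fun i K => cabs (a K i - l i))) => i; exact: al.
have /(@cvgrPdist_lt _ R^o) /(_ _ e4) hfin' := hfin.
near=> K.
have hab : forall n, cabs (a K n) <= b n by near: K.
have sa : asum (a K) by exists B; exact: dominated_le hab hB.
have [sa1 ->] := csum_split N sa; have [sl1 ->] := csum_split N sl.
rewrite sub0r normrN ger0_norm ?cabs_ge0// opprD addrACA -sumrB.
apply: le_lt_trans (cabsD _ _) _.
have h1 : cabs (\sum_(0 <= i < N) (a K i - l i)) < e / 4.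
  apply: le_lt_trans (cabs_sum _ _ _) _.
  have : `|0 - \sum_(0 <= i < N) cabs (a K i - l i)| < e / 4 by near: K.
  by rewrite sub0r normrN ger0_norm// sumr_ge0// => i _; exact: cabs_ge0.
have h2 : cabs (csum (fun k => a K (N + k)%N)) <= e / 4.
  by apply: dominated_csum; apply: dominated_le hN => n.
have h3 : cabs (csum (fun k => l (N + k)%N)) <= e / 4.
  by apply: dominated_csum; apply: dominated_le hN => n.
apply: le_lt_trans (lerD (lexx _) (cabsB _ _)) _; lra.
Unshelve. all: by end_near. Qed.

(** Interchange of two summations: apply dominated convergence to the partial
    sums of the rows. *)
Lemma csum_swap (w : nat -> nat -> C) (a b : nat -> R) A B :
  (forall m n, cabs (w m n) <= a m * b n) ->
  (forall n, 0 <= a n) ->  (forall n, 0 <= b n) ->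
  (forall n, \sum_(0 <= i < n) a i <= A) ->
  (forall n, \sum_(0 <= i < n) b i <= B) ->
  [/\ asum (fun n => csum (w^~ n)), asum (fun m => csum (w m))
    & csum (fun m => csum (w m)) = csum (fun n => csum (w^~ n))].
Proof.
move=> wab a0 b0 hA hB.
have A0 : 0 <= A by have := hA 0%N; rewrite big_geq.
have B0 : 0 <= B by have := hB 0%N; rewrite big_geq.
have rowd m : dominated (w m) (a m * B).
  apply: (dominated_le (wab m)) => n.
  by rewrite -mulr_sumr ler_wpM2l.
have cold n : dominated (w^~ n) (A * b n).
  apply: (@dominated_le _ (fun m => a m * b n)) => [m|N]; first exact: wab.
  by rewrite -mulr_suml ler_wpM2r.
have sc : asum (fun n => csum (w^~ n)).
  exists (A * B); apply: (@dominated_le _ (fun n => A * b n)) => [n|N].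
    by apply: dominated_csum.
  by rewrite -mulr_sumr ler_wpM2l.
have h1 m : ctends (fun N => \sum_(0 <= n < N) w m n) (csum (w m)).
  by apply: asum_cvg; exists (a m * B); exact: rowd.
have h2 : \forall N \near \oo, forall m, cabs (\sum_(0 <= n < N) w m n) <= a m * B.
  by near=> N => m; apply: le_trans (cabs_sum _ _ _) _; exact: rowd.
have h3 n : \sum_(0 <= i < n) a i * B <= A * B by rewrite -mulr_suml ler_wpM2r.
have [sr cv] := tannery h1 h2 h3.
split=> //; apply/esym/csumE; apply: eq_ctends cv; near=> N.
have sw n : asum (w^~ n) by exists (A * b n); exact: cold.
by have [_ ->] := csum_sum (index_iota 0 N) sw.
Unshelve. all: by end_near. Qed.

End Series.

(** * Complex derivatives *)

Section Cder.
Variable R : realType.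
Local Notation C := R[i].
Implicit Types (f g : C -> C) (z w h d : C).

Definition cder f z d := is_derive (z : C^o) (1 : C^o) (f : C^o -> C^o) d.

Lemma cderP f z d :
  cder f z d <-> forall e : R, 0 < e -> exists2 del : R, 0 < del &
    forall h, cabs h < del -> cabs (f (z + h) - f z - h * d) <= e * cabs h.
Proof.
split.
  case=> fd /= Ed e e0.
  have := fd; rewrite /derivable => /cvgP.
  rewrite -/(derive (f : C^o -> C^o) (z : C^o) (1 : C^o)) Ed.
  move=> /(@cvgrPdist_le _ C^o) /(_ e%:C); rewrite ltcR => /(_ e0).
  rewrite near_withinE => -[del /= del0 hdel].
  move: del0; rewrite ltcE /= => /andP[/eqP deli del0].
  exists (complex.Re del) => // h hd.
  have [->|h0] := eqVneq h 0; first by rewrite addr0 subrr mul0r subr0 cabs0 mulr0.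
  have := hdel h; rewrite /ball_ /= sub0r normrN cabsE ltcE /= deli eqxx hd.
  move=> /(_ isT h0); rewrite cabsE lecR.
  rewrite -[_ *: _]/(_ * _) -[h *: 1]/(h * 1) mulr1 /shift /= addrC -addrA => hh.
  rewrite -ler_pdivrMr ?cabs_gt0//; apply: le_trans hh.
  rewrite (_ : _ + (_ - _) = - (h * (- (h^-1 * (f (h + z) - f z)) + d))).
    by rewrite cabsN cabsM mulrAC divff ?mul1r// cabs_eq0.
  by rewrite [h + z]addrC; field.
move=> H.
have cv : (fun h : C^o => h^-1 *: ((f \o shift (z : C^o)) (h *: (1 : C^o)) - f z) : C^o)
    @ 0^' --> (d : C^o).
  apply/(@cvgrPdist_le _ C^o) => e; rewrite ltcE /= => /andP[/eqP ei e0].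
  have [del del0 hdel] := H _ e0.
  rewrite near_withinE; exists del%:C => /=; first by rewrite ltcR.
  move=> h; rewrite /ball_ /= sub0r normrN cabsE ltcR => hd h0.
  rewrite cabsE lecE /= ei eqxx /=.
  rewrite -[_ *: _]/(_ * _) -[h *: 1]/(h * 1) mulr1 /shift /=.
  have := hdel _ hd; rewrite -ler_pdivrMr ?cabs_gt0//; apply: le_trans.
  rewrite (_ : f (z + h) - _ - _ = - (h * (d - h^-1 * (f (h + z) - f z)))).
    by rewrite cabsN cabsM mulrAC divff ?mul1r// cabs_eq0.
  by rewrite [h + z]addrC; field.
split; first by apply/cvg_ex; exists d.
by apply: cvg_lim => //; exact: (@norm_hausdorff _ C^o).
Qed.

Lemma cder_quad f z d (K del : R) : 0 < del ->
  (forall h, cabs h < del -> cabs (f (z + h) - f z - h * d) <= K * cabs h ^+ 2) ->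
  cder f z d.
Proof.
move=> del0 H; apply/cderP => e e0.
have K0 : 0 <= K.
  have hd : cabs (del / 2)%:C < del by rewrite cabs_real ger0_norm; lra.
  have := le_trans (cabs_ge0 _) (H _ hd).
  by rewrite pmulr_lge0 // exprn_gt0// cabs_real normr_gt0; lra.
exists (Num.min del (e / (K + 1))); first by rewrite lt_min del0 divr_gt0//; lra.
move=> h; rewrite lt_min => /andP[h1 h2]; apply: le_trans (H _ h1) _.
rewrite expr2 mulrA ler_wpM2r ?cabs_ge0//.
move: h2; rewrite ltr_pdivlMr; last lra.
have := cabs_ge0 h; nra.
Qed.

Lemma cder_unique f z d d' : cder f z d -> cder f z d' -> d = d'.
Proof. by move=> [_ <-] [_ <-]. Qed.

Lemma cder_eq f z d d' : d = d' -> cder f z d -> cder f z d'.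
Proof. by move=> ->. Qed.

Lemma cder_cst a z : cder (fun=> a) z 0.
Proof. exact: is_derive_cst. Qed.

Lemma cder_id z : cder id z 1.
Proof. exact: is_derive_id. Qed.

Lemma cderD f g z d d' : cder f z d -> cder g z d' ->
  cder (fun w => f w + g w) z (d + d').
Proof. by move=> h h'; exact: is_deriveD. Qed.

Lemma cderM f g z d d' : cder f z d -> cder g z d' ->
  cder (fun w => f w * g w) z (f z * d' + g z * d).
Proof.
move=> h h'.
exact: (@is_deriveM C C^o (f : C^o -> C^o) (g : C^o -> C^o) z 1 d d').
Qed.

Lemma cderZ f z d a : cder f z d -> cder (fun w => a * f w) z (a * d).
Proof.
by move=> h; apply: cder_eq (cderM (cder_cst a z) h); rewrite mulr0 addr0.
Qed.

Lemma cderN f z d : cder f z d -> cder (fun w => - f w) z (- d).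
Proof. by move=> h; exact: is_deriveN. Qed.

Lemma cderV f z d : f z != 0 -> cder f z d ->
  cder (fun w => (f w)^-1) z (- d / f z ^+ 2).
Proof.
move=> fz [h1 h2].
have h3 := @derivableV C C^o (f : C^o -> C^o) z 1 fz h1.
have h4 := @deriveV C C^o (f : C^o -> C^o) z 1 fz h1.
split; first exact: h3.
rewrite h4 h2 -[_ *: _]/(_ * _) mulNr mulrC mulNr//.
Qed.

Lemma cderX f z d n : cder f z d ->
  cder (fun w => f w ^+ n) z (n%:R * f z ^+ n.-1 * d).
Proof.
move=> h; elim: n => [|n IH].
  by apply: cder_eq (cder_cst _ _); rewrite !mul0r.
have := cderM h IH; rewrite (_ : (fun w => _) = (fun w => f w ^+ n.+1)); last first.
  by apply/funext => w; rewrite exprS.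
apply: cder_eq; rewrite /= -natr1.
case: n {IH} => [|n] /=; first by ring.
rewrite [f z ^+ n.+1]exprS; ring.
Qed.

Lemma cder_comp f g z d d' : cder f z d -> cder g (f z) d' ->
  cder (fun w => g (f w)) z (d' * d).
Proof.
move=> /cderP hf /cderP hg; apply/cderP => e e0.
have d0 := cabs_ge0 d; have d0' := cabs_ge0 d'.
pose e1 := e / (2 * (cabs d + 1)).
have e10 : 0 < e1 by rewrite divr_gt0//; lra.
pose e2 := Num.min 1 (e / (2 * (cabs d' + 1))).
have e20 : 0 < e2 by rewrite lt_min ltr01 divr_gt0//; lra.
have e21 : e2 <= 1 by rewrite ge_min lexx.
have e22 : e2 * cabs d' <= e / 2.
  have : e2 <= e / (2 * (cabs d' + 1)) by rewrite ge_min lexx orbT.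
  rewrite ler_pdivlMr; last lra.
  nra.
have e11 : e1 * (cabs d + 1) = e / 2.
  by rewrite /e1; field; rewrite gt_eqF//; lra.
have [r1 r10 h1] := hg _ e10; have [r2 r20 h2] := hf _ e20.
exists (Num.min r2 (r1 / (cabs d + 1))); first by rewrite lt_min r20 divr_gt0//; lra.
move=> h; rewrite lt_min => /andP[hr2]; rewrite ltr_pdivlMr; last lra.
move=> hr1; have hs := h2 _ hr2.
pose k := f (z + h) - f z; pose s := k - h * d.
have hh := cabs_ge0 h.
have kE : cabs k <= cabs h * (cabs d + e2).
  have -> : k = h * d + s by rewrite /s; ring.
  apply: le_trans (cabsD _ _) _; rewrite cabsM mulrDr lerD2l mulrC.
  exact: hs.
have kr1 : cabs k < r1 by apply: le_lt_trans kE _; nra.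
have := h1 _ kr1; have -> : f z + k = f (z + h) by rewrite /k; ring.
move=> hk.
have -> : g (f (z + h)) - g (f z) - h * (d' * d) =
  (g (f (z + h)) - g (f z) - k * d') + s * d' by rewrite /s; ring.
apply: le_trans (cabsD _ _) _; rewrite cabsM.
have hs' : cabs s <= e2 * cabs h by [].
have t1 : cabs s * cabs d' <= cabs h * (e / 2) by nra.
have t2 : e1 * cabs k <= cabs h * (e / 2).
  rewrite -e11; apply: le_trans (ler_wpM2l (ltW e10) kE) _.
  rewrite mulrCA; apply: ler_wpM2l => //; apply: ler_wpM2l; [exact: ltW|lra].
lra.
Qed.

Lemma cder_near f g z d (del : R) : 0 < del ->
  (forall h, cabs h < del -> f (z + h) = g (z + h)) -> cder f z d -> cder g z d.
Proof.
move=> del0 fg /cderP H; apply/cderP => e e0; have [r r0 hr] := H _ e0.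
exists (Num.min del r); first by rewrite lt_min del0.
move=> h; rewrite lt_min => /andP[h1 h2]; rewrite -fg//.
have := fg 0; rewrite cabs0 addr0 => /(_ del0) <-; exact: hr.
Qed.

Lemma uhp_ball z h : uhp z -> cabs h < complex.Im z -> uhp (z + h).
Proof.
rewrite /uhp /=; case: z => a b; case: h => x y /= b0 hb.
have := le_lt_trans (cabs_Im (x +i* y)) hb; rewrite /= ltr_norml; lra.
Qed.

Lemma cder_uhp f g z d : uhp z -> (forall w, uhp w -> f w = g w) ->
  cder f z d -> cder g z d.
Proof.
move=> hz fg; apply: (@cder_near _ _ _ _ (complex.Im z)) => //.
by move=> h hh; apply: fg; exact: uhp_ball.
Qed.

(** A function with vanishing derivative on the upper half-plane is constant:
    restrict it to segments and apply the real mean value theorem to its real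
    and imaginary parts. *)
Lemma cder0_cst f : (forall z, uhp z -> cder f z 0) ->
  forall z w, uhp z -> uhp w -> f z = f w.
Proof.
move=> f0 z w hz hw.
have seg (t : R) : 0 <= t <= 1 -> uhp (z + t%:C * (w - z)).
  move=> /andP[t0 t1]; move: hz hw; rewrite /uhp /=.
  case: z w => [a b] [a' b'] /= b0 b0'.
  rewrite !mul0r !addr0; nra.
suff H (p : C -> R) : (forall x y, p (x - y) = p x - p y) ->
    (forall x, `|p x| <= cabs x) -> p (f z) = p (f w).
  have e1 := H (@complex.Re R) (fun x y => raddfB _ x y) (@cabs_Re R).
  have e2 := H (@complex.Im R) (fun x y => raddfB _ x y) (@cabs_Im R).
  by case: (f z) (f w) e1 e2 => ? ? [? ?] /= -> ->.
move=> pB ple.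
pose g t := p (f (z + t%:C * (w - z))).
have gder (t : R) : 0 <= t <= 1 -> is_derive (t : R^o) (1 : R^o) (g : R^o -> R^o) 0.
  move=> /seg ht.
  have /cderP H := f0 _ ht.
  have cv : (fun h : R^o => h^-1 *: ((g \o shift (t : R^o)) (h *: (1 : R^o)) - g t) : R^o)
    @ 0^' --> (0 : R^o).
    apply/(@cvgrPdist_le _ R^o) => e e0.
    pose c := cabs (w - z).
    have c0 : 0 <= c by exact: cabs_ge0.
    have e1 : 0 < e / (c + 1) by rewrite divr_gt0//; lra.
    have [del del0 hdel] := H _ e1.
    rewrite near_withinE; exists (del / (c + 1)) => /=; first by rewrite divr_gt0//; lra.
    move=> h; rewrite /ball_ /= sub0r normrN => hd h0.
    rewrite sub0r normrN normrM normfV mulrC ler_pdivrMr ?normr_gt0//.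
    rewrite -[h *: 1]/(h * 1) mulr1 /g -pB; apply: le_trans (ple _) _.
    have hc : cabs (h%:C * (w - z)) < del.
      rewrite cabsM cabs_real -/c; move: hd; rewrite ltr_pdivlMr; last lra.
      apply: le_lt_trans; rewrite ler_wpM2l//; lra.
    have := hdel _ hc; rewrite mulr0 subr0.
    have -> : z + t%:C * (w - z) + h%:C * (w - z) = z + (h + t)%:C * (w - z).
      by rewrite rmorphD /=; ring.
    move=> /le_trans; apply; rewrite cabsM cabs_real -/c mulrCA mulrC.
    rewrite ler_wpM2r// mulrAC ler_pdivrMr; last lra.
    by rewrite ler_wpM2l ?ltW//; lra.
  split; first by apply/cvg_ex; exists 0.
  by apply: cvg_lim => //; exact: (@norm_hausdorff _ R^o).
have gc : {within `[0, 1], continuous g}.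
  apply: derivable_within_continuous => t.
  by rewrite in_itv /= => /gder[].
have [|x hx] := @MVT R g (fun=> 0) 0 1 ltr01 _ gc.
  by move=> x; rewrite in_itv /= => /andP[a b]; apply: gder; rewrite !ltW.
rewrite mul0r => /eqP; rewrite subr_eq0 /g mul0r addr0 mul1r addrCA subrr addr0.
by move=> /eqP.
Qed.

End Cder.

(** * Power series converging in the unit disc *)

Section PowerSeries.
Variable R : realType.
Local Notation C := R[i].
Implicit Types (a b c : nat -> C) (z w h : C).

(** Convergence in the open unit disc, in the form of the Cauchy-Hadamard
    criterion. *)
Definition tame c := forall r : R, 0 < r < 1 ->
  exists M : R, forall n, cabs (c n) * r ^+ n <= M.

Definition peval c z : C := csum (fun n => c n * z ^+ n).

Lemma geom_sum_le (x : R) n : 0 <= x < 1 ->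
  \sum_(0 <= i < n) x ^+ i <= (1 - x)^-1.
Proof.
move=> /andP[x0 x1]; rewrite -[leRHS]mul1r ler_pdivlMr; last lra.
rewrite big_mkord; have := subrX1 x n; have := exprn_ge0 n x0; lra.
Qed.

Lemma tame_bound c (r : R) : tame c -> 0 < r < 1 ->
  exists2 B : R, 0 <= B & forall n, \sum_(0 <= i < n) cabs (c i) * r ^+ i <= B.
Proof.
move=> hc /andP[r0 r1]; pose s := (1 + r) / 2.
have s01 : 0 < s < 1 by rewrite /s; lra.
have [M hM] := hc _ s01.
have M0 : 0 <= M by have := hM 0%N; rewrite expr0 mulr1; apply: le_trans (cabs_ge0 _).
have rs : 0 <= r / s < 1.
  case/andP: s01 => s0 _; rewrite divr_ge0 ?ltW//= ltr_pdivrMr// /s; lra.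
exists (M * (1 - r / s)^-1) => [|n].
  by rewrite mulr_ge0// invr_ge0; lra.
apply: le_trans (ler_wpM2l M0 (geom_sum_le n rs)); rewrite mulr_sumr.
apply: ler_sum => i _; rewrite expr_div_n mulrA ler_pdivlMr ?exprn_gt0//; last lra.
by rewrite mulrAC ler_wpM2r// exprn_ge0// ltW.
Qed.

Lemma tame_summable c z : tame c -> cabs z < 1 ->
  asum (fun n => c n * z ^+ n).
Proof.
move=> hc z1; pose r := (1 + cabs z) / 2.
have z0 := cabs_ge0 z.
have r01 : 0 < r < 1 by rewrite /r; lra.
have [B _ hB] := tame_bound hc r01; exists B.
apply: dominated_le hB => n; rewrite cabsM cabsX ler_wpM2l ?cabs_ge0//.
by rewrite lerXn2r ?nnegrE//; rewrite /r; lra.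
Qed.

Lemma tame_le a c : (forall n, cabs (a n) <= cabs (c n)) -> tame c -> tame a.
Proof.
move=> ac hc r r01; have [M hM] := hc _ r01; exists M => n.
by apply: le_trans (hM n); rewrite ler_wpM2r// exprn_ge0//; lra.
Qed.

Lemma tameD a b : tame a -> tame b -> tame (fun n => a n + b n).
Proof.
move=> ha hb r r01; have [M hM] := ha _ r01; have [N hN] := hb _ r01.
exists (M + N) => n; apply: le_trans (lerD (hM n) (hN n)).
by rewrite -mulrDl ler_wpM2r ?cabsD// exprn_ge0//; lra.
Qed.

Lemma tameZ w a : tame a -> tame (fun n => w * a n).
Proof.
move=> ha r r01; have [M hM] := ha _ r01; exists (cabs w * M) => n.
by rewrite cabsM -mulrA ler_wpM2l ?cabs_ge0.
Qed.

Lemma tameN a : tame a -> tame (fun n => - a n).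
Proof. by apply: tame_le => n; rewrite cabsN. Qed.

Lemma tame1 : tame (fun _ => 1).
Proof.
by move=> r /andP[r0 r1]; exists 1 => n; rewrite cabs1 mul1r exprn_ile1 ?ltW.
Qed.

(** A slightly larger radius absorbs the factor n. *)
Lemma tame_muln a : tame a -> tame (fun n => n%:R * a n).
Proof.
move=> ha r /andP[r0 r1]; pose s := (1 + r) / 2.
have s01 : 0 < s < 1 by rewrite /s; lra.
have [M hM] := ha _ s01.
have rs : 0 <= r / s < 1.
  case/andP: s01 => s0 _; rewrite divr_ge0 ?ltW//= ltr_pdivrMr// /s; lra.
exists (M * (1 - r / s)^-1) => n; rewrite cabsM cabs_nat.
have h1 : n%:R * (r / s) ^+ n <= (1 - r / s)^-1.
  apply: le_trans (geom_sum_le n rs).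
  rewrite mulr_natl -[X in _ *+ X <= _]subn0 -sumr_const_nat.
  rewrite big_nat [leRHS]big_nat; apply: ler_sum => i /andP[_ ni].
  by case/andP: rs => rs0 rs1; apply: ler_wiXn2l; rewrite ?(ltW rs1) ?(ltnW ni).
have h2 : cabs (a n) * s ^+ n * (n%:R * (r / s) ^+ n) <= M * (1 - r / s)^-1.
  apply: ler_pM => //; first by rewrite mulr_ge0 ?cabs_ge0// exprn_ge0//; lra.
  by rewrite mulr_ge0// exprn_ge0//; lra.
apply: le_trans h2; rewrite [(r / s) ^+ n]expr_div_n le_eqVlt; apply/orP; left; apply/eqP.
have s0 : s ^+ n != 0 by rewrite expf_neq0// gt_eqF//; lra.
by move: (s ^+ n) s0 => S S0; field.
Qed.

Lemma tame_shift a : tame a -> tame (fun n => a n.+1).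
Proof.
move=> ha r /andP[r0 r1]; have [M hM] := ha r (introT andP (conj r0 r1)).
exists (M / r) => n; rewrite ler_pdivlMr// -mulrA -exprSr; exact: hM.
Qed.

Definition qshift a n := if n is m.+1 then a m else 0 : C.

Lemma tame_qshift a : tame a -> tame (qshift a).
Proof.
move=> ha r /andP[r0 r1]; have [M hM] := ha r (introT andP (conj r0 r1)).
exists (Num.max 0 (M * r)) => -[|n]; first by rewrite cabs0 mul0r le_max lexx.
by rewrite le_max /= exprSr mulrA (ler_wpM2r (ltW r0))// orbT.
Qed.

Lemma tame_finite N c : (forall n, (N <= n)%N -> c n = 0) -> tame c.
Proof.
move=> cN r /andP[r0 r1]; exists (\sum_(0 <= i < N) cabs (c i)) => n.
have h k m : 0 <= \sum_(k <= i < m) cabs (c i).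
  by rewrite sumr_ge0// => i _; exact: cabs_ge0.
case: (leqP N n) => nN; first by rewrite cN// cabs0 mul0r.
apply: (@le_trans _ _ (cabs (c n))).
  by rewrite ler_piMr ?cabs_ge0// exprn_ile1 ?ltW.
rewrite (@big_cat_nat _ _ _ n)//= ?(ltnW nN)//.
by rewrite [X in _ + X]big_ltn// addrCA lerDl addr_ge0.
Qed.

Definition pconst w : nat -> C := fun n => if n is 0%N then w else 0.

Lemma tame_const w : tame (pconst w).
Proof. by apply: (@tame_finite 1) => -[]. Qed.

Lemma peval_const w z : peval (pconst w) z = w.
Proof.
have h k : pconst w (1 + k) * z ^+ (1 + k) = 0 by rewrite mul0r.
have [_ e] := csum_finite (u := fun n => pconst w n * z ^+ n) h.
by rewrite /peval e big_nat1 expr0 mulr1.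
Qed.

Lemma pevalD a b z : tame a -> tame b -> cabs z < 1 ->
  peval (fun n => a n + b n) z = peval a z + peval b z.
Proof.
move=> ha hb z1; rewrite /peval -csumD; [|exact: tame_summable..].
by apply: eq_csum => n; rewrite mulrDl.
Qed.

Lemma pevalZ w a z : tame a -> cabs z < 1 ->
  peval (fun n => w * a n) z = w * peval a z.
Proof.
move=> ha z1; rewrite /peval -csumZ; last exact: tame_summable.
by apply: eq_csum => n; rewrite mulrA.
Qed.

Lemma peval_recl a z : tame a -> cabs z < 1 ->
  peval a z = a 0%N + z * peval (fun n => a n.+1) z.
Proof.
move=> ha z1; rewrite /peval csum_recl; last exact: tame_summable.
rewrite expr0 mulr1 -csumZ; last exact: tame_summable (tame_shift ha) z1.
by congr (_ + _); apply: eq_csum => n; rewrite exprS; ring.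
Qed.

Lemma peval_qshift a z : tame a -> cabs z < 1 -> peval (qshift a) z = z * peval a z.
Proof.
by move=> ha z1; rewrite peval_recl//= ?add0r//; exact: tame_qshift.
Qed.

Definition conv a b n : C := \sum_(i < n.+1) a i * b (n - i)%N.

(** The Cauchy product as a double array: one order of summation gives the product
    of the two sums, the other the series of [conv]. *)
Definition convw a b z i N : C :=
  if (i <= N)%N then a i * b (N - i)%N * z ^+ N else 0.

Lemma conv_swap a b z : tame a -> tame b -> cabs z < 1 ->
  exists A B : nat -> R, [/\ forall i N, cabs (convw a b z i N) <= A i * B N,
    forall n, 0 <= A n, forall n, 0 <= B n,
    exists K, forall n, \sum_(0 <= i < n) A i <= K &
    exists K, forall n, \sum_(0 <= i < n) B i <= K].
Proof.
move=> ha hb z1; pose rho := (1 + cabs z) / 2; have z0 := cabs_ge0 z.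
have r01 : 0 < rho < 1 by rewrite /rho; lra.
have [M hM] := ha _ r01; have [N hN] := hb _ r01.
have M0 : 0 <= M by have := hM 0%N; rewrite expr0 mulr1; apply: le_trans (cabs_ge0 _).
have N0 : 0 <= N by have := hN 0%N; rewrite expr0 mulr1; apply: le_trans (cabs_ge0 _).
pose t := cabs z / rho.
have t01 : 0 <= t < 1.
  case/andP: r01 => r0 _; rewrite /t divr_ge0 ?z0 ?(ltW r0)//= ltr_pdivrMr// /rho; lra.
pose s := (1 + t) / 2.
have s01 : 0 < s < 1 by rewrite /s; lra.
have ts : 0 <= t / s < 1.
  apply/andP; split; first by apply: divr_ge0; lra.
  by rewrite ltr_pdivrMr; rewrite ?/s; lra.
exists (fun i => M * N * s ^+ i), (fun n => (t / s) ^+ n); split.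
- move=> i n; rewrite /convw; case: ifP => [i_n|_]; last first.
    by rewrite cabs0 !mulr_ge0// ?exprn_ge0//; lra.
  have h1 : cabs (a i * b (n - i)%N * z ^+ n) <= M * N * t ^+ n.
    rewrite !cabsM cabsX /t expr_div_n mulrA ler_pdivlMr ?exprn_gt0//; last lra.
    rewrite mulrAC ler_wpM2r ?exprn_ge0//.
    have -> : rho ^+ n = rho ^+ i * rho ^+ (n - i) by rewrite -exprD subnKC.
    rewrite mulrACA ler_pM ?mulr_ge0 ?cabs_ge0 ?exprn_ge0//; lra.
  apply: le_trans h1 _; rewrite -[leRHS]mulrA ler_wpM2l ?mulr_ge0//.
  rewrite [(t / s) ^+ n]expr_div_n mulrA ler_pdivlMr ?exprn_gt0//; last lra.
  rewrite mulrC ler_wpM2r ?exprn_ge0//; first lra.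
  by rewrite ler_wiXn2l//; lra.
- by move=> n; rewrite !mulr_ge0// exprn_ge0//; lra.
- by move=> n; rewrite exprn_ge0//; lra.
- exists (M * N * (1 - s)^-1) => n; rewrite -mulr_sumr ler_wpM2l ?mulr_ge0//.
  by apply: geom_sum_le; lra.
- by exists (1 - t / s)^-1 => n; exact: geom_sum_le.
Qed.

Lemma tame_conv a b : tame a -> tame b -> tame (conv a b).
Proof.
move=> ha hb r r01; pose s := (1 + r) / 2.
have s01 : 0 < s < 1 by rewrite /s; lra.
have [A A0 hA] := tame_bound ha r01; have [N hN] := hb _ r01.
exists (A * N) => n; rewrite (le_trans (ler_wpM2r _ (cabs_sum _ _ _)))//.
  by rewrite exprn_ge0//; lra.
have := hA n.+1; rewrite big_mkord => hAn.
have N0 : 0 <= N by have := hN 0%N; rewrite expr0 mulr1; apply: le_trans (cabs_ge0 _).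
apply: le_trans (ler_wpM2r N0 hAn); rewrite !mulr_suml; apply: ler_sum => i _.
have hi : (i <= n)%N by rewrite -ltnS.
have -> : r ^+ n = r ^+ i * r ^+ (n - i) by rewrite -exprD subnKC.
rewrite cabsM mulrACA ler_wpM2l//.
by rewrite mulr_ge0 ?cabs_ge0// exprn_ge0//; lra.
Qed.

Lemma pevalM a b z : tame a -> tame b -> cabs z < 1 ->
  peval (conv a b) z = peval a z * peval b z.
Proof.
move=> ha hb z1; have [A [B [hw A0 B0 [K1 hA] [K2 hB]]]] := conv_swap ha hb z1.
set w := convw a b z in hw.
have [_ _ e] := csum_swap hw A0 B0 hA hB.
have row i : csum (w i) = peval b z * (a i * z ^+ i).
  have sw : asum (w i).
    by exists (A i * K2); apply: (dominated_le (hw i)) => n; rewrite -mulr_sumr ler_wpM2l.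
  have [_ ->] := csum_split i sw.
  rewrite big_nat big1 ?add0r; last first.
    by move=> j /andP[_ ji]; rewrite /w /convw leqNgt ji.
  rewrite mulrC -csumZ; last exact: tame_summable.
  apply: eq_csum => k; rewrite /w /convw leq_addr addKn exprD; ring.
rewrite [peval a z * _]mulrC /(peval a z) -csumZ; last exact: tame_summable.
rewrite -(eq_csum row) e /peval; apply: eq_csum => N.
have h k : w (N.+1 + k)%N N = 0 by rewrite /w /convw leqNgt leq_addr.
have [_ ->] := csum_finite (u := w^~ N) h.
rewrite /conv mulr_suml big_mkord; apply: eq_bigr => i _.
by rewrite /w /convw -ltnS ltn_ord.
Qed.

(** A quadratic remainder that is uniform in a disc: multiplied by c_n and summed
    over n it yields the derivative of a power series. The factor rho ^+ 2 stands for
    a division of rho ^+ n. *)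
Lemma expr_taylor2 z h (rho : R) n : 0 <= rho -> cabs z <= rho -> cabs (z + h) <= rho ->
  rho ^+ 2 * cabs ((z + h) ^+ n - z ^+ n - h * (n%:R * z ^+ n.-1))
    <= n%:R ^+ 2 * rho ^+ n * cabs h ^+ 2.
Proof.
move=> r0 z1 zh1; have h0 := cabs_ge0 h; elim: n => [|n IH].
  by rewrite !expr0 subrr mul0r mulr0 subr0 cabs0 expr0n !mul0r mulr0.
set e := (z + h) ^+ n - _ - _ in IH.
have -> : (z + h) ^+ n.+1 - z ^+ n.+1 - h * (n.+1%:R * z ^+ n.+1.-1) =
   (z + h) * e + n%:R * z ^+ n.-1 * h ^+ 2.
  rewrite /e -natr1 !exprS /=; case: n {IH e} => [|n] /=; first by rewrite !expr0; ring.
  by rewrite !exprS; ring.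
have t1 : rho ^+ 2 * cabs ((z + h) * e) <= rho * (n%:R ^+ 2 * rho ^+ n * cabs h ^+ 2).
  rewrite cabsM mulrCA.
  apply: ler_pM => //; rewrite ?cabs_ge0 ?mulr_ge0 ?exprn_ge0 ?cabs_ge0//.
have t2 : rho ^+ 2 * cabs (n%:R * z ^+ n.-1 * h ^+ 2) <= n%:R * rho ^+ n.+1 * cabs h ^+ 2.
  rewrite 2!cabsM !cabsX cabs_nat mulrA ler_wpM2r ?exprn_ge0//.
  case: n {IH e t1} => [|n] /=; first by rewrite !mul0r mulr0.
  have hz : cabs z ^+ n <= rho ^+ n by rewrite lerXn2r ?nnegrE ?cabs_ge0.
  have h1 := mulr_ge0 (ler0n R n.+1) (mulr_ge0 r0 r0).
  have := ler_wpM2l h1 hz; rewrite expr2 !exprS; lra.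
apply: le_trans (ler_wpM2l (exprn_ge0 2 r0) (cabsD _ _)) _.
rewrite mulrDr; apply: le_trans (lerD t1 t2) _.
rewrite -natr1 [rho ^+ n.+1]exprS; set X := rho ^+ n; set Y := cabs h ^+ 2.
have X0 : 0 <= X by rewrite exprn_ge0.
have Y0 : 0 <= Y by rewrite exprn_ge0.
have n0 : 0 <= n%:R :> R by exact: ler0n.
have XY := mulr_ge0 r0 (mulr_ge0 X0 Y0).
have := mulr_ge0 n0 XY; lra.
Qed.

Definition dcoef c n : C := n.+1%:R * c n.+1.

Lemma tame_dcoef c : tame c -> tame (dcoef c).
Proof. by move=> /tame_muln /tame_shift. Qed.

Lemma peval_cder c z : tame c -> cabs z < 1 -> cder (peval c) z (peval (dcoef c) z).
Proof.
move=> hc z1; have z0 := cabs_ge0 z.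
pose rho := (1 + cabs z) / 2.
have r01 : 0 < rho < 1 by rewrite /rho; lra.
have hc2 := tame_muln (tame_muln hc).
have [B B0 hB] := tame_bound hc2 r01.
apply: (@cder_quad _ _ _ _ (rho ^- 2 * B) (rho - cabs z)); first by rewrite /rho; lra.
move=> h hh.
have zh : cabs (z + h) <= rho by apply: le_trans (cabsD _ _) _; lra.
have zr : cabs z <= rho by rewrite /rho; lra.
have -> : peval (dcoef c) z = csum (fun n => c n * (n%:R * z ^+ n.-1)).
  rewrite csum_recl ?mul0r ?mulr0 ?add0r.
    by apply: eq_csum => n; rewrite /dcoef /=; ring.
  have sm := tame_summable (tame_dcoef hc) z1.
  case: sm => K hK; exists K => -[|n]; first by rewrite big_geq// (le_trans _ (hK 0%N)) ?big_geq.
  rewrite big_nat_recl// mul0r mulr0 cabs0 add0r; apply: le_trans (hK n).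
  apply: ler_sum => i _; rewrite /dcoef /=.
  by rewrite le_eqVlt; apply/orP; left; apply/eqP; congr cabs; ring.
have s1 := tame_summable hc (le_lt_trans zh (proj2 (andP r01))).
have s2 := tame_summable hc z1.
have s3 : asum (fun n => c n * (n%:R * z ^+ n.-1)).
  have sm := tame_summable (tame_dcoef hc) z1.
  case: sm => K hK; exists K => -[|n]; first by rewrite big_geq// (le_trans _ (hK 0%N)) ?big_geq.
  rewrite big_nat_recl// mul0r mulr0 cabs0 add0r; apply: le_trans (hK n).
  apply: ler_sum => i _; rewrite /dcoef /=.
  by rewrite le_eqVlt; apply/orP; left; apply/eqP; congr cabs; ring.
have s2' := asumN s2.
rewrite /peval -(csumN s2) -(csumD s1 s2').
rewrite -csumZ// -csumN; last exact: asumZ.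
rewrite -csumD; first last.
- exact: asumN (asumZ h s3).
- exact: asumD s1 (asumN s2).
rewrite -mulrA; apply: dominated_csum.
apply: (@dominated_le _ _ (fun n => rho ^- 2 * (cabs (n%:R * (n%:R * c n)) * rho ^+ n * cabs h ^+ 2))).
  move=> n; rewrite [leRHS]mulrC ler_pdivlMr ?exprn_gt0//; last lra.
  have -> : c n * (z + h) ^+ n - c n * z ^+ n - h * (c n * (n%:R * z ^+ n.-1)) =
     c n * ((z + h) ^+ n - z ^+ n - h * (n%:R * z ^+ n.-1)) by ring.
  rewrite !cabsM cabs_nat -mulrA [_ * rho ^+ 2]mulrC.
  rewrite [leLHS]mulrCA; have := expr_taylor2 n (ltW (proj1 (andP r01))) zr zh.
  move=> /(ler_wpM2l (cabs_ge0 (c n))) /le_trans; apply.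
  by rewrite le_eqVlt; apply/orP; left; apply/eqP; ring.
move=> n; rewrite -mulr_sumr ler_wpM2l ?invr_ge0 ?exprn_ge0//; first lra.
by rewrite -mulr_suml ler_wpM2r ?exprn_ge0 ?cabs_ge0.
Qed.

End PowerSeries.

(** * The exponential function and the roots of unity *)

Section Exponential.
Variable R : realType.
Local Notation C := R[i].
Implicit Types (z w h tau : C) (x y : R).

Lemma sin_le x : `|sin x| <= `|x|.
Proof.
wlog x0 : x / 0 <= x.
  move=> H; case: (leP 0 x) => [/H//|x0].
  by rewrite -normrN -sinN -[leRHS]normrN; apply: H; lra.
have [|t _ e] := @MVT_segment R sin cos 0 x x0 (fun t _ => is_derive_sin t).
  by apply: continuous_subspaceT; exact: continuous_sin.
move: e; rewrite sin0 !subr0 => ->; rewrite normrM ler_piMl ?normr_ge0//.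
exact: cos_max.
Qed.

Lemma cos_ge x : 1 - x ^+ 2 / 2 <= cos x.
Proof.
have -> : cos x = 1 - 2 * sin (x / 2) ^+ 2.
  have {1}-> : x = (x / 2) *+ 2 by lra.
  by rewrite cos_mulr2n sin2cos2; lra.
have := sin_le (x / 2); rewrite -(@ler_pXn2r _ 2) ?nnegrE// -!normrX.
rewrite !ger0_norm ?sqr_ge0// => h; nra.
Qed.

Lemma sin_sub_le x : `|x| <= 1 -> `|sin x - x| <= x ^+ 2.
Proof.
wlog x0 : x / 0 <= x.
  move=> H; case: (leP 0 x) => [/H//|x0 h].
  have := H (- x); rewrite normrN sinN sqrrN -opprD normrN; apply => //; lra.
rewrite ger0_norm// => x1.
have [|t] := @MVT_segment R sin cos 0 x x0 (fun t _ => is_derive_sin t).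
  by apply: continuous_subspaceT; exact: continuous_sin.
rewrite in_itv /= => /andP[t0 tx]; rewrite sin0 !subr0 => ->.
have h1 := cos_ge t; have h2 := cos_le1 t.
rewrite ler_norml; apply/andP; split; nra.
Qed.

Lemma expR_sub_le x : `|x| <= 1 / 2 -> 0 <= expR x - 1 - x <= 2 * x ^+ 2.
Proof.
rewrite ler_norml => /andP[x1 x2].
have h1 := expR_ge1Dx x; have h2 := expR_ge1Dx (- x).
have h3 : expR x * expR (- x) = 1 by rewrite -expRD subrr expR0.
have h4 := expR_gt0 x; apply/andP; split; first lra.
have h5 : expR x * (1 - x) <= 1 by rewrite -[leRHS]h3 (ler_wpM2l (ltW h4)).
nra.
Qed.

(** A weak form of Jordan's inequality: the mean value theorem up to 1, and
    monotonicity from 1 to pi / 2 < 2. *)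
Lemma sin_lower x : 0 <= x <= pi / 2 -> cos 1 / 2 * x <= sin x.
Proof.
move=> /andP[x0 x1]; have c1 := @cos1_gt0 R; have c2 := cos_le1 (1 : R).
have ph := @pihalf_lt2 R; have ph1 := @pihalf_ge1 R.
have H (t : R) : 0 <= t <= 1 -> cos 1 * t <= sin t.
  move=> /andP[t0 t1].
  have [|u] := @MVT_segment R sin cos 0 t t0 (fun t _ => is_derive_sin t).
    by apply: continuous_subspaceT; exact: continuous_sin.
  rewrite in_itv /= => /andP[u0 ut]; rewrite sin0 !subr0 => ->.
  rewrite ler_wpM2r//; have [->//|u1] := eqVneq u 1.
  apply/ltW; rewrite ltr_cos ?in_itv /=; last 2 first.
  - by apply/andP; split; lra.
  - by apply/andP; split; lra.
  by rewrite lt_neqAle u1; lra.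
case: (leP x 1) => hx; first by have := H x; rewrite x0 hx => /(_ isT); nra.
have h1 : sin 1 <= sin x.
  apply/ltW; rewrite ltr_sin// in_itv /=; apply/andP; split; lra.
have := H 1; rewrite ler01 lexx => /(_ isT); nra.
Qed.

Lemma cexpE x y : cexp (x +i* y) = (expR x * cos y) +i* (expR x * sin y).
Proof. by rewrite /cexp /=; simpc. Qed.

Lemma cexpD z w : cexp (z + w) = cexp z * cexp w.
Proof.
case: z w => [a b] [c d]; rewrite -[_ + _]/((a + c) +i* (b + d)) !cexpE.
rewrite -[RHS]/(_ +i* _) expRD cosD sinD; congr (_ +i* _); ring.
Qed.

Lemma cabs_cexp z : cabs (cexp z) = expR (complex.Re z).
Proof.
apply/eqP; rewrite -(@eqrXn2 _ 2)// ?cabs_ge0 ?expR_ge0//.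
case: z => a b; rewrite sqr_cabs cexpE /= !exprMn -mulrDr cos2Dsin2 mulr1//.
Qed.

Lemma cexp_neq0 z : cexp z != 0.
Proof. by rewrite -cabs_eq0 cabs_cexp gt_eqF// expR_gt0. Qed.

Lemma cexp0 : cexp 0 = 1 :> C.
Proof. by rewrite cexpE expR0 cos0 sin0 mulr1 mulr0. Qed.

Lemma cexpMn z n : cexp (n%:R * z) = cexp z ^+ n.
Proof.
elim: n => [|n IH]; first by rewrite mul0r cexp0.
by rewrite -natr1 mulrDl mul1r cexpD IH exprSr.
Qed.

Lemma cexp_taylor h : cabs h <= 1 / 2 -> cabs (cexp h - 1 - h) <= 8 * cabs h ^+ 2.
Proof.
case: h => a b hh; have ha := le_trans (cabs_Re (a +i* b)) hh.
have hb := le_trans (cabs_Im (a +i* b)) hh; rewrite /= in ha hb.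
have h1 := cabs_Re (a +i* b); have h2 := cabs_Im (a +i* b); rewrite /= in h1 h2.
set m := cabs (a +i* b) in hh h1 h2 *.
have m0 : 0 <= m by exact: cabs_ge0.
have a2 : a ^+ 2 <= m ^+ 2 by rewrite -[leLHS]real_normK ?num_real// lerXn2r ?nnegrE.
have b2 : b ^+ 2 <= m ^+ 2 by rewrite -[leLHS]real_normK ?num_real// lerXn2r ?nnegrE.
have /andP[e1 e2] := expR_sub_le ha.
have c1 := cos_ge b; have c2 := cos_le1 b; have c3 := cos_geN1 b.
have sb : `|sin b - b| <= b ^+ 2 by apply: sin_sub_le; lra.
apply: le_trans (cabs_ReIm _) _; rewrite cexpE /=.
have t1 : `|expR a * cos b - 1 - a| <= 4 * m ^+ 2.
  have -> : expR a * cos b - 1 - a = (expR a - 1 - a) * cos b + (1 + a) * (cos b - 1).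
    by ring.
  move: ha; rewrite ler_norml => /andP[ha1 ha2].
  rewrite ler_norml; apply/andP; split; nra.
have t2 : `|expR a * sin b - 0 - b| <= 4 * m ^+ 2.
  have -> : expR a * sin b - 0 - b = expR a * (sin b - b) + (expR a - 1) * b by ring.
  apply: le_trans (ler_normD _ _) _; rewrite !normrM.
  have ea : expR a <= 2 by move: ha; rewrite ler_norml => /andP[ha1 ha2]; nra.
  have ea0 := expR_gt0 a; rewrite (ger0_norm (ltW ea0)).
  have k1 : expR a * `|sin b - b| <= 2 * m ^+ 2.
    have sb' := le_trans sb b2; have := normr_ge0 (sin b - b); nra.
  have k2 : `|expR a - 1| <= 2 * m.
    have -> : expR a - 1 = (expR a - 1 - a) + a by ring.
    apply: le_trans (ler_normD _ _) _; rewrite (ger0_norm e1); nra.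
  have := ler_pM (normr_ge0 _) (normr_ge0 _) k2 h2; nra.
rewrite -![X in `|X|]/(_ - 1 - a) in t1 *; lra.
Qed.

Lemma cexp_cder z : cder (@cexp R) z (cexp z).
Proof.
apply: (@cder_quad _ _ _ _ (8 * cabs (cexp z)) (1 / 2)) => [|h hh]; first lra.
have -> : cexp (z + h) - cexp z - h * cexp z = cexp z * (cexp h - 1 - h).
  by rewrite cexpD; ring.
rewrite cabsM mulrAC [leRHS]mulrC ler_wpM2l ?cabs_ge0//.
by apply: cexp_taylor; exact: ltW.
Qed.

Lemma twopiiM x y : twopii R * (x +i* y) = (- (2 * pi * y)) +i* (2 * pi * x).
Proof.
by rewrite /twopii; apply/eqP; rewrite eq_complex /=; apply/andP; split;
  apply/eqP; ring.
Qed.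

Lemma twopii_neq0 : twopii R != 0.
Proof.
rewrite /twopii mulf_neq0 ?eq_complex /= ?oner_eq0 ?andbF//.
by rewrite negb_and gt_eqF// mulr_gt0// pi_gt0.
Qed.

Lemma qexpE x y : qexp (x +i* y) =
  (expR (- (2 * pi * y)) * cos (2 * pi * x)) +i* (expR (- (2 * pi * y)) * sin (2 * pi * x)).
Proof. by rewrite /qexp twopiiM cexpE. Qed.

Lemma qexpD z w : qexp (z + w) = qexp z * qexp w.
Proof. by rewrite /qexp mulrDr cexpD. Qed.

Lemma qexpMn z n : qexp (n%:R * z) = qexp z ^+ n.
Proof. by rewrite /qexp mulrCA cexpMn. Qed.

Lemma cabs_qexp tau : cabs (qexp tau) = expR (- (2 * pi * complex.Im tau)).
Proof. by case: tau => x y; rewrite cabs_cexp twopiiM. Qed.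

Lemma cabs_qexp_lt1 tau : uhp tau -> cabs (qexp tau) < 1.
Proof.
by move=> h; rewrite cabs_qexp expR_lt1 oppr_lt0 !mulr_gt0// pi_gt0.
Qed.

Lemma cabs_qexp_gt0 tau : 0 < cabs (qexp tau).
Proof. by rewrite cabs_qexp expR_gt0. Qed.

Lemma qexp_neq0 tau : qexp tau != 0.
Proof. exact: cexp_neq0. Qed.

Lemma qexp1 : qexp 1 = 1 :> C.
Proof.
rewrite qexpE mulr0 oppr0 expR0 mulr1 !mul1r.
by rewrite mulr_natl cos2pi sin2pi.
Qed.

Lemma qexp_nat n : qexp n%:R = 1 :> C.
Proof. by rewrite -[n%:R]mulr1 qexpMn qexp1 expr1n. Qed.

Lemma qexpS tau : qexp (tau + 1) = qexp tau.
Proof. by rewrite qexpD qexp1 mulr1. Qed.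

Lemma qexp_cder tau : cder (@qexp R) tau (twopii R * qexp tau).
Proof.
rewrite mulrC; apply: (@cder_comp _ (fun w => twopii R * w)); last exact: cexp_cder.
by rewrite -[X in cder _ _ X]mulr1; apply: cderZ; exact: cder_id.
Qed.

Lemma qexp_onto (r : R) : 0 < r < 1 -> exists2 y : R, 0 < y & cabs (qexp (0 +i* y)) = r.
Proof.
move=> /andP[r0 r1]; exists (- ln r / (2 * pi)).
  by rewrite divr_gt0 ?mulr_gt0 ?pi_gt0// oppr_gt0 ln_lt0// r0.
rewrite cabs_qexp /= mulrC divfK ?opprK ?lnK ?posrE//.
by rewrite gt_eqF// mulr_gt0// pi_gt0.
Qed.

(** With r = |q| and s the sine, |1 - q|^2 = (1 - r)^2 + 4 r s^2. *)
Lemma cabs_1Bqexp tau : 0 <= complex.Im tau ->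
  `|sin (pi * complex.Re tau)| <= cabs (1 - qexp tau).
Proof.
case: tau => x y /= y0; rewrite -(@ler_pXn2r _ 2) ?nnegrE ?cabs_ge0//.
rewrite -normrX ger0_norm ?sqr_ge0// sqr_cabs qexpE /=.
have -> : 2 * pi * x = (pi * x) *+ 2 by rewrite -[RHS]mulr_natl mulrA.
rewrite cos_mulr2n sin_mulr2n.
have r0 := expR_gt0 (- (2 * pi * y)).
have r1 : expR (- (2 * pi * y)) <= 1.
  by rewrite -[leRHS]expR0 ler_expR oppr_le0 !mulr_ge0// pi_ge0.
set r := expR _ in r0 r1 *; have cs := cos2Dsin2 (pi * x).
set s := sin _ in cs *; set c := cos _ in cs *.
have -> : (1 - r * (c ^+ 2 *+ 2 - 1)) ^+ 2 + (0 - r * ((c * s) *+ 2)) ^+ 2 =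
   (1 - r) ^+ 2 + 4 * r * s ^+ 2.
  clearbody r s c; have -> : s ^+ 2 = 1 - c ^+ 2 by rewrite -cs; ring.
  transitivity ((1 - r * (c ^+ 2 *+ 2 - 1)) ^+ 2 + 4 * r ^+ 2 * c ^+ 2 * s ^+ 2).
    by ring.
  have -> : s ^+ 2 = 1 - c ^+ 2 by rewrite -cs; ring.
  by ring.
have s0 := sqr_ge0 s; have s1 : s ^+ 2 <= 1 by rewrite -cs lerDr sqr_ge0.
have t1 : 0 <= (1 - r) ^+ 2 * (1 - s ^+ 2) by rewrite mulr_ge0 ?sqr_ge0// subr_ge0.
have t2 : 0 <= s ^+ 2 * (r ^+ 2 + 2 * r) by rewrite mulr_ge0//; nra.
lra.
Qed.

Definition zeta (N : nat) : C := qexp (N%:R^-1).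

Lemma zeta_pow N m : (0 < N)%N -> (zeta N ^+ m == 1) = (N %| m)%N.
Proof.
move=> N0; have Nn : N%:R != 0 :> C by rewrite pnatr_eq0 -lt0n.
have zN k : zeta N ^+ (N * k) = 1.
  by rewrite -qexpMn natrM mulrAC divff// mul1r qexp_nat.
apply/idP/idP => [|/dvdnP[k ->]]; last by rewrite mulnC zN.
rewrite {1}(divn_eq m N) exprD mulnC zN mul1r /dvdn.
have := ltn_pmod m N0; set r := (m %% N)%N => rN.
case: (posnP r) => [->//|r0]; rewrite /zeta -qexpMn.
have -> : r%:R / N%:R = (r%:R / N%:R)%:C :> C.
  by rewrite rmorphM /= fmorphV /= !rmorph_nat.
rewrite qexpE mulr0 oppr0 expR0 !mul1r => /eqP[h _].
have NR : 0 < N%:R :> R by rewrite ltr0n.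
have t0 : 0 < sin (pi * (r%:R / N%:R) : R).
  apply: sin_gt0_pi; rewrite mulr_gt0 ?pi_gt0 ?divr_gt0 ?ltr0n//=.
  by rewrite gtr_pMr ?pi_gt0// ltr_pdivrMr// mul1r ltr_nat.
move: h; have -> : 2 * pi * (r%:R / N%:R) = (pi * (r%:R / N%:R)) *+ 2 :> R.
  by rewrite -[RHS]mulr_natl mulrA.
rewrite cos_mulr2n cos2sin2 => h.
have : sin (pi * (r%:R / N%:R) : R) ^+ 2 = 0 by lra.
by move/eqP; rewrite sqrf_eq0 gt_eqF.
Qed.

Lemma zeta_sum N m : (0 < N)%N ->
  \sum_(j < N) zeta N ^+ (j * m) = if (N %| m)%N then N%:R else 0.
Proof.
move=> N0; under eq_bigr do rewrite mulnC exprM.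
rewrite -zeta_pow//; case: eqP => [->|/eqP h].
  by under eq_bigr do rewrite expr1n; rewrite sumr_const card_ord.
have := subrX1 (zeta N ^+ m) N.
have -> : zeta N ^+ m ^+ N = 1 by apply/eqP; rewrite -exprM zeta_pow// dvdn_mull.
rewrite subrr => /esym/eqP; rewrite mulf_eq0 subr_eq0 (negbTE h) /=.
by move/eqP.
Qed.

Lemma cabs_zeta N : cabs (zeta N) = 1.
Proof.
rewrite cabs_qexp -[N%:R](rmorph_nat (real_complex R)) -fmorphV /=.
by rewrite mulr0 oppr0 expR0.
Qed.

(** The powers zeta^m sum up to 0 unless N divides m, so that averaging selects a
    residue class of exponents. *)
Lemma zeta_average (c : nat -> C) N k z : (0 < N)%N -> tame c -> cabs z < 1 ->
  asum (fun m => if (N %| m + k)%N then c m * z ^+ m else 0) /\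
  \sum_(j < N) peval c (z * zeta N ^+ j) * zeta N ^+ (j * k) =
  N%:R * csum (fun m => if (N %| m + k)%N then c m * z ^+ m else 0).
Proof.
move=> N0 hc z1.
have zz j : cabs (z * zeta N ^+ j) = cabs z.
  by rewrite cabsM cabsX cabs_zeta expr1n mulr1.
have s0 : asum (fun m => if (N %| m + k)%N then c m * z ^+ m else 0).
  apply: asum_le (tame_summable hc z1) => n.
  by case: ifP => // _; rewrite cabs0 cabs_ge0.
split=> //; rewrite -csumZ//.
have sj (j : 'I_N) : asum (fun m => zeta N ^+ (j * k) * (c m * (z * zeta N ^+ j) ^+ m)).
  by apply: asumZ; apply: tame_summable; rewrite ?zz.
have [_] := csum_sum (index_enum 'I_N) sj.
rewrite [in X in _ = X](eq_bigr (fun j : 'I_N =>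
    peval c (z * zeta N ^+ j) * zeta N ^+ (j * k))); last first.
  move=> j _; rewrite /peval [RHS]mulrC -csumZ//; apply: tame_summable => //.
  by rewrite zz.
move=> <-; apply: eq_csum => m.
rewrite (eq_bigr (fun j : 'I_N => c m * z ^+ m * zeta N ^+ (j * (m + k)))).
  rewrite -mulr_sumr zeta_sum//; case: ifP => _; last by rewrite !mulr0.
  by rewrite mulrC.
move=> j _; rewrite [(z * _) ^+ m]exprMn mulnDr exprD (exprM (zeta N) j m).
by move: (zeta N ^+ j ^+ m) (zeta N ^+ (j * k)) (z ^+ m) => a b d; ring.
Qed.

Lemma csum_dvd (f : nat -> C) N : (0 < N)%N -> asum f ->
  csum (fun n => if (N %| n)%N then f n else 0) = csum (fun m => f (N * m)%N).
Proof.
move=> N0 sf; set g := (fun n => _).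
have sg : asum g by apply: asum_le sf => n; rewrite /g; case: ifP; rewrite ?cabs0 ?cabs_ge0.
apply/esym/csumE.
have := ctends_sub (f := fun K => (N * K)%N) _ (asum_cvg sg).
move=> /(_ (fun n => leq_pmull n N0)); apply: eq_ctends; apply: nearW => K.
elim: K => [|k IH]; first by rewrite muln0 !big_geq.
rewrite mulnS addnC big_nat_recr//= -IH (@big_cat_nat _ _ _ (N * k)%N)//= ?leq_addr//.
congr (_ + _); rewrite big_ltn; last by rewrite -[X in (X < _)%N]addn0 ltn_add2l.
rewrite /g dvdn_mulr// big_nat big1 ?addr0// => i /andP[i1 i2].
case: ifP => // /dvdnP[q iq]; move: i1 i2; rewrite iq (mulnC q) -mulnSr !ltn_pmul2l//.
by rewrite ltnS => a b; have := leq_ltn_trans b a; rewrite ltnn.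
Qed.

(** Cauchy's estimate without contour integrals: an average over the N-th roots of
    unity leaves the terms of index n, n + N, n + 2N, ..., and all but the first
    vanish in the limit. *)
Lemma coef_bound (c : nat -> C) y (M : R) : tame c -> 0 < y ->
  (forall x, cabs (peval c (qexp (x +i* y))) <= M) ->
  forall n, cabs (c n) * expR (- (2 * pi * y)) ^+ n <= M.
Proof.
move=> hc y0 hM n; pose z := qexp (0 +i* y).
have uz : uhp (0 +i* y) by [].
have z1 : cabs z < 1 by exact: cabs_qexp_lt1.
have -> : expR (- (2 * pi * y)) = cabs z by rewrite cabs_qexp.
apply/ler_addgt0Pr => e e0.
have [B sB] := tame_summable hc z1.
have b0 i : 0 <= cabs (c i * z ^+ i) by exact: cabs_ge0.
have [N1 hN1] := tail_small b0 sB e0.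
pose N := (N1 + n).+1; have N0 : (0 < N)%N by [].
have [sm] := zeta_average (N - n) N0 hc z1.
have [sm' ->] := csum_split N sm.
have nN : (n < N)%N by rewrite /N ltnS leq_addl.
set T := csum _; rewrite [in X in _ = X -> _](bigD1_seq n) ?iota_uniq ?mem_index_iota//= subnKC ?(ltnW nN)// dvdnn.
rewrite big_nat_cond [in X in _ = X -> _]big1 ?addr0; last first.
  move=> i /andP[/andP[_ iN] i_n]; case: ifP => // /dvdnP[q].
  move=> E; exfalso; move/eqP: i_n; apply.
  have : (q < 2)%N.
    by rewrite -(@ltn_pmul2r N)// -E mul2n -addnn -addSn leq_add// leq_subr.
  case: q E => [|[|//]]; lia.
move=> E.
have T_le : cabs T <= e.
  apply: dominated_csum.
  have := hN1; move=> h k.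
  apply: le_trans (h (n.+1 + k)%N).
  rewrite [leRHS](@big_cat_nat _ _ _ n.+1)//= ?leq_addr//.
  rewrite -{2}[n.+1]add0n big_addn addKn.
  apply: ler_wpDl; first by rewrite sumr_ge0// => i _.
  apply: ler_sum => i _; case: ifP => _; last by rewrite cabs0 cabs_ge0.
  by have -> : (N + i = N1 + (i + n.+1))%N by rewrite /N; lia.
have S_le : cabs (\sum_(j < N) peval c (z * zeta N ^+ j) * zeta N ^+ (j * (N - n))) <= N%:R * M.
  apply: le_trans (cabs_sum _ _ _) _.
  rewrite (le_trans (ler_sum _ (G := fun=> M) _))//; last by rewrite sumr_const card_ord mulr_natl.
  move=> j _; rewrite cabsM cabsX cabs_zeta expr1n mulr1.
  rewrite /z -qexpMn -qexpD.
  have -> : 0 +i* y + j%:R * N%:R^-1 = (j%:R / N%:R) +i* y :> C.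
    have -> : j%:R / N%:R = (j%:R / N%:R)%:C :> C.
      by rewrite rmorphM /= fmorphV /= !rmorph_nat.
    by apply/eqP; rewrite eq_complex /= add0r addr0 !eqxx.
  exact: hM.
move: S_le; rewrite E cabsM cabs_nat ler_pM2l ?ltr0n// => S_le.
rewrite -cabsX -cabsM.
have -> : c n * z ^+ n = (c n * z ^+ n + T) - T by ring.
by apply: le_trans (cabsB _ _) _; exact: lerD.
Qed.

Lemma peval_eq0 (c : nat -> C) : tame c ->
  (forall tau, uhp tau -> peval c (qexp tau) = 0) -> forall n, c n = 0.
Proof.
move=> hc h n; have := @coef_bound c 1 0 hc ltr01 _ n.
suff: cabs (c n) * expR (- (2 * pi * 1)) ^+ n <= 0 -> c n = 0.
  by move=> h1 h2; apply/h1/h2 => x; rewrite h ?cabs0//=; exact: ltr01.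
by rewrite pmulr_lle0 ?exprn_gt0 ?expR_gt0// => h0; apply/eqP; rewrite -cabs_eq0 eq_le h0 cabs_ge0.
Qed.

End Exponential.

(** * Partial fractions: the Lipschitz formula *)

Section Lipschitz.
Variable R : realType.
Local Notation C := R[i].
Implicit Types (z w h tau : C) (x y : R).

Lemma uhp_neq0 z : uhp z -> z != 0.
Proof. by rewrite /uhp /=; apply: contraTneq => ->; rewrite ltxx. Qed.

Lemma ImDr z x : complex.Im (z + x%:C) = complex.Im z.
Proof. by case: z => a b /=; rewrite addr0. Qed.

Lemma ReDr z x : complex.Re (z + x%:C) = complex.Re z + x.
Proof. by case: z. Qed.

Lemma natC n : n%:R = (n%:R : R)%:C :> C.
Proof. by rewrite rmorph_nat. Qed.

Lemma uhpDn z n : uhp z -> uhp (z + n%:R).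
Proof. by rewrite /uhp /= natC ImDr. Qed.

Lemma uhpBn z n : uhp z -> uhp (z - n%:R).
Proof. by rewrite /uhp /= natC -rmorphN ImDr. Qed.

Lemma uhpS z : uhp z -> uhp (z + 1). Proof. exact: (@uhpDn z 1). Qed.

Lemma ImZ z x : complex.Im (x%:C * z) = x * complex.Im z.
Proof. by case: z => a b /=; rewrite mul0r addr0. Qed.

Lemma ReZ z x : complex.Re (x%:C * z) = x * complex.Re z.
Proof. by case: z => a b /=; rewrite mul0r subr0. Qed.

Lemma uhpMn z n : (0 < n)%N -> uhp z -> uhp (n%:R * z).
Proof. by move=> n0; rewrite /uhp /= natC ImZ => h; rewrite mulr_gt0 ?ltr0n. Qed.

Lemma inv_sqr_sum n : \sum_(0 <= i < n) (i.+1%:R ^- 2) <= 2 :> R.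
Proof.
suff: \sum_(0 <= i < n) (i.+1%:R ^- 2) <= 2 - 2 / n.+1%:R :> R.
  by move=> /le_trans; apply; rewrite gerBl divr_ge0.
elim: n => [|n IH]; first by rewrite big_geq//; lra.
rewrite big_nat_recr//=; apply: le_trans (lerD IH (lexx _)) _.
have n0 : 0 < n.+1%:R :> R by rewrite ltr0n.
have -> : 2 / n.+2%:R = 2 / n.+1%:R - 2 / (n.+1%:R * (n.+1%:R + 1)) :> R.
  by rewrite -(natr1 n.+1); field; rewrite !gt_eqF//; lra.
have h : n.+1%:R ^- 2 <= 2 / (n.+1%:R * (n.+1%:R + 1)) :> R.
  have n1 : 1 <= n.+1%:R :> R by rewrite ler1n.
  have y0 : 0 < n.+1%:R + 1 :> R by lra.
  rewrite ler_pdivlMr ?mulr_gt0// mulrC ler_pdivrMr ?exprn_gt0//.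
  move: (n.+1%:R) n1 => x x1; nra.
move: h; move: (n.+1%:R ^- 2) (2 / (n.+1%:R * _)) (2 / n.+1%:R) => X Y Z; lra.
Qed.

Lemma ctends_inv z : ctends (fun n => (z + n%:R)^-1) 0.
Proof.
apply: (@ctends_le _ _ _ (fun n => 2 * harmonic n)); last first.
  by have h := cvgM (cvg_cst (2 : R)) (@cvg_harmonic R); rewrite mulr0 in h; exact: h.
near=> n; rewrite subr0 cabsV /harmonic /=.
have h : 2 * cabs z + 1 <= n%:R :> R by near: n; exact: nbhs_infty_ger.
have h1 : n%:R - cabs z <= cabs (z + n%:R).
  have := le_cabsB (n%:R : C) (- z); rewrite cabsN cabs_nat opprK addrC.
  by rewrite [n%:R + z]addrC.
have z0 := cabs_ge0 z.
rewrite invf_ple ?posrE; first last.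
- by rewrite mulr_gt0// invr_gt0 ltr0n.
- lra.
by rewrite invf_div -natr1; lra.
Unshelve. all: by end_near. Qed.

(** The symmetric partial sums of the series of (tau + n)^(-k) over all integers;
    for k = 1 the symmetry makes them converge. *)
Definition lsum k tau K : C :=
  tau ^- k + \sum_(0 <= n < K) ((tau + n.+1%:R) ^- k + (tau - n.+1%:R) ^- k).

Lemma lsumS k tau K :
  lsum k (tau + 1) K = lsum k tau K + ((tau + K.+1%:R) ^- k - (tau - K%:R) ^- k).
Proof.
elim: K => [|K IH]; first by rewrite /lsum !big_geq// !addr0 subr0; ring.
have e F : \sum_(0 <= n < K.+1) F n = \sum_(0 <= n < K) F n + F K :> C.
  by rewrite big_nat_recr.
move: IH; rewrite /lsum !e !addrA => ->.
have -> : tau + 1 + K.+1%:R = tau + K.+2%:R by rewrite -[K.+2%:R]natr1; ring.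
have -> : tau + 1 - K.+1%:R = tau - K%:R by rewrite -[K.+1%:R]natr1; ring.
ring.
Qed.

Lemma lsum_shift k tau l : (0 < k)%N ->
  ctends (lsum k (tau + 1)) l <-> ctends (lsum k tau) l.
Proof.
move=> k0.
have h : ctends (fun K => (tau + K.+1%:R) ^- k - (tau - K%:R) ^- k) 0.
  rewrite -[0]subr0; apply: ctendsB.
    have := ctendsX k (proj2 (ctends_shift _ _) (ctends_inv tau)).
    rewrite expr0n gtn_eqF//; apply: eq_ctends.
    by apply: nearW => n; rewrite exprVn.
  have := ctendsZ ((-1) ^- k) (ctendsX k (ctends_inv (- tau))).
  rewrite expr0n gtn_eqF// mulr0; apply: eq_ctends.
  apply: nearW => n; rewrite exprVn -invfM -exprMn mulN1r; congr (_ ^- _); ring.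
split=> H.
  have := ctendsB H h; rewrite subr0; apply: eq_ctends; apply: nearW => K.
  by rewrite lsumS; ring.
have := ctendsD H h; rewrite addr0; apply: eq_ctends; apply: nearW => K.
by rewrite lsumS.
Qed.

(** The estimates below are uniform only for bounded real part. *)
Lemma strip_reduction (P : C -> Prop) : (forall tau, P (tau + 1) <-> P tau) ->
  (forall tau, uhp tau -> `|complex.Re tau| <= 1 / 2 -> P tau) ->
  forall tau, uhp tau -> P tau.
Proof.
move=> PS H tau ut.
have up n z : P z <-> P (z + n%:R).
  elim: n z => [|n IH] z; first by rewrite addr0.
  by rewrite -natr1 addrA PS.
have fl := floor_itv (complex.Re tau + 1 / 2 : R).
set m := Num.floor _ in fl; have m1 : m%:~R <= complex.Re tau + 1 / 2 by lra.
have m2 : complex.Re tau + 1 / 2 < m%:~R + 1.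
  by move: fl; rewrite intrD => /andP[].
have [n [e|e]] : exists n, m = n%:Z \/ m = - n%:Z.
  by case: (m) => n; [exists n; left | exists n.+1; right; rewrite NegzE].
- have -> : tau = tau - n%:R + n%:R by ring.
  apply: (proj1 (up n _)); apply: H; first exact: uhpBn.
  rewrite natC -rmorphN ReDr; move: m1 m2; rewrite e -pmulrn => m1 m2.
  by rewrite ler_norml; lra.
- apply: (proj2 (up n _)); apply: H; first exact: uhpDn.
  rewrite natC ReDr; move: m1 m2; rewrite e intrN -pmulrn => m1 m2.
  by rewrite ler_norml; lra.
Qed.

Lemma lsum_strip k (f : C -> C) : (0 < k)%N ->
  (forall tau, f (tau + 1) = f tau) ->
  (forall tau, uhp tau -> `|complex.Re tau| <= 1 / 2 -> ctends (lsum k tau) (f tau)) ->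
  forall tau, uhp tau -> ctends (lsum k tau) (f tau).
Proof.
by move=> k0 fS; apply: strip_reduction => tau; rewrite fS; exact: lsum_shift.
Qed.

Lemma sym_sum (f : nat -> C) K :
  \sum_(j < K.*2.+1) f j = f 0%N + \sum_(0 <= n < K) (f n.+1 + f (K.*2 - n)%N).
Proof.
rewrite big_ord_recl /=; congr (_ + _).
rewrite (eq_bigr (fun i : 'I_K.*2 => f i.+1)) => [|i _]; last by rewrite /bump.
rewrite -(big_mkord xpredT (fun i => f i.+1)) (@big_cat_nat _ _ _ K)//=; last first.
  by rewrite -addnn leq_addr.
rewrite big_split /=; congr (_ + _).
rewrite -{1}[K]add0n big_addn -addnn addnK big_nat_rev /= add0n.
rewrite big_nat [RHS]big_nat; apply: eq_bigr => i /andP[_ iK].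
by congr f; lia.
Qed.

Lemma cder_seq (f : C -> C) a d (h : nat -> C) : cder f a d -> ctends h 0 ->
  (forall n, h n != 0) -> ctends (fun n => (f (a + h n) - f a) / h n) d.
Proof.
move=> /cderP H h0 hn0; apply/(@cvgrPdist_le _ R^o) => e e0.
have [del del0 hdel] := H _ e0.
have /(@cvgrPdist_lt _ R^o) /(_ _ del0) := h0; apply: filterS => n /=.
rewrite sub0r normrN subr0 ger0_norm ?cabs_ge0// => hn.
rewrite sub0r normrN ger0_norm ?cabs_ge0//.
have -> : (f (a + h n) - f a) / h n - d = (f (a + h n) - f a - h n * d) / h n.
  by have := hn0 n; move: (h n) => t t0; field.
by rewrite cabsM cabsV ler_pdivrMr ?cabs_gt0//; exact: hdel.
Qed.

(** The number of roots of unity is odd so that the residues modulo it are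
    -K, ..., K. *)
Definition N K : C := K.*2.+1%:R.

Lemma N_neq0 K : N K != 0. Proof. by rewrite pnatr_eq0. Qed.


Lemma ctends_divN z : ctends (fun K => z / N K) 0.
Proof.
rewrite -(mulr0 z); apply: ctendsZ.
have h n : (n <= n.*2)%N by rewrite -addnn leq_addr.
have := ctends_sub h (ctends_inv 1); apply: eq_ctends.
by apply: nearW => n; rewrite /N nat1r.
Qed.

Lemma ctends_N1Bq z : z != 0 ->
  ctends (fun K => N K * (1 - qexp (z / N K))) (- twopii R * z).
Proof.
move=> z0.
have h0 K : z / N K != 0 by rewrite mulf_neq0// invr_neq0// N_neq0.
have q0 : qexp 0 = 1 :> C by rewrite /qexp mulr0 cexp0.
have := cder_seq (qexp_cder 0) (ctends_divN z) h0.
rewrite q0 mulr1 => /(ctendsZ (- z)); rewrite mulrC mulrN -mulNr.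
apply: eq_ctends; apply: nearW => K; rewrite add0r.
have := N_neq0 K; move: (N K) (qexp _) => n q n0; field.
by rewrite n0 z0.
Qed.

Lemma ctends_qN z : z != 0 -> ctends (fun K => qexp (z / N K)) 1.
Proof.
move=> z0; have := ctendsB (ctends_cst 1) (ctendsM (ctends_divN 1) (ctends_N1Bq z0)).
rewrite mul0r subr0; apply: eq_ctends; apply: nearW => K.
have := N_neq0 K; move: (N K) (qexp _) => n q n0; field.
exact: n0.
Qed.

(** The factors N (1 - q^{1/N}) tend to multiples of tau + n, and this is the
    uniform lower bound that makes the limit dominated. *)
Lemma N1Bq_ge tau n K : uhp tau -> `|complex.Re tau| <= 1 / 2 -> (n < K)%N ->
  let c : R := cos 1 / 2 * pi / 2 * n.+1%:R in
  c <= cabs (N K * (1 - qexp ((tau + n.+1%:R) / N K))) /\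
  c <= cabs (N K * (1 - qexp ((tau - n.+1%:R) / N K))).
Proof.
move=> ut; rewrite ler_norml => /andP[x1 x2] nK c.
have c1 := @cos1_gt0 R; have p0 := @pi_gt0 R.
have NE : N K = (K.*2.+1%:R : R)%:C by rewrite /N natC.
have NK : 0 < K.*2.+1%:R :> R by rewrite ltr0n.
have nKR : n.+1%:R <= K%:R :> R by rewrite ler_nat.
have N2 : K.*2.+1%:R = 2 * K%:R + 1 :> R by rewrite -natr1 -mul2n natrM.
have n1 : 1 <= n.+1%:R :> R by rewrite ler1n.
have H t : 0 < complex.Im t -> n.+1%:R / 2 <= `|complex.Re t| <= K%:R + 1 / 2 ->
    c <= cabs (N K * (1 - qexp (t / N K))).
  move=> it /andP[h1 h2].
  have tN : t / N K = (K.*2.+1%:R^-1)%:C * t by rewrite NE mulrC fmorphV.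
  have := @cabs_1Bqexp R (t / N K); rewrite tN ImZ ReZ.
  move=> /(_ (mulr_ge0 _ _)); rewrite invr_ge0 ltW//= => /(_ isT (ltW it)) h3.
  rewrite NE cabsM cabs_real ger0_norm ?ler0n//.
  apply: le_trans (ler_wpM2l (ltW NK) h3).
  pose s := K.*2.+1%:R^-1 * `|complex.Re t|.
  have s0 : 0 <= s by rewrite /s mulr_ge0// invr_ge0 ler0n.
  have s1 : s <= 1 / 2.
    by rewrite /s mulrC ler_pdivrMr// N2; lra.
  have -> : `|sin (pi * (K.*2.+1%:R^-1 * complex.Re t))| = sin (pi * s).
    have sp : 0 <= sin (pi * s).
      by apply: sin_ge0_pi; rewrite mulr_ge0 ?pi_ge0//=; nra.
    rewrite -[RHS]ger0_norm// /s; case: (ger0P (complex.Re t)) => // _.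
    by rewrite !mulrN sinN normrN.
  have : cos 1 / 2 * (pi * s) <= sin (pi * s).
    by apply: sin_lower; rewrite mulr_ge0 ?pi_ge0//=; nra.
  move=> /(ler_wpM2l (ltW NK)) h4; apply: le_trans h4.
  have -> : K.*2.+1%:R * (cos 1 / 2 * (pi * s)) = cos 1 / 2 * pi * `|complex.Re t|.
    by rewrite /s; move: (K.*2.+1%:R) NK => m m0; field; rewrite gt_eqF.
  rewrite /c -mulrA ler_wpM2l//; last lra.
  by rewrite mulr_ge0 ?pi_ge0//; lra.
split; apply: H.
- by rewrite natC ImDr.
- rewrite natC ReDr ger0_norm; [apply/andP; split; lra|lra].
- by rewrite natC -rmorphN ImDr.
- rewrite natC -rmorphN ReDr ler0_norm; [apply/andP; split; lra|lra].
Qed.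

(** Multiplication by 1 - z on coefficients; powers of it annihilate polynomial
    sequences. *)
Definition pdiff (c : nat -> C) n := c n - qshift c n.

Lemma tame_pdiff c : tame c -> tame (pdiff c).
Proof. by move=> h; apply: tameD => //; exact/tameN/tame_qshift. Qed.

Lemma peval_pdiff c z : tame c -> cabs z < 1 -> peval (pdiff c) z = (1 - z) * peval c z.
Proof.
move=> h z1; rewrite /pdiff pevalD//; last exact/tameN/tame_qshift.
have -> : (fun n => - qshift c n) = (fun n => -1 * qshift c n).
  by apply/funext => n; rewrite mulN1r.
rewrite pevalZ//; last exact: tame_qshift.
by rewrite peval_qshift//; ring.
Qed.

Lemma peval_iter_pdiff c k z : tame c -> cabs z < 1 ->
  tame (iter k pdiff c) /\ peval (iter k pdiff c) z = (1 - z) ^+ k * peval c z.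
Proof.
move=> h z1; elim: k => [|k [IH1 IH2]]; first by rewrite mul1r.
by rewrite iterS; split; [exact: tame_pdiff | rewrite peval_pdiff// IH2 exprS mulrA].
Qed.

(** The hypotheses on c say that p(z) = sum of c_m z^m is A(z) / (1 - z)^k with A a
    polynomial and A(1) = s, and that c is homogeneous of degree k - 1 under
    dilations. The latter makes the sum of p over the n-th roots of z^n equal to
    n^k p(z^n). For z = q^{1/n} the points close to 1 contribute, in the limit,
    multiples of the terms (tau + m)^(-k). *)
Section Kernel.
Variables (k : nat) (c : nat -> C) (s : C).
Hypothesis k0 : (0 < k)%N.
Hypothesis ct : tame c.
Hypothesis s0 : s != 0.
Hypothesis cM : forall n m, c (n * m)%N = n%:R ^+ k.-1 * c m.
Hypothesis cfin : forall i, iter k pdiff c (k + i)%N = 0.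
Hypothesis csumk : \sum_(0 <= i < k) iter k pdiff c i = s.

Let A z := \sum_(0 <= i < k) iter k pdiff c i * z ^+ i.

Lemma kernelE z : cabs z < 1 -> peval c z = A z / (1 - z) ^+ k.
Proof.
move=> z1; have [_ e] := peval_iter_pdiff k ct z1.
have z11 : (1 - z) ^+ k != 0.
  rewrite expf_neq0// subr_eq0; apply: contraTneq z1 => <-.
  by rewrite cabs1 ltxx.
apply: (mulfI z11); rewrite -e mulrC divfK//.
have h i : iter k pdiff c (k + i)%N * z ^+ (k + i) = 0 by rewrite cfin mul0r.
have [_] := csum_finite (u := fun i => iter k pdiff c i * z ^+ i) h.
by [].
Qed.

Lemma kernel_average z n : (0 < n)%N -> cabs z < 1 ->
  \sum_(j < n) peval c (z * zeta R n ^+ j) = n%:R ^+ k * peval c (z ^+ n).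
Proof.
move=> n0 z1; have [_] := zeta_average 0 n0 ct z1.
under eq_bigr do rewrite muln0 expr0 mulr1.
move=> ->; under eq_csum do rewrite addn0.
rewrite csum_dvd//; last exact: tame_summable.
have -> : n%:R ^+ k = n%:R * n%:R ^+ k.-1 :> C.
  by rewrite -exprS prednK.
rewrite -mulrA; congr (_ * _); rewrite /peval -csumZ.
  by apply: eq_csum => m; rewrite cM exprM mulrA.
apply: tame_summable => //; rewrite cabsX.
by rewrite exprn_ilt1 ?cabs_ge0// -lt0n.
Qed.

Let B := \sum_(0 <= i < k) cabs (iter k pdiff c i).

Lemma kernel_le z : cabs z <= 1 -> cabs (A z) <= B.
Proof.
move=> z1; apply: le_trans (cabs_sum _ _ _) _; apply: ler_sum => i _.
by rewrite cabsM cabsX ler_piMr ?cabs_ge0// exprn_ile1 ?cabs_ge0.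
Qed.

Lemma kernel_tends (u : nat -> C) : ctends u 1 -> ctends (fun n => A (u n)) s.
Proof.
move=> u1; rewrite -csumk /A.
have H m : ctends (fun n => \sum_(0 <= i < m) iter k pdiff c i * u n ^+ i)
    (\sum_(0 <= i < m) iter k pdiff c i).
  elim: m => [|m IH].
    rewrite big_geq//; apply: eq_ctends (ctends_cst 0).
    by apply: nearW => n; rewrite big_geq.
  have := ctendsD IH (ctendsZ (iter k pdiff c m) (ctendsX m u1)).
  rewrite expr1n mulr1 big_nat_recr//=; apply: eq_ctends.
  by apply: nearW => n; rewrite big_nat_recr.
exact: H.
Qed.

Lemma lipschitz_strip tau : (2 <= k)%N -> uhp tau -> `|complex.Re tau| <= 1 / 2 ->
  ctends (lsum k tau) ((- twopii R) ^+ k / s * peval c (qexp tau)).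
Proof.
move=> k2 ut hx; have t0 := uhp_neq0 ut.
have tw0 : - twopii R != 0 by rewrite oppr_eq0 twopii_neq0.
have tk0 : (- twopii R) ^+ k != 0 by rewrite expf_neq0.
have NK0 K : N K != 0 := N_neq0 K.
have mulNK (x : C) K : N K ^+ k * (x / N K ^+ k) = x.
  by have := expf_neq0 k (NK0 K); move: (_ ^+ _) => y y0; rewrite mulrCA mulfV ?mulr1.
pose g z K := peval c (qexp (z / N K)) / N K ^+ k.
have uN z K : uhp z -> uhp (z / N K).
  move=> uz; rewrite /N natC mulrC -fmorphV /uhp /= ImZ mulr_gt0// invr_gt0 ltr0n//.
have gE z K : uhp z ->
    g z K = A (qexp (z / N K)) / (N K * (1 - qexp (z / N K))) ^+ k.
  move=> uz; have q1 := cabs_qexp_lt1 (uN _ K uz).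
  rewrite /g (kernelE q1) exprMn invfM; ring.
have g_tends z : uhp z -> ctends (g z) (s / (- twopii R * z) ^+ k).
  move=> uz; have z0 := uhp_neq0 uz.
  have h1 := kernel_tends (ctends_qN z0).
  have h2 : (- twopii R * z) ^+ k != 0 by rewrite expf_neq0// mulf_neq0.
  have := ctendsM h1 (ctendsV h2 (ctendsX k (ctends_N1Bq z0))).
  by apply: eq_ctends; apply: nearW => K; rewrite gE.
pose a K n := if (n < K)%N then g (tau + n.+1%:R) K + g (tau - n.+1%:R) K else 0.
pose l n := s / (- twopii R * (tau + n.+1%:R)) ^+ k
  + s / (- twopii R * (tau - n.+1%:R)) ^+ k.
have a_tends n : ctends (a^~ n) (l n).
  have := ctendsD (g_tends _ (uhpDn n.+1 ut)) (g_tends _ (uhpBn n.+1 ut)).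
  apply: eq_ctends; near=> K; rewrite /a ifT//.
  by near: K; exact: nbhs_infty_gt.
pose c0 : R := cos 1 / 2 * pi / 2.
have c00 : 0 < c0.
  have c1 := @cos1_gt0 R; have p0 := @pi_gt0 R.
  by rewrite /c0 !mulr_gt0.
have B0 : 0 <= B by rewrite sumr_ge0// => i _; exact: cabs_ge0.
have gle z K n : uhp z -> c0 * n.+1%:R <= cabs (N K * (1 - qexp (z / N K))) ->
    cabs (g z K) <= B / c0 ^+ k * n.+1%:R ^- 2.
  move=> uz h; rewrite gE// cabsM cabsV cabsX -mulrA ler_pM ?invr_ge0 ?exprn_ge0 ?cabs_ge0//.
    by apply/kernel_le/ltW/cabs_qexp_lt1/uN.
  rewrite -invfM lef_pV2 ?posrE; first last.
  - by rewrite mulr_gt0 ?exprn_gt0.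
  - by rewrite exprn_gt0//; apply: lt_le_trans h; rewrite mulr_gt0.
  apply: (@le_trans _ _ ((c0 * n.+1%:R) ^+ k)).
    rewrite [(c0 * _) ^+ k]exprMn ler_wpM2l ?exprn_ge0 ?(ltW c00)//.
    by rewrite ler_weXn2l// ?ler1n.
  by rewrite lerXn2r ?nnegrE ?cabs_ge0// mulr_ge0 ?ler0n// (ltW c00).
pose b n : R := 2 * (B / c0 ^+ k) * n.+1%:R ^- 2.
have ab : \forall K \near \oo, forall n, cabs (a K n) <= b n.
  apply: nearW => K n; rewrite /a; case: ifP => nK; last first.
    rewrite cabs0 /b !mulr_ge0 ?divr_ge0 ?exprn_ge0 ?invr_ge0 ?exprn_ge0//; exact: ltW.
  have [h1 h2] := N1Bq_ge ut hx nK.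
  apply: le_trans (cabsD _ _) _; rewrite /b -mulrA mulr_natl mulr2n.
  by apply: lerD; apply: gle => //; [exact: uhpDn|exact: uhpBn].
have bB n : \sum_(0 <= i < n) b i <= 2 * (B / c0 ^+ k) * 2.
  rewrite -mulr_sumr ler_wpM2l ?inv_sqr_sum//.
  by rewrite mulr_ge0// divr_ge0// exprn_ge0// ltW.
have [sl cv] := tannery a_tends ab bB.
have aE K : csum (a K) = peval c (qexp tau) - g tau K.
  have h n : a K (K + n)%N = 0 by rewrite /a ltnNge leq_addr.
  have [_ ->] := csum_finite h.
  have q1 : cabs (qexp (tau / N K)) < 1 by exact/cabs_qexp_lt1/uN.
  have := kernel_average (ltn0Sn K.*2) q1.
  have zE j : qexp (tau / N K) * zeta R K.*2.+1 ^+ j = qexp ((tau + j%:R) / N K).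
    by rewrite -qexpMn -qexpD -/(N K); congr qexp; field.
  have -> : qexp (tau / N K) ^+ K.*2.+1 = qexp tau.
    by rewrite -qexpMn -/(N K) mulrCA divff// mulr1.
  have := sym_sum (fun j => peval c (qexp ((tau + j%:R) / N K))) K.
  rewrite (eq_bigr (fun j : 'I_K.*2.+1 => peval c (qexp (tau / N K) * zeta R K.*2.+1 ^+ j))).
    move=> -> e; apply: (mulfI (expf_neq0 k (NK0 K))).
    rewrite mulrBr -e /g mulNK.
    have cancel (x y : C) : x + y - x = y by ring.
    rewrite [tau + 0]addr0 cancel mulr_sumr.
    rewrite big_nat [RHS]big_nat; apply: eq_bigr => n /andP[_ nK].
    have e2 : qexp ((tau - n.+1%:R) / N K) = qexp ((tau + (K.*2 - n)%:R) / N K).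
      have <- : tau + (K.*2 - n)%:R - N K = tau - n.+1%:R.
        rewrite /N -natr1 natrB -?natr1; first by ring.
        by rewrite -addnn (leq_trans (ltnW nK)) ?leq_addr.
      by rewrite mulrBl (mulfV (NK0 K)) -[in LHS]qexpS subrK.
    rewrite /a nK /g e2.
    set x := peval c _; set y := peval c _; move: x y => x y.
    by rewrite mulrDr !mulNK.
  by move=> j _; rewrite zE.
have lE n : l n = s / (- twopii R) ^+ k * ((tau + n.+1%:R) ^- k + (tau - n.+1%:R) ^- k).
  by rewrite /l !exprMn !invfM; ring.
have h3 := ctendsB (ctends_cst (peval c (qexp tau))) (g_tends _ ut).
have E : csum l = peval c (qexp tau) - s / (- twopii R * tau) ^+ k.
  by apply: ctends_unique h3; apply: eq_ctends cv; apply: nearW => K; rewrite aE.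
have := asum_cvg sl; rewrite E => /(ctendsZ ((- twopii R) ^+ k / s)).
move=> /(ctendsD (ctends_cst (tau ^- k))).
have -> : tau ^- k + (- twopii R) ^+ k / s * (peval c (qexp tau) - s / (- twopii R * tau) ^+ k)
   = (- twopii R) ^+ k / s * peval c (qexp tau).
  rewrite exprMn; have : tau ^+ k != 0 by rewrite expf_neq0.
  move: ((- twopii R) ^+ k) tk0 (tau ^+ k) (peval _ _) => T T0 t p u0; field.
  by rewrite u0 T0 s0.
apply: eq_ctends; apply: nearW => K; rewrite /lsum; congr (_ + _).
rewrite mulr_sumr; apply: eq_bigr => n _; rewrite lE mulrA.
set x := _ ^- k + _; move: x ((- twopii R) ^+ k) tk0 => x T T0; field.
by rewrite s0 T0.
Unshelve. all: by end_near. Qed.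

Lemma lipschitz tau : (2 <= k)%N -> uhp tau ->
  ctends (lsum k tau) ((- twopii R) ^+ k / s * peval c (qexp tau)).
Proof.
move=> k2; apply: (@lsum_strip k (fun t => (- twopii R) ^+ k / s * peval c (qexp t))).
- exact: k0.
- by move=> t; rewrite qexpS.
- by move=> t; exact: lipschitz_strip.
Qed.

End Kernel.

End Lipschitz.

(** * The cotangent series *)

Section Cotangent.
Variable R : realType.
Local Notation C := R[i].
Implicit Types (z w h tau : C).

(** For z = e^{2 i x} this is i cot x. *)
Definition cotq z : C := (1 + z) / (1 - z).

Lemma disc_1B z : cabs z < 1 -> 1 - z != 0.
Proof.
by rewrite subr_eq0; apply: contraTneq => <-; rewrite cabs1 ltxx.
Qed.

Lemma geom_peval z : cabs z < 1 -> peval (fun=> 1) z = (1 - z)^-1.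
Proof.
move=> z1; have h := peval_pdiff (@tame1 R) z1.
have e : peval (pdiff (fun=> 1)) z = 1.
  rewrite -[RHS](@peval_const R 1 z); congr peval; apply/funext => -[|n].
    by rewrite /pdiff /= subr0.
  by rewrite /pdiff /= subrr.
by apply: (mulfI (disc_1B z1)); rewrite mulfV ?disc_1B// -h e.
Qed.

Lemma cotq_average z n : (0 < n)%N -> cabs z < 1 ->
  \sum_(j < n) cotq (z * zeta R n ^+ j) = n%:R * cotq (z ^+ n).
Proof.
move=> n0 z1.
have cE w : cabs w < 1 -> cotq w = 2 * peval (fun=> 1) w - 1.
  move=> w1; rewrite geom_peval// /cotq; have := disc_1B w1.
  by move=> h; field.
have [_] := zeta_average 0 n0 (@tame1 R) z1.
under eq_bigr do rewrite muln0 expr0 mulr1.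
under eq_csum do rewrite addn0.
rewrite (csum_dvd n0); last exact: tame_summable (@tame1 R) z1.
move=> e; rewrite (eq_bigr (fun j : 'I_n => 2 * peval (fun=> 1) (z * zeta R n ^+ j) - 1)).
  rewrite sumrB -mulr_sumr e sumr_const card_ord cE; last first.
    by rewrite cabsX exprn_ilt1 ?cabs_ge0// -lt0n.
  rewrite mulrBr mulr1 mulrCA; congr (_ * (_ * _) - _).
  by apply: eq_csum => m; rewrite exprM.
move=> j _; apply: cE.
by rewrite cabsM cabsX cabs_zeta expr1n mulr1.
Qed.

(** The argument of the Lipschitz formula for k = 1. Each term is now paired with its
    opposite before passing to the limit, as only the pairs are dominated by a
    convergent series. *)
Lemma cot_strip tau : uhp tau -> `|complex.Re tau| <= 1 / 2 ->
  ctends (lsum 1 tau) (- twopii R / 2 * cotq (qexp tau)).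
Proof.
move=> ut hx; have t0 := uhp_neq0 ut.
have tw0 : - twopii R != 0 by rewrite oppr_eq0 twopii_neq0.
have NK0 K : N R K != 0 := N_neq0 R K.
have uN z K : uhp z -> uhp (z / N R K).
  move=> uz; rewrite /N natC mulrC -fmorphV /uhp /= ImZ mulr_gt0// invr_gt0 ltr0n//.
pose D z K := N R K * (1 - qexp (z / N R K)).
have D0 z K : uhp z -> D z K != 0.
  by move=> uz; apply: mulf_neq0; [exact: NK0|exact/disc_1B/cabs_qexp_lt1/uN].
have Dt z : z != 0 -> ctends (D z) (- twopii R * z) by exact: ctends_N1Bq.
have u2 : uhp (2 * tau) by exact: (@uhpMn _ _ 2).
pose a K n := if (n < K)%N then
  2 * D (2 * tau) K / (D (tau + n.+1%:R) K * D (tau - n.+1%:R) K) else 0.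
pose l n := 2 * (- twopii R * (2 * tau)) /
  ((- twopii R * (tau + n.+1%:R)) * (- twopii R * (tau - n.+1%:R))).
have tn0 n : tau + n.+1%:R != 0 by exact/uhp_neq0/uhpDn.
have tn0' n : tau - n.+1%:R != 0 by exact/uhp_neq0/uhpBn.
have a_tends n : ctends (a^~ n) (l n).
  have h1 := ctendsZ 2 (Dt _ (uhp_neq0 u2)).
  have h2 := ctendsM (Dt _ (tn0 n)) (Dt _ (tn0' n)).
  have h3 : - twopii R * (tau + n.+1%:R) * (- twopii R * (tau - n.+1%:R)) != 0.
    by rewrite !mulf_neq0.
  have := ctendsM h1 (ctendsV h3 h2); apply: eq_ctends; near=> K; rewrite /a ifT//.
  by near: K; exact: nbhs_infty_gt.
pose c0 : R := cos 1 / 2 * pi / 2.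
have c00 : 0 < c0.
  have c1 := @cos1_gt0 R; have p0 := @pi_gt0 R.
  by rewrite /c0 !mulr_gt0.
pose M : R := cabs (- twopii R * (2 * tau)) + 1.
have M0 : 0 <= M by rewrite addr_ge0 ?cabs_ge0.
pose b n : R := 2 * M / c0 ^+ 2 * n.+1%:R ^- 2.
have ab : \forall K \near \oo, forall n, cabs (a K n) <= b n.
  near=> K => n.
  have b0 : 0 <= b n by rewrite /b !mulr_ge0// invr_ge0 exprn_ge0// ltW.
  rewrite /a; case: ifP => nK; last by rewrite cabs0.
  have [h1 h2] := N1Bq_ge ut hx nK.
  have h3 : cabs (D (2 * tau) K) <= M.
    have : `|cabs (- twopii R * (2 * tau)) - cabs (D (2 * tau) K)| < 1.
      near: K; exact: (@cvgrPdist_lt _ R^o _ _ _ _ _).1 (ctends_cabs (Dt _ (uhp_neq0 u2))) _ ltr01.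
    rewrite ltr_norml /M; lra.
  have cE (x y z : C) : cabs (2 * x / (y * z)) = 2 * (cabs x / (cabs y * cabs z)).
    by rewrite !cabsM cabsV cabsM cabs_nat mulrA.
  rewrite cE /b -!mulrA ler_wpM2l//.
  rewrite ler_pM ?invr_ge0 ?mulr_ge0 ?cabs_ge0//.
  have p : 0 < c0 * n.+1%:R by rewrite mulr_gt0.
  rewrite -invfM lef_pV2 ?posrE; first last.
  - by rewrite mulr_gt0 ?exprn_gt0.
  - by rewrite mulr_gt0//; [apply: lt_le_trans h1|apply: lt_le_trans h2].
  have -> : c0 ^+ 2 * n.+1%:R ^+ 2 = (c0 * n.+1%:R) * (c0 * n.+1%:R) by ring.
  by apply: ler_pM => //; exact: ltW.
have bB n : \sum_(0 <= i < n) b i <= 2 * M / c0 ^+ 2 * 2.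
  rewrite -mulr_sumr ler_wpM2l ?inv_sqr_sum//.
  by rewrite !mulr_ge0// invr_ge0 exprn_ge0// ltW.
have [sl cv] := tannery a_tends ab bB.
have aE K : csum (a K) = cotq (qexp tau) - (1 + qexp (tau / N R K)) / D tau K.
  have h n : a K (K + n)%N = 0 by rewrite /a ltnNge leq_addr.
  have [_ ->] := csum_finite h.
  have q1 : cabs (qexp (tau / N R K)) < 1 by exact/cabs_qexp_lt1/uN.
  have := cotq_average (ltn0Sn K.*2) q1.
  have zE j : qexp (tau / N R K) * zeta R K.*2.+1 ^+ j = qexp ((tau + j%:R) / N R K).
    rewrite -qexpMn -qexpD -/(N R K); congr qexp.
    by have := NK0 K; move: (N R K) => x x0; field.
  have -> : qexp (tau / N R K) ^+ K.*2.+1 = qexp tau.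
    rewrite -qexpMn -/(N R K); congr qexp.
    by have := NK0 K; move: (N R K) => x x0; field.
  have := sym_sum (fun j => cotq (qexp ((tau + j%:R) / N R K))) K.
  rewrite (eq_bigr (fun j : 'I_K.*2.+1 => cotq (qexp (tau / N R K) * zeta R K.*2.+1 ^+ j))).
    move=> -> e; apply: (mulfI (NK0 K)).
    have -> : N R K * (cotq (qexp tau) - (1 + qexp (tau / N R K)) / D tau K) =
       N R K * cotq (qexp tau) - cotq (qexp (tau / N R K)).
      have := D0 tau K ut; have := disc_1B q1; rewrite /D /cotq; have := NK0 K.
      move: (N R K) (qexp (_ / _)) (_ / (1 - qexp tau)) => x y u x0 y0 _.
      by field; rewrite x0 y0.
    rewrite -/(N R K) in e; rewrite -e.
    have cancel (x y : C) : x + y - x = y by ring.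
    rewrite [tau + 0]addr0 cancel mulr_sumr.
    rewrite big_nat [RHS]big_nat; apply: eq_bigr => n /andP[_ nK].
    have <- : qexp ((tau - n.+1%:R) / N R K) = qexp ((tau + (K.*2 - n)%:R) / N R K).
      have <- : tau + (K.*2 - n)%:R - N R K = tau - n.+1%:R.
        rewrite /N -natr1 natrB -?natr1; first by ring.
        by rewrite -addnn (leq_trans (ltnW nK)) ?leq_addr.
      by rewrite mulrBl (mulfV (NK0 K)) -[in LHS]qexpS subrK.
    rewrite /a nK /D.
    have -> : qexp (2 * tau / N R K) =
        qexp ((tau + n.+1%:R) / N R K) * qexp ((tau - n.+1%:R) / N R K).
      by rewrite -qexpD; congr qexp; ring.
    have h1 := disc_1B (cabs_qexp_lt1 (uN _ K (uhpDn n.+1 ut))).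
    have h2 := disc_1B (cabs_qexp_lt1 (uN _ K (uhpBn n.+1 ut))).
    rewrite /cotq.
    have := NK0 K; set x := qexp _ in h1 *; set y := qexp _ in h2 *.
    move: x y (N R K) h1 h2 => x y u h1 h2 u0.
    by field; rewrite u0 h1 h2.
  by move=> j _; rewrite zE.
have lE n : l n = 2 / (- twopii R) * ((tau + n.+1%:R) ^- 1 + (tau - n.+1%:R) ^- 1).
  rewrite /l !expr1.
  have -> : 2 * tau = (tau + n.+1%:R) + (tau - n.+1%:R) by ring.
  move: (tau + _) (tau - _) (twopii R) (tn0 n) (tn0' n) tw0 => x y T h1 h2.
  rewrite oppr_eq0 => h3.
  by field; rewrite h1 h2 h3.
have h3 : ctends (fun K => cotq (qexp tau) - (1 + qexp (tau / N R K)) / D tau K)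
    (cotq (qexp tau) - (1 + 1) / (- twopii R * tau)).
  apply: ctendsB (ctends_cst _) _; apply: ctendsM.
    exact: ctendsD (ctends_cst _) (ctends_qN t0).
  by apply: ctendsV; [rewrite mulf_neq0|exact: Dt].
have E : csum l = cotq (qexp tau) - (1 + 1) / (- twopii R * tau).
  by apply: ctends_unique h3; apply: eq_ctends cv; apply: nearW => K; rewrite aE.
have := asum_cvg sl; rewrite E => /(ctendsZ (- twopii R / 2)).
move=> /(ctendsD (ctends_cst (tau ^- 1))).
have -> : tau ^- 1 + - twopii R / 2 * (cotq (qexp tau) - (1 + 1) / (- twopii R * tau)) =
   - twopii R / 2 * cotq (qexp tau).
  rewrite expr1; move: (cotq _) (twopii R) tw0 => x T; rewrite oppr_eq0 => T0.
  by field; rewrite T0 t0.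
apply: eq_ctends; apply: nearW => K; rewrite /lsum; congr (_ + _).
rewrite mulr_sumr; apply: eq_bigr => n _; rewrite lE mulrA.
have -> : - twopii R / 2 * (2 / - twopii R) = 1.
  by move: (twopii R) tw0 => T; rewrite oppr_eq0 => T0; field.
by rewrite mul1r.
Unshelve. all: by end_near. Qed.

Lemma cot_series tau : uhp tau ->
  ctends (lsum 1 tau) (- twopii R / 2 * cotq (qexp tau)).
Proof.
apply: (@lsum_strip _ 1 (fun t => - twopii R / 2 * cotq (qexp t))) => //.
  by move=> t; rewrite qexpS.
by move=> t; exact: cot_strip.
Qed.

End Cotangent.

(** * Lattice sums *)

Section Lattice.
Variable R : realType.
Local Notation C := R[i].
Implicit Types (z w h tau : C) (m n : nat).

Lemma lattice_ge tau : uhp tau -> exists2 d : R, 0 < d &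
  forall a t : R, 0 <= a -> d * (a + `|t|) <= cabs (a%:C * tau + t%:C).
Proof.
move=> ut; have y0 : 0 < complex.Im tau by [].
pose x := complex.Re tau; pose y := complex.Im tau.
have x0 : 0 <= `|x| by [].
have q0 : 0 < 1 + (1 + `|x|) / y.
  by rewrite addr_gt0 ?divr_gt0// ltr_wpDr.
exists (1 + (1 + `|x|) / y)^-1; first by rewrite invr_gt0.
move=> a t a0; rewrite mulrC ler_pdivrMr//.
set L := cabs _.
have h1 : a * y <= L.
  have := cabs_Im (a%:C * tau + t%:C); rewrite ImDr ImZ ger0_norm//.
  by rewrite mulr_ge0// ltW.
have h2 : `|t| - a * `|x| <= L.
  have := cabs_Re (a%:C * tau + t%:C); rewrite ReDr ReZ.
  apply: le_trans; rewrite lerBlDr.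
  have -> : a * `|x| = `|- (a * x)| by rewrite normrN normrM ger0_norm.
  apply: le_trans (ler_normD _ _); rewrite le_eqVlt; apply/orP; left; apply/eqP.
  congr `|_|; rewrite -/x; ring.
have L0 : 0 <= L by exact: cabs_ge0.
have h3 : a <= L / y by rewrite ler_pdivlMr.
have h4 : a * `|x| <= L / y * `|x| by rewrite ler_wpM2r.
have -> : L * (1 + (1 + `|x|) / y) = L + L / y + L / y * `|x| by ring.
lra.
Qed.

Lemma sum_pow4 (a b : R) : 1 <= a -> 1 <= b -> (a + b) ^- 4 <= a ^- 2 * b ^- 2.
Proof.
move=> a1 b1; rewrite -invfM lef_pV2 ?posrE ?mulr_gt0 ?exprn_gt0//; try lra.
have h : a * b <= (a + b) ^+ 2 by nra.
have h0 : 0 <= a * b by nra.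
rewrite -exprMn (_ : (a + b) ^+ 4 = ((a + b) ^+ 2) ^+ 2); last by rewrite -exprM.
by rewrite lerXn2r ?nnegrE ?sqr_ge0.
Qed.

Definition lat k tau m n : C :=
  (m.+1%:R * tau + n.+1%:R) ^- k + (m.+1%:R * tau - n.+1%:R) ^- k.

(** Subtracting this array makes the case k = 2 absolutely convergent, and its rows
    telescope. *)
Definition tele tau m n : C :=
  ((m.+1%:R * tau + n.+1%:R) ^+ 2 - 4^-1)^-1 +
  ((m.+1%:R * tau - n.+1%:R) ^+ 2 - 4^-1)^-1.

Lemma natr_ge1 n : 1 <= n.+1%:R :> R. Proof. by rewrite ler1n. Qed.

Lemma lat_point_ge (d : R) tau m n (t : R) :
  (forall a t : R, 0 <= a -> d * (a + `|t|) <= cabs (a%:C * tau + t%:C)) ->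
  `|t| = n.+1%:R -> d * (m.+1%:R + n.+1%:R) <= cabs (m.+1%:R * tau + t%:C).
Proof. by move=> H e; rewrite natC -e; apply: H. Qed.

Lemma lat_bound k tau : (2 <= k)%N -> uhp tau -> exists2 K : R, 0 <= K &
  forall m n, cabs (lat k tau m n) <= K * (m.+1%:R + n.+1%:R) ^- k.
Proof.
move=> k2 ut; have [d d0 H] := lattice_ge ut.
exists (2 * d ^- k); first by rewrite mulr_ge0// invr_ge0 exprn_ge0// ltW.
move=> m n; have p : 0 < d * (m.+1%:R + n.+1%:R).
  by rewrite mulr_gt0// addr_gt0// ltr0n.
have h (t : R) : `|t| = n.+1%:R ->
    cabs ((m.+1%:R * tau + t%:C) ^- k) <= d ^- k * (m.+1%:R + n.+1%:R) ^- k.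
  move=> e; have h := lat_point_ge m H e.
  rewrite cabsV cabsX -invfM -exprMn lef_pV2 ?posrE ?exprn_gt0//; last exact: lt_le_trans h.
  by rewrite lerXn2r ?nnegrE ?cabs_ge0// ltW.
apply: le_trans (cabsD _ _) _; rewrite -[leRHS]mulrA [leRHS]mulr_natl mulr2n; apply: lerD.
  by rewrite [X in _ + X]natC; apply: h; rewrite ger0_norm.
by rewrite [X in _ - X]natC -rmorphN; apply: h; rewrite normrN ger0_norm.
Qed.

Lemma lat_tele_bound tau : uhp tau -> exists2 K : R, 0 <= K &
  forall m n, cabs (lat 2 tau m n - tele tau m n) <= K * (m.+1%:R + n.+1%:R) ^- 4.
Proof.
move=> ut; have [d d0 H] := lattice_ge ut.
exists (2 * d ^- 4); first by rewrite mulr_ge0// invr_ge0 exprn_ge0// ltW.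
move=> m n; have m1 := natr_ge1 m; have n1 := natr_ge1 n.
have p : 0 < d * (m.+1%:R + n.+1%:R).
  by rewrite mulr_gt0// addr_gt0// ltr0n.
have h (t : R) : `|t| = n.+1%:R -> cabs ((m.+1%:R * tau + t%:C) ^- 2 -
    ((m.+1%:R * tau + t%:C) ^+ 2 - 4^-1)^-1) <= d ^- 4 * (m.+1%:R + n.+1%:R) ^- 4.
  move=> e; have h := lat_point_ge m H e; set z := m.+1%:R * tau + t%:C in h *.
  have hp (s : R) : `|s| = 1 / 2 -> d / 2 * (m.+1%:R + n.+1%:R) <= cabs (z + s%:C).
    move=> s2; have -> : z + s%:C = (m.+1%:R : R)%:C * tau + (t + s)%:C.
      by rewrite /z natC rmorphD /= addrA.
    apply: le_trans (H m.+1%:R (t + s) (ler0n _ _)).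
    rewrite -mulrA ler_wpM2l ?(ltW d0)//.
    have := lerB_dist t (- s); rewrite opprK normrN s2 e; lra.
  have z1 := hp (1 / 2); have z2 := hp (- (1 / 2)).
  rewrite normrN ger0_norm in z2; last lra.
  rewrite ger0_norm in z1; last lra.
  have {}z1 := z1 erefl; have {}z2 := z2 erefl.
  have half : (1 / 2 : R)%:C = 2^-1 :> C by rewrite div1r fmorphV /= rmorph_nat.
  rewrite half in z1; rewrite rmorphN /= half in z2.
  have p2 : 0 < d / 2 * (m.+1%:R + n.+1%:R).
    by rewrite mulr_gt0 ?divr_gt0// addr_gt0// ltr0n.
  have z0 : z != 0 by rewrite -cabs_gt0; exact: lt_le_trans h.
  have z10 : z + 2^-1 != 0 by rewrite -cabs_gt0; exact: lt_le_trans z1.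
  have z20 : z - 2^-1 != 0 by rewrite -cabs_gt0; exact: lt_le_trans z2.
  have f4 : z ^+ 2 - 4^-1 = (z + 2^-1) * (z - 2^-1).
    rewrite mulrC -subr_sqr; congr (_ - _); rewrite exprVn; congr (_^-1).
    by rewrite expr2; ring.
  have -> : z ^- 2 - (z ^+ 2 - 4^-1)^-1 =
      - 4^-1 / (z ^+ 2 * ((z + 2^-1) * (z - 2^-1))).
    rewrite -f4; have : z ^+ 2 - 4^-1 != 0 by rewrite f4 mulf_neq0.
    move: z0 => a b; have b' : z ^+ 2 * 4 - 1 != 0.
      have -> : z ^+ 2 * 4 - 1 = 4 * (z ^+ 2 - 4^-1) by field.
      by rewrite mulf_neq0// pnatr_eq0.
    by field; rewrite a b'.
  rewrite cabsM cabsN !cabsV cabs_nat cabsM cabsX cabsM.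
  have g1 : d ^+ 4 * (m.+1%:R + n.+1%:R) ^+ 4 <=
      4 * (cabs z ^+ 2 * (cabs (z + 2^-1) * cabs (z - 2^-1))).
    set S := _ + _ in h z1 z2 *.
    have -> : d ^+ 4 * S ^+ 4 = 4 * ((d * S) ^+ 2 * ((d / 2 * S) * (d / 2 * S))) by field.
    rewrite ler_wpM2l//; apply: ler_pM.
    - by rewrite exprn_ge0// ltW.
    - by rewrite mulr_ge0 ?ltW.
    - by rewrite lerXn2r ?nnegrE ?cabs_ge0// ltW.
    - by apply: ler_pM => //; exact: ltW.
  rewrite -!invfM lef_pV2 ?posrE//.
    by rewrite !mulr_gt0// ?exprn_gt0// cabs_gt0.
  by rewrite mulr_gt0 ?exprn_gt0//; lra.
have -> : lat 2 tau m n - tele tau m n =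
  ((m.+1%:R * tau + n.+1%:R) ^- 2 - ((m.+1%:R * tau + n.+1%:R) ^+ 2 - 4^-1)^-1) +
  ((m.+1%:R * tau - n.+1%:R) ^- 2 - ((m.+1%:R * tau - n.+1%:R) ^+ 2 - 4^-1)^-1).
  by rewrite /lat /tele; ring.
apply: le_trans (cabsD _ _) _; rewrite -[leRHS]mulrA [leRHS]mulr_natl mulr2n; apply: lerD.
  by rewrite [n.+1%:R]natC; apply: h; rewrite ger0_norm.
by rewrite [n.+1%:R]natC -rmorphN; apply: h; rewrite normrN ger0_norm.
Qed.

(** Rows and columns are dominated since (m + n)^(-4) <= m^(-2) n^(-2). *)
Lemma swap4 (w : nat -> nat -> C) (K : R) : 0 <= K ->
  (forall m n, cabs (w m n) <= K * (m.+1%:R + n.+1%:R) ^- 4) ->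
  [/\ asum (fun n => csum (w^~ n)), asum (fun m => csum (w m))
    & csum (fun m => csum (w m)) = csum (fun n => csum (w^~ n))].
Proof.
move=> K0 H; apply: (@csum_swap _ w (fun m => K * m.+1%:R ^- 2) (fun n => n.+1%:R ^- 2)
    (K * 2) 2).
- move=> m n; apply: le_trans (H m n) _; rewrite -mulrA ler_wpM2l//.
  by apply: sum_pow4; exact: natr_ge1.
- by move=> n; rewrite mulr_ge0// invr_ge0 exprn_ge0.
- by move=> n; rewrite invr_ge0 exprn_ge0.
- by move=> n; rewrite -mulr_sumr ler_wpM2l// inv_sqr_sum.
- exact: inv_sqr_sum.
Qed.

Lemma lat_inv k tau m n : ~~ odd k -> uhp tau ->
  lat k (- tau^-1) m n = tau ^+ k * lat k tau n m.
Proof.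
move=> ek ut; have t0 := uhp_neq0 ut.
have e1 : m.+1%:R * - tau^-1 + n.+1%:R = (n.+1%:R * tau - m.+1%:R) / tau by field.
have e2 : m.+1%:R * - tau^-1 - n.+1%:R = - ((n.+1%:R * tau + m.+1%:R) / tau) by field.
rewrite /lat e1 e2 exprNn -signr_odd (negbTE ek) mul1r !expr_div_n !invf_div.
by rewrite mulrDr addrC.
Qed.

Lemma uhp_inv tau : uhp tau -> uhp (- tau^-1).
Proof.
case: tau => x y; rewrite /uhp /= => y0.
by rewrite opprK divr_gt0// ltr_wpDl ?sqr_ge0// exprn_gt0.
Qed.

(** Half of the Eisenstein series without the terms with m = 0 or n = 0, summed by
    rows: for k = 2 the order of summation matters. *)
Definition latsum k tau := csum (fun m => csum (lat k tau m)).

Lemma latsum_inv_swap k tau : ~~ odd k -> (2 <= k)%N -> uhp tau ->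
  (exists l, csums (fun n => csum (fun m => lat k tau m n)) l) ->
  latsum k (- tau^-1) = tau ^+ k * csum (fun n => csum (fun m => lat k tau m n)).
Proof.
move=> ek k2 ut [l hl]; rewrite /latsum (csumE hl); apply: csumE.
have sc n : asum (fun m => lat k tau m n).
  have [K K0 H] := lat_bound k2 ut; exists (K * 2).
  apply: (@dominated_le _ _ (fun m => K * m.+1%:R ^- 2)) => [m|N]; last first.
    by rewrite -mulr_sumr ler_wpM2l// inv_sqr_sum.
  apply: le_trans (H m n) _; rewrite ler_wpM2l// lef_pV2 ?posrE ?exprn_gt0 ?addr_gt0//.
  apply: (@le_trans _ _ (m.+1%:R ^+ k)); first by rewrite ler_weXn2l// natr_ge1.
  by rewrite lerXn2r ?nnegrE ?addr_ge0// lerDl.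
apply: eq_ctends (ctendsZ (tau ^+ k) hl); apply: nearW => N.
rewrite mulr_sumr; apply: eq_bigr => n _; rewrite -csumZ//.
by apply: eq_csum => m; rewrite lat_inv.
Qed.

Lemma latsum_inv k tau : ~~ odd k -> (4 <= k)%N -> uhp tau ->
  latsum k (- tau^-1) = tau ^+ k * latsum k tau.
Proof.
move=> ek k4 ut; have [K K0 H] := lat_bound (leq_trans (leqnSn 2) (ltnW k4)) ut.
have [|s1 s2 e] := @swap4 (lat k tau) K K0.
  move=> m n; apply: le_trans (H m n) _; rewrite ler_wpM2l//.
  rewrite lef_pV2 ?posrE ?exprn_gt0 ?addr_gt0//.
  by rewrite ler_weXn2l//; have := natr_ge1 m; have := natr_ge1 n; lra.
have k2 : (2 <= k)%N by exact: leq_trans k4.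
have ex : exists l, csums (fun n => csum (fun m => lat k tau m n)) l.
  by exists (csum (fun n => csum (fun m => lat k tau m n))); exact: asum_cvg s1.
by have := latsum_inv_swap ek k2 ut ex; rewrite -e.
Qed.

Lemma telescope_row z N : (forall n, z + n%:R - 2^-1 != 0) ->
  \sum_(0 <= n < N) ((z + n.+1%:R) ^+ 2 - 4^-1)^-1 =
  (z + 2^-1)^-1 - (z + N%:R + 2^-1)^-1.
Proof.
move=> H; elim: N => [|N IH]; first by rewrite big_geq// addr0 subrr.
rewrite big_nat_recr//= IH.
have h1 := H N.+1; have h2 := H N.+2; have h3 := H 1%N.
have e1 : z + N%:R + 2^-1 = z + N.+1%:R - 2^-1 by rewrite -natr1; field.
have e2 : z + N.+1%:R + 2^-1 = z + N.+2%:R - 2^-1 by rewrite -[N.+2%:R]natr1; field.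
rewrite e1; rewrite -e2 in h2; rewrite -addrA; congr (_ + _).
set w := z + N.+1%:R in h1 h2 *.
have -> : (w ^+ 2 - 4^-1)^-1 = (w - 2^-1)^-1 - (w + 2^-1)^-1; last by ring.
have f4 : w ^+ 2 - 4^-1 = (w + 2^-1) * (w - 2^-1).
  rewrite mulrC -subr_sqr; congr (_ - _); rewrite exprVn; congr (_^-1).
  by rewrite expr2; ring.
rewrite f4; set a := w + 2^-1 in h2 *; set b := w - 2^-1 in h1 *.
have ab : a - b = 1 by rewrite /a /b; field.
by rewrite -[LHS]mul1r -ab; move: a b h2 h1 {ab f4} => a b a0 b0; field; rewrite a0 b0.
Qed.

Lemma tele_row_partial tau m N : uhp tau -> let x := m.+1%:R * tau in
  \sum_(0 <= n < N) tele tau m n =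
  (4^-1 - x ^+ 2)^-1 - (2 * N%:R + 1) / ((N%:R + 2^-1) ^+ 2 - x ^+ 2).
Proof.
move=> ut x.
have ux : uhp x by exact: (@uhpMn _ _ m.+1).
have half : 2^-1 = (2^-1 : R)%:C :> C by rewrite fmorphV /= rmorph_nat.
have H z n : complex.Im z != 0 -> z + n%:R - 2^-1 != 0.
  move=> z0; apply/eqP => e; move: z0; rewrite -(ImDr z n%:R) -natC.
  rewrite -(ImDr (z + n%:R) (- 2^-1)) rmorphN /= -half e /=.
  by rewrite eqxx.
have H' z n : complex.Im z != 0 -> z + n%:R + 2^-1 != 0.
  move=> z0; apply/eqP => e; move: z0; rewrite -(ImDr z n%:R) -natC.
  by rewrite -(ImDr (z + n%:R) 2^-1) -half e /= eqxx.
have x0 : complex.Im x != 0 by rewrite gt_eqF.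
have x0' : complex.Im (- x) != 0 by case: (x) x0 => a b /=; rewrite oppr_eq0.
rewrite /tele big_split /= (telescope_row _ (fun n => H x n x0)).
rewrite (eq_bigr (fun n : nat => ((- x + n.+1%:R) ^+ 2 - 4^-1)^-1)); last first.
  by move=> n _; rewrite -/x -[in RHS]sqrrN; congr (_ ^+ 2 - _)^-1; ring.
rewrite (telescope_row _ (fun n => H (- x) n x0')).
have a1 := H' x 0%N x0; have a2 := H' (- x) 0%N x0'.
have a3 := H' x N x0; have a4 := H' (- x) N x0'.
rewrite !addr0 in a1 a2.
have f1 : 4^-1 - x ^+ 2 = (x + 2^-1) * (- x + 2^-1) by field.
have f2 : (N%:R + 2^-1) ^+ 2 - x ^+ 2 = (x + N%:R + 2^-1) * (- x + N%:R + 2^-1) by ring.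
rewrite f1 f2.
have -> : (x + 2^-1)^-1 - (x + N%:R + 2^-1)^-1 + ((- x + 2^-1)^-1 - (- x + N%:R + 2^-1)^-1)
  = ((x + 2^-1)^-1 + (- x + 2^-1)^-1) - ((x + N%:R + 2^-1)^-1 + (- x + N%:R + 2^-1)^-1) by ring.
congr (_ - _).
  have e : (x + 2^-1) + (- x + 2^-1) = 1 by field.
  set a := x + _ in a1 e *; set b := - x + _ in a2 e *.
  have -> : (a * b)^-1 = (a + b) / (a * b) by rewrite e mul1r.
  by move: a b a1 a2 {e f1 f2} => a b a1 a2; field; rewrite a1 a2.
have -> : 2 * N%:R + 1 = (x + N%:R + 2^-1) + (- x + N%:R + 2^-1) by field.
set a := x + _ + _ in a3 *; set b := - x + _ + _ in a4 *.
by move: a b a3 a4 {f1 f2} => a b a3 a4; field; rewrite a3 a4.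
Qed.

(** ** The conditionally convergent series of weight 2 *)

Lemma cotq_tends tau : uhp tau -> ctends (fun N => cotq (qexp (N.*2.+1%:R * tau))) 1.
Proof.
move=> ut; have q1 := cabs_qexp_lt1 ut.
have h : ctends (fun N => qexp (N.*2.+1%:R * tau)) 0.
  have hN n : (n <= n.*2.+1)%N by rewrite -addnn ltnW// ltnS leq_addr.
  apply: (ctends_sub (u := fun n => qexp (n%:R * tau)) hN).
  apply: (@ctends_le _ _ _ (fun n => cabs (qexp tau) ^+ n)).
    by apply: nearW => n; rewrite subr0 qexpMn cabsX.
  by apply: cvg_expr; rewrite ger0_norm ?cabs_ge0.
have h1 := ctendsD (ctends_cst 1) h.
have n0 : 1 - 0 != 0 :> C by rewrite subr0 oner_eq0.
have h2 := ctendsV n0 (ctendsB (ctends_cst 1) h).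
by have := ctendsM h1 h2; rewrite addr0 subr0 divr1.
Qed.

(** What is missing from the sum of a row of [tele] after N terms. *)
Definition tele_def tau m N : C :=
  (2 * N%:R + 1) / ((N%:R + 2^-1) ^+ 2 - (m.+1%:R * tau) ^+ 2).

Lemma asum_sqr (u : nat -> C) (K : R) : 0 <= K ->
  (forall n, cabs (u n) <= K * n.+1%:R ^- 2) -> asum u.
Proof.
move=> K0 H; exists (K * 2); apply: (dominated_le H) => n.
by rewrite -mulr_sumr ler_wpM2l// inv_sqr_sum.
Qed.

Lemma tele_term_le tau : uhp tau -> exists2 K : R, 0 <= K &
  forall m (t : R), cabs (((m.+1%:R * tau + t%:C) ^+ 2 - 4^-1)^-1) <= K * m.+1%:R ^- 2.
Proof.
move=> ut; have [d d0 H] := lattice_ge ut.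
exists (d ^- 2); first by rewrite invr_ge0 exprn_ge0// ltW.
move=> m t; have m1 := natr_ge1 m.
have h (s : R) : d * m.+1%:R <= cabs (m.+1%:R * tau + s%:C).
  rewrite natC; apply: le_trans (H m.+1%:R s (ler0n _ _)).
  by rewrite ler_wpM2l ?(ltW d0)// lerDl.
have half : (2^-1 : R)%:C = 2^-1 :> C by rewrite fmorphV /= rmorph_nat.
have f4 : (m.+1%:R * tau + t%:C) ^+ 2 - 4^-1 =
    (m.+1%:R * tau + (t + 2^-1)%:C) * (m.+1%:R * tau + (t - 2^-1)%:C).
  by rewrite !rmorphD rmorphN /= half; field.
have p : 0 < d * m.+1%:R by rewrite mulr_gt0.
rewrite f4 cabsV cabsM -invfM -exprMn lef_pV2 ?posrE ?exprn_gt0//.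
  by rewrite expr2; apply: ler_pM => //; exact: ltW.
by rewrite mulr_gt0//; apply: lt_le_trans (h _).
Qed.

Lemma asum_tele_col tau n : uhp tau -> asum (fun m => tele tau m n).
Proof.
move=> ut; have [K K0 H] := tele_term_le ut.
apply: asumD; apply: (asum_sqr K0) => m.
  by rewrite [n.+1%:R]natC; exact: H.
by rewrite [n.+1%:R]natC -rmorphN; exact: H.
Qed.

Lemma tele_row tau m : uhp tau ->
  csums (tele tau m) ((4^-1 - (m.+1%:R * tau) ^+ 2)^-1).
Proof.
move=> ut; set x := m.+1%:R * tau.
have ux : uhp x by exact: (@uhpMn _ _ m.+1).
have half : 2^-1 = (2^-1 : R)%:C :> C by rewrite fmorphV /= rmorph_nat.
have h : ctends (fun N : nat => (x + N%:R + 2^-1)^-1 + (- x + N%:R + 2^-1)^-1) 0.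
  rewrite -[0]addr0; apply: ctendsD.
    have := ctends_inv (x + 2^-1); apply: eq_ctends; apply: nearW => n.
    by rewrite addrAC.
  have := ctends_inv (- x + 2^-1); apply: eq_ctends; apply: nearW => n.
  by rewrite addrAC.
have := ctendsB (ctends_cst ((4^-1 - x ^+ 2)^-1)) h; rewrite subr0.
apply: eq_ctends; apply: nearW => N; rewrite (tele_row_partial m N ut) -/x.
congr (_ - _).
have nz z (w : C) : complex.Im z != 0 -> complex.Im w = 0 -> z + w != 0.
  by case: z w => a b [c d] /= b0 d0; rewrite eq_complex /= d0 addr0 negb_and b0 orbT.
have iN : complex.Im (N%:R + 2^-1 : C) = 0.
  by rewrite natC half -rmorphD.
have x0 : complex.Im x != 0 by rewrite gt_eqF.
have x0' : complex.Im (- x) != 0 by case: (x) x0 => a b /=; rewrite oppr_eq0.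
have a3 := nz _ _ x0 iN; have a4 := nz _ _ x0' iN; rewrite !addrA in a3 a4.
have f2 : (N%:R + 2^-1) ^+ 2 - x ^+ 2 = (x + N%:R + 2^-1) * (- x + N%:R + 2^-1) by ring.
rewrite f2; have -> : 2 * N%:R + 1 = (x + N%:R + 2^-1) + (- x + N%:R + 2^-1) by field.
set a := x + _ + _ in a3 *; set b := - x + _ + _ in a4 *.
by move: a b a3 a4 {f2} => a b a3 a4; field; rewrite a3 a4.
Qed.

(** By partial fractions the sum over m is a cotangent series at a point
    that moves up in the half-plane as N grows. *)
Lemma tele_def_sum tau N : uhp tau ->
  csums (fun m => tele_def tau m N)
    (twopii R / 2 / tau * cotq (qexp (N.*2.+1%:R * (- tau^-1 / 2))) - (2 * (2 * N%:R + 1)^-1)).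
Proof.
move=> ut; have t0 := uhp_neq0 ut.
pose z := N.*2.+1%:R * (- tau^-1 / 2).
have uz : uhp z.
  apply: (@uhpMn _ _ N.*2.+1) => //; rewrite mulrC.
  have -> : 2^-1 = (2^-1 : R)%:C :> C by rewrite fmorphV /= rmorph_nat.
  by rewrite /uhp /= ImZ mulr_gt0 ?invr_gt0//; exact: uhp_inv.
have z0 := uhp_neq0 uz.
have N0 : 2 * N%:R + 1 != 0 :> C by rewrite -natrM natr1 pnatr_eq0.
have N2 : N.*2.+1%:R = 2 * N%:R + 1 :> C by rewrite -natr1 -mul2n natrM.
have := ctendsZ (- tau^-1) (ctendsB (cot_series uz) (ctends_cst (z ^- 1))).
have -> : - tau^-1 * (- twopii R / 2 * cotq (qexp z) - z ^- 1) =
    twopii R / 2 / tau * cotq (qexp z) - 2 * (2 * N%:R + 1)^-1.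
  rewrite expr1 /z N2; move: (cotq _) (twopii R) => x T; field.
  by rewrite N0 t0.
apply: eq_ctends; apply: nearW => M.
rewrite /lsum addrAC subrr add0r mulr_sumr; apply: eq_bigr => m _.
have hp : z + m.+1%:R != 0 by exact/uhp_neq0/uhpDn.
have hm : z - m.+1%:R != 0 by exact/uhp_neq0/uhpBn.
rewrite /tele_def !expr1.
have -> : (N%:R + 2^-1) ^+ 2 - (m.+1%:R * tau) ^+ 2 =
    tau ^+ 2 * ((z + m.+1%:R) * (z - m.+1%:R)).
  by rewrite /z N2; field.
have -> : 2 * N%:R + 1 = - tau * ((z + m.+1%:R) + (z - m.+1%:R)).
  by rewrite /z N2; field.
by move: (z + _) (z - _) hp hm => x y x0 y0; field; rewrite t0 x0 y0.
Qed.

(** The orders of summation agree for [lat] minus [tele], so the discrepancy is that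
    of [tele], which is the limit of [tele_def_sum]. *)
Lemma latsum2_swap tau : uhp tau ->
  csums (fun n => csum (fun m => lat 2 tau m n)) (latsum 2 tau - twopii R / 2 / tau).
Proof.
move=> ut.
have [K K0 H] := lat_tele_bound ut.
have [s1 s2 e] := swap4 K0 H.
have [L L0 HL] := lat_bound (leqnn 2) ut.
have HLr m n : cabs (lat 2 tau m n) <= L * n.+1%:R ^- 2.
  apply: le_trans (HL m n) _; rewrite ler_wpM2l// lef_pV2 ?posrE ?exprn_gt0 ?addr_gt0//.
  by rewrite lerXn2r ?nnegrE ?addr_ge0// lerDr.
have HLc m n : cabs (lat 2 tau m n) <= L * m.+1%:R ^- 2.
  apply: le_trans (HL m n) _; rewrite ler_wpM2l// lef_pV2 ?posrE ?exprn_gt0 ?addr_gt0//.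
  by rewrite lerXn2r ?nnegrE ?addr_ge0// lerDl.
have sr m : asum (lat 2 tau m) by exact: asum_sqr L0 (HLr m).
have sc n : asum (fun m => lat 2 tau m n) by exact: asum_sqr L0 (HLc^~ n).
have [T T0 HT] := tele_term_le ut.
pose r m : C := (4^-1 - (m.+1%:R * tau) ^+ 2)^-1.
have sR : asum r.
  apply: (asum_sqr T0) => m; have := HT m 0; rewrite addr0.
  by rewrite -[X in cabs X^-1]opprB invrN cabsN.
have rowE m : csum (fun n => lat 2 tau m n - tele tau m n) = csum (lat 2 tau m) - r m.
  apply: csumE; apply: eq_ctends (ctendsB (asum_cvg (sr m)) (tele_row m ut)).
  by apply: nearW => n; rewrite -sumrB.
have colE n : csum (fun m => lat 2 tau m n - tele tau m n) =
    csum (fun m => lat 2 tau m n) - csum (fun m => tele tau m n).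
  have st := asum_tele_col n ut.
  by rewrite -csumN// -csumD//; exact: asumN.
have srow : asum (fun m => csum (lat 2 tau m)).
  have := asumD s2 sR; congr asum; apply/funext => m; rewrite rowE; ring.
have eS : csum (fun m => csum (fun n => lat 2 tau m n - tele tau m n)) =
    latsum 2 tau - csum r.
  by rewrite (eq_csum rowE) csumD ?csumN//; exact: asumN.
have hcol : csums (fun n => csum (fun m => tele tau m n)) (csum r - twopii R / 2 / tau).
  have tN : ctends (fun N : nat => csum r - (twopii R / 2 / tau *
      cotq (qexp (N.*2.+1%:R * (- tau^-1 / 2))) - 2 * (2 * N%:R + 1)^-1))
      (csum r - (twopii R / 2 / tau * 1 - 2 * 0)).
    apply: ctendsB (ctends_cst _) _; apply: ctendsB.
      apply/ctendsZ/cotq_tends; rewrite mulrC.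
      have -> : 2^-1 = (2^-1 : R)%:C :> C by rewrite fmorphV /= rmorph_nat.
      by rewrite /uhp /= ImZ mulr_gt0 ?invr_gt0//; exact: uhp_inv.
    apply: ctendsZ.
    have := ctendsZ (2^-1 : C) (ctends_inv (2^-1 : C)); rewrite mulr0; apply: eq_ctends.
    by apply: nearW => n; rewrite -invfM; congr (_^-1); field.
  rewrite mulr1 mulr0 subr0 in tN; apply: eq_ctends tN; apply: nearW => N.
  have [_ <-] := csum_sum (index_iota 0 N) (fun n => asum_tele_col n ut).
  apply/esym/csumE; have := ctendsB (asum_cvg sR) (tele_def_sum N ut).
  apply: eq_ctends; apply: nearW => M; rewrite -sumrB; apply: eq_bigr => m _.
  by rewrite tele_row_partial.
have := ctendsD (asum_cvg s1) hcol; rewrite -e eS.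
have -> : latsum 2 tau - csum r + (csum r - twopii R / 2 / tau) =
    latsum 2 tau - twopii R / 2 / tau by ring.
apply: eq_ctends; apply: nearW => N; rewrite -big_split /=; apply: eq_bigr => n _.
by rewrite colE subrK.
Qed.

Lemma latsum2_inv tau : uhp tau ->
  latsum 2 (- tau^-1) = tau ^+ 2 * latsum 2 tau - twopii R / 2 * tau.
Proof.
move=> ut; have h := latsum2_swap ut; have t0 := uhp_neq0 ut.
have ex : exists l, csums (fun n => csum (fun m => lat 2 tau m n)) l.
  by eexists; exact: h.
have := latsum_inv_swap (k := 2) isT isT ut ex; rewrite (csumE h) => ->.
by move: (latsum _ _) (twopii R) => x T; field.
Qed.

End Lattice.

(** * Eisenstein series *)

Section Eisenstein.
Variable R : realType.
Local Notation C := R[i].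
Implicit Types (z w h tau : C) (m n : nat).

Definition powc e : nat -> C := fun m => m%:R ^+ e.

Lemma tame_powc e : tame (powc e).
Proof.
elim: e => [|e IH]; first by exact: (@tame_le _ _ _ _ (@tame1 R)).
have -> : powc e.+1 = (fun n => n%:R * powc e n).
  by apply/funext => n; rewrite /powc exprS.
exact: tame_muln.
Qed.

Lemma powcM e n m : powc e (n * m)%N = n%:R ^+ e * powc e m.
Proof. by rewrite /powc natrM exprMn. Qed.

(** The case n = 0 is separate because the list of divisors of 0 is not empty. *)
Definition sigc e n : C := if n is 0%N then 0 else (sigma e n)%:R.

Lemma sigma_le e n : (0 < n)%N -> (sigma e n <= n ^ e.+1)%N.
Proof.
case: n => // n _; rewrite /sigma.
apply: (@leq_trans (\sum_(d <- divisors n.+1) n.+1 ^ e)%N).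
  rewrite big_seq [leqRHS]big_seq; apply: leq_sum => d.
  rewrite -dvdn_divisors// => /dvdn_leq dn.
  by case: e => // e; rewrite leq_exp2r// dn.
rewrite big_const_seq count_predT iter_addn_0 expnSr leq_mul2l; apply/orP; right.
have : (size (divisors n.+1) <= size (iota 1 n.+1))%N.
  apply: uniq_leq_size; first exact: divisors_uniq.
  move=> d; rewrite -dvdn_divisors// mem_iota => h.
  by rewrite (dvdn_gt0 _ h)// add1n ltnS dvdn_leq.
by rewrite size_iota.
Qed.

Lemma tame_sigc e : tame (sigc e).
Proof.
apply: (@tame_le _ _ (powc e.+1)); last exact: tame_powc.
case=> [|n]; first by rewrite cabs0 cabs_ge0.
by rewrite cabs_nat cabsX cabs_nat -natrX ler_nat sigma_le.
Qed.

Lemma sigma_sum e N : (0 < N)%N -> (sigma e N = \sum_(0 <= m < N)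
   if m.+1 %| N then (N %/ m.+1) ^ e else 0)%N.
Proof.
case: N => // N _; rewrite -big_mkcond /= /sigma.
have N0 : (0 < N.+1)%N by [].
rewrite (perm_big [seq (N.+1 %/ d)%N | d <- divisors N.+1]) /=; last first.
  have inj : {in divisors N.+1 &, injective (fun d => N.+1 %/ d)%N}.
    move=> a b; rewrite -!dvdn_divisors// => ha hb e1.
    have a0 := dvdn_gt0 N0 ha; have b0 := dvdn_gt0 N0 hb.
    have q0 : (0 < N.+1 %/ a)%N by rewrite divn_gt0// dvdn_leq.
    apply/eqP; rewrite -(eqn_pmul2l q0) (divnK ha) e1 (divnK hb)//.
  apply: uniq_perm; first exact: divisors_uniq.
    by rewrite map_inj_in_uniq ?divisors_uniq.
  move=> d; apply/idP/mapP => [hd|[a ha ->]].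
    rewrite -dvdn_divisors// in hd; exists (N.+1 %/ d)%N.
      by rewrite -dvdn_divisors// dvdn_div.
    by rewrite divnA// mulnC mulnK// (dvdn_gt0 N0 hd).
  by rewrite -dvdn_divisors// in ha; rewrite -dvdn_divisors// dvdn_div.
rewrite big_map (perm_big [seq m.+1 | m <- index_iota 0 N.+1 & (m.+1 %| N.+1)%N]).
  by rewrite big_map big_filter.
apply: uniq_perm; first exact: divisors_uniq.
  by rewrite map_inj_uniq ?filter_uniq ?iota_uniq//; move=> a b [].
move=> d; rewrite -dvdn_divisors//; apply/idP/mapP => [hd|[m]].
  exists d.-1; last by rewrite prednK// (dvdn_gt0 N0 hd).
  rewrite mem_filter prednK ?(dvdn_gt0 N0 hd)// hd mem_index_iota /=.
  by rewrite prednK ?(dvdn_gt0 N0 hd)// dvdn_leq.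
by rewrite mem_filter => /andP[h _] ->.
Qed.

(** Both sides sum over the pairs (m, n) with q^{mn}; collecting equal exponents
    gives divisor sums. *)
Lemma lambert e tau : (0 < e)%N -> uhp tau ->
  asum (fun m => peval (powc e) (qexp (m.+1%:R * tau))) /\
  csum (fun m => peval (powc e) (qexp (m.+1%:R * tau))) = peval (sigc e) (qexp tau).
Proof.
move=> e0 ut; have q1 := cabs_qexp_lt1 ut; set q := qexp tau in q1 *.
pose f m N : C := (N %/ m.+1)%:R ^+ e * q ^+ N.
pose w m N : C := if (m.+1 %| N)%N then f m N else 0.
have fle m N : cabs (f m N) <= cabs (powc e N * q ^+ N).
  rewrite !cabsM !cabsX !cabs_nat ler_wpM2r ?exprn_ge0 ?cabs_ge0//.
  by rewrite lerXn2r ?nnegrE// ler_nat leq_div.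
have sP : asum (fun N => powc e N * q ^+ N) by exact: tame_summable (tame_powc e) q1.
have row m : csum (w m) = peval (powc e) (qexp (m.+1%:R * tau)).
  rewrite csum_dvd//; last exact: asum_le (fle m) sP.
  rewrite qexpMn -/q; apply: eq_csum => j.
  by rewrite /f mulKn// /powc exprM.
have col N : csum (fun m => w m N) = sigc e N * q ^+ N.
  have h k : w (N + k)%N N = 0.
    rewrite /w; case: ifP => // /dvdn_leq; case: N => [|N] h.
      by rewrite /f div0n expr0n gtn_eqF ?mul0r.
    by have := h isT; rewrite ltnNge leq_addr.
  have [_ ->] := csum_finite (u := w^~ N) h.
  case: N {h} => [|N]; first by rewrite big_geq// mul0r.
  rewrite /sigc sigma_sum// natr_sum mulr_suml; apply: eq_bigr => m _.
  by rewrite /w /f; case: ifP => _; rewrite ?mul0r// natrX.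
pose s : R := (1 + cabs q) / 2; have q0 : 0 < cabs q by exact: cabs_qexp_gt0.
have s01 : 0 < s < 1 by rewrite /s; lra.
case/andP: s01 => s0 s1.
have qs : 0 < cabs q / s < 1.
  by rewrite divr_gt0//= ltr_pdivrMr// /s; lra.
have [B B0 hB] := tame_bound (tame_powc e) qs.
have [] := @csum_swap _ w (fun m => s ^+ m.+1)
   (fun N => cabs (powc e N) * (cabs q / s) ^+ N) (1 - s)^-1 B.
- move=> m N; case: N => [|N].
    have -> : w m 0%N = 0 by rewrite /w dvdn0 /f div0n expr0n gtn_eqF// mul0r.
    by rewrite cabs0 expr0 mulr1 mulr_ge0 ?cabs_ge0// exprn_ge0// ltW.
  rewrite /w; case: ifP => hd; last first.
    rewrite cabs0 !mulr_ge0 ?cabs_ge0// exprn_ge0//; apply: ltW => //.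
    by case/andP: qs.
  apply: le_trans (fle m _) _; rewrite cabsM cabsX mulrCA ler_wpM2l ?cabs_ge0//.
  rewrite [(cabs q / s) ^+ _]expr_div_n mulrA ler_pdivlMr ?exprn_gt0//.
  rewrite mulrC ler_wpM2r ?exprn_ge0 ?cabs_ge0//.
  by rewrite ler_wiXn2l ?(ltW s0) ?(ltW s1)// dvdn_leq.
- by move=> n; rewrite exprn_ge0// ltW.
- by move=> n; rewrite mulr_ge0 ?cabs_ge0// exprn_ge0//; case/andP: qs => /ltW.
- move=> n; apply: le_trans (geom_sum_le n.+1 (x := s) _); last by rewrite ltW.
  by rewrite [leRHS]big_nat_recl// lerDr.
- exact: hB.
move=> _ s2 e1.
rewrite (_ : (fun m => peval _ _) = (fun m => csum (w m))); last first.
  by apply/funext => m; rewrite row.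
by split=> //; rewrite e1; apply: eq_csum => N; rewrite col.
Qed.

Lemma sigma_seriesE e tau : uhp tau -> sigma_series e tau = peval (sigc e) (qexp tau).
Proof.
move=> ut; rewrite /peval csum_recl ?mul0r ?add0r//.
exact: tame_summable (tame_sigc e) (cabs_qexp_lt1 ut).
Qed.

(** The power series with coefficients m^(k-1) is an Eulerian polynomial divided by
    (1 - z)^k, and the value of that polynomial at 1 is (k-1)!. *)
Lemma pdiff2 : (forall i, iter 2 (@pdiff R) (powc 1) (2 + i)%N = 0) /\
  \sum_(0 <= i < 2) iter 2 (@pdiff R) (powc 1) i = 1.
Proof.
split=> [i|]; last by rewrite !big_nat_recr ?big_nil//= /pdiff /qshift /= /powc; ring.
by rewrite /= /pdiff /qshift /= /powc -!natr1; ring.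
Qed.

Lemma pdiff4 : (forall i, iter 4 (@pdiff R) (powc 3) (4 + i)%N = 0) /\
  \sum_(0 <= i < 4) iter 4 (@pdiff R) (powc 3) i = 6.
Proof.
split=> [i|]; last by rewrite !big_nat_recr ?big_nil//= /pdiff /qshift /= /powc; ring.
by rewrite /= /pdiff /qshift /= /powc -!natr1; ring.
Qed.

Lemma pdiff6 : (forall i, iter 6 (@pdiff R) (powc 5) (6 + i)%N = 0) /\
  \sum_(0 <= i < 6) iter 6 (@pdiff R) (powc 5) i = 120.
Proof.
split=> [i|]; last by rewrite !big_nat_recr ?big_nil//= /pdiff /qshift /= /powc; ring.
by rewrite /= /pdiff /qshift /= /powc -!natr1; ring.
Qed.

Definition zetaval k : C := csum (fun n => n.+1%:R ^- k).

Lemma asum_zeta k : (2 <= k)%N -> asum (fun n => n.+1%:R ^- k : C).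
Proof.
move=> k2; apply: (@asum_sqr _ _ 1) => // n.
rewrite mul1r cabsV cabsX cabs_nat lef_pV2 ?posrE ?exprn_gt0//.
by rewrite ler_weXn2l// natr_ge1.
Qed.

Section Weight.
Variables (k : nat) (s : C).
Hypothesis k2 : (2 <= k)%N.
Hypothesis ek : ~~ odd k.
Hypothesis s0 : s != 0.
Hypothesis kfin : forall i, iter k (@pdiff R) (powc k.-1) (k + i)%N = 0.
Hypothesis ksum : \sum_(0 <= i < k) iter k (@pdiff R) (powc k.-1) i = s.

Let Ck : C := (- twopii R) ^+ k / s.

Lemma lat_row tau m : uhp tau ->
  csum (lat k tau m) =
  Ck * peval (powc k.-1) (qexp (m.+1%:R * tau)) - (m.+1%:R * tau) ^- k.
Proof.
move=> ut; have um : uhp (m.+1%:R * tau) by exact: (@uhpMn _ _ m.+1).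
apply: csumE.
have h := lipschitz (ltnW k2) (tame_powc k.-1) s0 (powcM k.-1) kfin ksum k2 um.
have := ctendsB h (ctends_cst ((m.+1%:R * tau) ^- k)).
by apply: eq_ctends; apply: nearW => N; rewrite /lsum addrAC subrr add0r.
Qed.

Lemma latsumE tau : uhp tau ->
  latsum k tau = Ck * peval (sigc k.-1) (qexp tau) - tau ^- k * zetaval k.
Proof.
move=> ut; rewrite /latsum (eq_csum (fun m => lat_row m ut)).
have k1 : (0 < k.-1)%N by rewrite -ltnS prednK// ltnW.
have [h1 h2] := lambert k1 ut.
have h3 := asum_zeta k2.
have e m : (m.+1%:R * tau) ^- k = tau ^- k * m.+1%:R ^- k.
  by rewrite exprMn invfM mulrC.
under eq_csum do rewrite e.
rewrite csumD; [|exact: asumZ|exact/asumN/asumZ].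
by rewrite csumZ// h2 csumN ?csumZ//; exact: asumZ.
Qed.

Definition eis tau := zetaval k + Ck * peval (sigc k.-1) (qexp tau).

Lemma eis_inv tau (r : C) : uhp tau ->
  latsum k (- tau^-1) = tau ^+ k * latsum k tau + r ->
  eis (- tau^-1) = tau ^+ k * eis tau + r.
Proof.
move=> ut; have t0 := uhp_neq0 ut; rewrite !latsumE//; last exact: uhp_inv.
have -> : (- tau^-1) ^- k = tau ^+ k.
  by rewrite exprNn -signr_odd (negbTE ek) mul1r exprVn invrK.
have tk : tau ^+ k != 0 by rewrite expf_neq0.
rewrite /eis; move: (peval _ _) (peval _ (qexp (- tau^-1))) (zetaval k) Ck => y x Z D.
move: (tau ^+ k) tk => T T0 e.
have -> : D * x = (D * x - T * Z) + T * Z by ring.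
by rewrite e; field.
Qed.

End Weight.

Lemma eis_inv4 k s tau : (4 <= k)%N -> ~~ odd k -> s != 0 ->
  (forall i, iter k (@pdiff R) (powc k.-1) (k + i)%N = 0) ->
  \sum_(0 <= i < k) iter k (@pdiff R) (powc k.-1) i = s -> uhp tau ->
  eis k s (- tau^-1) = tau ^+ k * eis k s tau.
Proof.
move=> k4 ek s0 kf ks ut; rewrite -[RHS]addr0.
have k2 : (2 <= k)%N by exact: leq_trans k4.
by apply: eis_inv => //; rewrite latsum_inv// addr0.
Qed.

Lemma eis2_inv tau : uhp tau ->
  eis 2 1 (- tau^-1) = tau ^+ 2 * eis 2 1 tau - twopii R / 2 * tau.
Proof.
move=> ut; have [h1 h2] := pdiff2.
by apply: (eis_inv (k := 2)) => //; rewrite ?oner_eq0 ?latsum2_inv.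
Qed.

(** The Lipschitz series of weights 2 and 4 are polynomially related. *)
Lemma kernel24 z : cabs z < 1 ->
  peval (powc 3) z = 6 * peval (powc 1) z ^+ 2 + peval (powc 1) z.
Proof.
move=> z1; have [h1 _] := pdiff2; have [h2 _] := pdiff4.
rewrite (kernelE (tame_powc 3) h2 z1) (kernelE (tame_powc 1) h1 z1).
rewrite !big_nat_recr ?big_nil//= /pdiff /qshift /= /powc.
by have := disc_1B z1 => n0; field.
Qed.

Lemma lat_axis_tends k : ~~ odd k -> (2 <= k)%N ->
  ctends (fun K => csum (fun n => ((0 +i* K.+1%:R^-1) + n.+1%:R) ^- k +
                                  ((0 +i* K.+1%:R^-1) - n.+1%:R) ^- k))
    (2 * zetaval k).
Proof.
move=> ek k2; pose y K : C := 0 +i* K.+1%:R^-1.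
have y0 : ctends y 0.
  apply: (@ctends_le _ _ _ harmonic); last exact: cvg_harmonic.
  apply: nearW => K; rewrite subr0 /harmonic /=.
  have := cabs_ReIm (y K); rewrite /= normr0 add0r => /le_trans; apply.
  by rewrite ger0_norm// invr_ge0.
have yR K n : complex.Re (y K + n%:R) = n%:R by rewrite natC ReDr add0r.
have yR' K n : complex.Re (y K - n%:R) = - n%:R.
  by rewrite natC -rmorphN ReDr add0r.
have nn n : n.+1%:R != 0 :> C by rewrite pnatr_eq0.
pose a K n := (y K + n.+1%:R) ^- k + (y K - n.+1%:R) ^- k.
have at_ n : ctends (a^~ n) (2 * n.+1%:R ^- k).
  have nk : n.+1%:R ^+ k != 0 :> C by rewrite expf_neq0.
  have -> : 2 * n.+1%:R ^- k = n.+1%:R ^- k + n.+1%:R ^- k :> C by ring.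
  apply: ctendsD; apply: ctendsV => //.
    by have := ctendsX k (ctendsD y0 (ctends_cst n.+1%:R)); rewrite add0r.
  have := ctendsX k (ctendsB y0 (ctends_cst n.+1%:R)).
  by rewrite sub0r exprNn -signr_odd (negbTE ek) mul1r.
have ab : \forall K \near \oo, forall n, cabs (a K n) <= 2 * n.+1%:R ^- 2.
  apply: nearW => K n.
  have h z : `|complex.Re z| = n.+1%:R -> cabs (z ^- k) <= n.+1%:R ^- 2.
    move=> e; have hz := cabs_Re z; rewrite e in hz.
    have z0 : 0 < cabs z by apply: lt_le_trans hz.
    rewrite cabsV cabsX lef_pV2 ?posrE ?exprn_gt0//.
    apply: (@le_trans _ _ (n.+1%:R ^+ k)); first by rewrite ler_weXn2l// natr_ge1.
    by rewrite lerXn2r ?nnegrE ?cabs_ge0.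
  apply: le_trans (cabsD _ _) _; rewrite [leRHS]mulr_natl mulr2n.
  by apply: lerD; apply: h; rewrite ?yR ?yR' ?normrN ger0_norm.
have bB n : \sum_(0 <= i < n) 2 * i.+1%:R ^- 2 <= 2 * 2 :> R.
  by rewrite -mulr_sumr ler_wpM2l// inv_sqr_sum.
have [_] := tannery at_ ab bB.
by rewrite /zetaval -csumZ//; exact: asum_zeta.
Qed.

(** Along tau = i / K the terms with n different from 0 tend to zeta values, while
    the relation between weights 2 and 4 has a pole; comparing its polar part
    determines zeta(2). *)
Lemma zeta2E : zetaval 2 = - twopii R ^+ 2 / 24.
Proof.
pose y K : C := 0 +i* K.+1%:R^-1.
have uy K : uhp (y K) by rewrite /uhp /= invr_gt0.
have y0 K : y K != 0 by exact: uhp_neq0.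
pose a K := csum (fun n => (y K + n.+1%:R) ^- 2 + (y K - n.+1%:R) ^- 2).
pose b K := csum (fun n => (y K + n.+1%:R) ^- 4 + (y K - n.+1%:R) ^- 4).
have ha : ctends a (2 * zetaval 2) by exact: (@lat_axis_tends 2).
have hb : ctends b (2 * zetaval 4) by exact: (@lat_axis_tends 4).
have yt : ctends y 0.
  apply: (@ctends_le _ _ _ harmonic); last exact: cvg_harmonic.
  apply: nearW => K; rewrite subr0 /harmonic /=.
  have := cabs_ReIm (y K); rewrite /= normr0 add0r => /le_trans; apply.
  by rewrite ger0_norm// invr_ge0.
have [h2 h2'] := pdiff2; have [h4 h4'] := pdiff4.
have six : 6 != 0 :> C by rewrite pnatr_eq0.
have aE K : a K = (twopii R) ^+ 2 * peval (powc 1) (qexp (y K)) - y K ^- 2.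
  apply: csumE.
  have h := lipschitz (k := 2) isT (tame_powc 1) (oner_neq0 _) (powcM 1) h2 h2' isT (uy K).
  have := ctendsB h (ctends_cst (y K ^- 2)); rewrite sqrrN divr1.
  by apply: eq_ctends; apply: nearW => N; rewrite /lsum addrAC subrr add0r.
have bE K : b K = (twopii R) ^+ 4 / 6 * peval (powc 3) (qexp (y K)) - y K ^- 4.
  apply: csumE.
  have h := lipschitz (k := 4) isT (tame_powc 3) six (powcM 3) h4 h4' isT (uy K).
  have := ctendsB h (ctends_cst (y K ^- 4)).
  have -> : (- twopii R) ^+ 4 = twopii R ^+ 4 by ring.
  by apply: eq_ctends; apply: nearW => N; rewrite /lsum addrAC subrr add0r.
have key K : 2 * a K + twopii R ^+ 2 / 6 =
    y K ^+ 2 * (b K - a K ^+ 2 - twopii R ^+ 2 / 6 * a K).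
  rewrite bE (kernel24 (cabs_qexp_lt1 (uy K))) !aE.
  move: (y K) (y0 K) (peval _ _) (twopii R) => t t0 p T; field.
  by rewrite t0.
have l1 := ctendsD (ctendsZ 2 ha) (ctends_cst (twopii R ^+ 2 / 6)).
have l2 := ctendsM (ctendsX 2 yt) (ctendsB (ctendsB hb (ctendsX 2 ha))
   (ctendsZ (twopii R ^+ 2 / 6) ha)).
rewrite expr0n mul0r in l2.
have l1' : ctends (fun n => y n ^+ 2 * (b n - a n ^+ 2 - twopii R ^+ 2 / 6 * a n))
    (2 * (2 * zetaval 2) + twopii R ^+ 2 / 6).
  by apply: eq_ctends l1; apply: nearW => K; rewrite key.
have e := ctends_unique l1' l2.
have -> : zetaval 2 = (2 * (2 * zetaval 2) + twopii R ^+ 2 / 6) / 4 - twopii R ^+ 2 / 24.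
  by move: (zetaval 2) (twopii R) => Z T; field.
by rewrite e mul0r sub0r mulNr.
Qed.

Lemma E2_peval tau : uhp tau -> E2 tau = 1 - 24 * peval (sigc 1) (qexp tau).
Proof. by move=> ut; rewrite /E2 sigma_seriesE. Qed.

Lemma E2_inv tau : uhp tau ->
  E2 (- tau^-1) = tau ^+ 2 * E2 tau + 12 / twopii R * tau.
Proof.
move=> ut; have ui := uhp_inv ut; have T0 := twopii_neq0 R.
have := eis2_inv ut; rewrite /eis zeta2E !E2_peval// divr1 sqrrN.
move: (peval _ _) (peval _ (qexp (- tau^-1))) (twopii R) T0 => z x T T0 e.
have -> : 1 - 24 * x = - (24 / T ^+ 2) * (- T ^+ 2 / 24 + T ^+ 2 * x) by field.
by rewrite e; field.
Qed.

End Eisenstein.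

(** * Functions with a q-expansion *)

Section QSeries.
Variable R : realType.
Local Notation C := R[i].
Local Notation T := (twopii R).
Implicit Types (z w h tau : C) (m n : nat) (f g : C -> C) (a b c : nat -> C).

Definition qs f c := tame c /\ forall tau, uhp tau -> f tau = peval c (qexp tau).

Definition qser f := exists c, qs f c.

Lemma eq_qs f g c : (forall tau, uhp tau -> f tau = g tau) -> qs f c -> qs g c.
Proof. by move=> fg [h1 h2]; split=> // tau ut; rewrite -fg// h2. Qed.

Lemma qs_cst z : qs (fun=> z) (pconst z).
Proof. by split; [exact: tame_const | move=> tau _; rewrite peval_const]. Qed.

Lemma qsD f g a b : qs f a -> qs g b -> qs (fun t => f t + g t) (fun n => a n + b n).
Proof.
move=> [ha fa] [hb gb]; split; first exact: tameD.
by move=> tau ut; rewrite fa// gb// pevalD// cabs_qexp_lt1.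
Qed.

Lemma qsZ f a z : qs f a -> qs (fun t => z * f t) (fun n => z * a n).
Proof.
move=> [ha fa]; split; first exact: tameZ.
by move=> tau ut; rewrite fa// pevalZ// cabs_qexp_lt1.
Qed.

Lemma qsB f g a b : qs f a -> qs g b -> qs (fun t => f t - g t) (fun n => a n - b n).
Proof.
move=> ha hb; have := qsD ha (qsZ (-1) hb).
have -> : (fun t => f t + -1 * g t) = (fun t => f t - g t).
  by apply/funext => t; rewrite mulN1r.
by have -> : (fun n => a n + -1 * b n) = (fun n => a n - b n)
  by apply/funext => t; rewrite mulN1r.
Qed.

Lemma qsM f g a b : qs f a -> qs g b -> qs (fun t => f t * g t) (conv a b).
Proof.
move=> [ha fa] [hb gb]; split; first exact: tame_conv.
by move=> tau ut; rewrite fa// gb// pevalM// cabs_qexp_lt1.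
Qed.

Lemma conv0 a b : conv a b 0 = a 0%N * b 0%N.
Proof. by rewrite /conv big_ord1. Qed.

Lemma conv1 a b : conv a b 1 = a 0%N * b 1%N + a 1%N * b 0%N.
Proof. by rewrite /conv big_ord_recl big_ord1. Qed.

Lemma qs_inj f g a b : qs f a -> qs g b ->
  (forall tau, uhp tau -> f tau = g tau) -> forall n, a n = b n.
Proof.
move=> ha hb fg n; have [h1 h2] := qsB ha hb.
apply/eqP; rewrite -subr_eq0; apply/eqP.
by apply: (peval_eq0 h1) => tau ut; rewrite -h2// fg// subrr.
Qed.

Lemma qser_cst z : qser (fun=> z). Proof. by eexists; exact: qs_cst. Qed.
Lemma qserD f g : qser f -> qser g -> qser (fun t => f t + g t).
Proof. by move=> [a ha] [b hb]; eexists; exact: qsD ha hb. Qed.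
Lemma qserB f g : qser f -> qser g -> qser (fun t => f t - g t).
Proof. by move=> [a ha] [b hb]; eexists; exact: qsB ha hb. Qed.
Lemma qserZ f z : qser f -> qser (fun t => z * f t).
Proof. by move=> [a ha]; eexists; exact: qsZ ha. Qed.
Lemma qserM f g : qser f -> qser g -> qser (fun t => f t * g t).
Proof. by move=> [a ha] [b hb]; eexists; exact: qsM ha hb. Qed.
Lemma qserX f n : qser f -> qser (fun t => f t ^+ n).
Proof.
move=> hf; elim: n => [|n IH]; first exact: qser_cst.
have -> : (fun t => f t ^+ n.+1) = (fun t => f t * f t ^+ n).
  by apply/funext => t; rewrite exprS.
exact: qserM.
Qed.
Lemma eq_qser f g : (forall tau, uhp tau -> f tau = g tau) -> qser f -> qser g.
Proof. by move=> fg [c hc]; exists c; exact: eq_qs hc. Qed.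
Lemma qser_sum I (r : seq I) (F : I -> C -> C) :
  (forall i, qser (F i)) -> qser (fun t => \sum_(i <- r) F i t).
Proof.
move=> h; elim: r => [|i r IH].
  by apply: eq_qser (qser_cst 0) => tau _; rewrite big_nil.
by apply: eq_qser (qserD (h i) IH) => tau _; rewrite big_cons.
Qed.

Lemma qserS f tau : qser f -> uhp tau -> f (tau + 1) = f tau.
Proof. by move=> [c [_ hc]] ut; rewrite (hc _ (uhpS ut)) (hc _ ut) qexpS. Qed.

(** The operator q d/dq on coefficients. *)
Definition theta c n : C := n%:R * c n.

Lemma tame_theta c : tame c -> tame (theta c). Proof. exact: tame_muln. Qed.

Lemma qs_cder f c tau : qs f c -> uhp tau ->
  cder f tau (T * peval (theta c) (qexp tau)).
Proof.
move=> [hc fc] ut; have q1 := cabs_qexp_lt1 ut.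
apply: (cder_uhp ut (f := fun t => peval c (qexp t))); first by move=> w /fc.
apply: cder_eq (cder_comp (qexp_cder tau) (peval_cder hc q1)).
have -> : theta c = qshift (dcoef c).
  by apply/funext => -[|n]; rewrite /theta /= ?mul0r.
by rewrite peval_qshift//; [ring|exact: tame_dcoef].
Qed.

(** The solution d of q d' = s d with constant term 1: comparing coefficients
    determines d_n after division by n. *)
Fixpoint expseq s n : seq C :=
  if n is m.+1 then
    rcons (expseq s m)
      (m.+1%:R^-1 * \sum_(i < m.+1) s (m.+1 - i)%N * nth 0 (expseq s m) i)
  else [:: 1].

Definition expcoef s n := nth 0 (expseq s n) n.

Lemma size_expseq s n : size (expseq s n) = n.+1.
Proof. by elim: n => //= n IH; rewrite size_rcons IH. Qed.

Lemma nth_expseq s n i : (i <= n)%N -> nth 0 (expseq s n) i = expcoef s i.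
Proof.
elim: n => [|n IH]; first by rewrite leqn0 => /eqP ->.
rewrite leq_eqVlt => /orP[/eqP -> //|].
by rewrite ltnS => h; rewrite /= nth_rcons size_expseq ltnS h IH.
Qed.

Lemma expcoefS s n :
  n.+1%:R * expcoef s n.+1 = \sum_(i < n.+1) s (n.+1 - i)%N * expcoef s i.
Proof.
rewrite {1}/expcoef /= nth_rcons size_expseq ltnn eqxx mulrA mulfV ?pnatr_eq0// mul1r.
by apply: eq_bigr => i _; rewrite nth_expseq// -ltnS.
Qed.

Lemma theta_expcoef s n : s 0%N = 0 ->
  theta (expcoef s) n = conv s (expcoef s) n.
Proof.
move=> s0; case: n => [|n].
  by rewrite /theta mul0r conv0 s0 mul0r.
rewrite /theta expcoefS /conv [RHS]big_ord_recl s0 mul0r add0r.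
rewrite (reindex_inj rev_ord_inj) /=; apply: eq_bigr => i _.
by rewrite /bump /= add1n subKn.
Qed.

(** Majorization: if the sum of |s_i| r^i is at most A, then for n >= A a bound
    for |d_i| r^i with i < n is also a bound for i = n. *)
Lemma tame_expcoef s : tame s -> tame (expcoef s).
Proof.
move=> hs r r01; have [A A0 hA] := tame_bound hs r01.
have r0 : 0 <= r by lra.
pose e n := cabs (expcoef s n) * r ^+ n.
have e0 n : 0 <= e n by rewrite mulr_ge0 ?cabs_ge0// exprn_ge0.
pose N := Num.truncn A.
have hN : A < N.+1%:R by apply: truncnS_gt.
pose M := \sum_(0 <= i < N.+1) e i.
exists M => n; rewrite -/(e n).
elim/ltn_ind: n => n IH; case: (ltnP n N.+1) => nN.
  rewrite /M (@big_cat_nat _ _ _ n)//= ?(ltnW nN)// [X in _ + X]big_ltn// addrCA lerDl.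
  by rewrite addr_ge0// sumr_ge0.
case: n IH nN => // n IH nN.
have n1 : 0 < n.+1%:R :> R by [].
rewrite -(ler_pM2l n1).
have -> : n.+1%:R * e n.+1 = cabs (n.+1%:R * expcoef s n.+1) * r ^+ n.+1.
  by rewrite cabsM cabs_nat mulrA.
rewrite expcoefS; apply: le_trans (ler_wpM2r (exprn_ge0 _ r0) (cabs_sum _ _ _)) _.
have M0 : 0 <= M by rewrite sumr_ge0.
apply: (@le_trans _ _ (A * M)); last first.
  by rewrite ler_wpM2r// (le_trans (ltW hN))// ler_nat.
apply: le_trans (ler_wpM2r M0 (hA n.+2)).
rewrite [in leRHS]big_nat_recl// mulrDl ler_wpDl ?mulr_ge0 ?cabs_ge0//.
rewrite !mulr_suml big_mkord (reindex_inj rev_ord_inj) /=; apply: ler_sum => i _.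
rewrite subKn// subSS.
have -> : r ^+ n.+1 = r ^+ i.+1 * r ^+ (n - i).
  by rewrite -exprD addSn subnKC// -ltnS.
rewrite cabsM mulrACA ler_wpM2l ?mulr_ge0 ?cabs_ge0 ?exprn_ge0//.
by apply: IH; rewrite ltnS leq_subr.
Qed.

End QSeries.

(** * The discriminant *)

Section Discriminant.
Variable R : realType.
Local Notation C := R[i].
Local Notation T := (twopii R).
Implicit Types (z w h tau : C) (m n : nat) (f g : C -> C) (a b c : nat -> C).

Definition cE2 n : C := pconst 1 n - 24 * sigc R 1 n.
Definition cE4 n : C := pconst 1 n + 240 * sigc R 3 n.
Definition cE6 n : C := pconst 1 n - 504 * sigc R 5 n.

Lemma qs_sig e : qs (@sigma_series R e) (sigc R e).
Proof. by split; [exact: tame_sigc|move=> tau ut; rewrite sigma_seriesE]. Qed.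

Lemma qs_E2 : qs (@E2 R) cE2.
Proof. exact: qsB (qs_cst 1) (qsZ 24 (qs_sig 1)). Qed.
Lemma qs_E4 : qs (@E4 R) cE4.
Proof. exact: qsD (qs_cst 1) (qsZ 240 (qs_sig 3)). Qed.
Lemma qs_E6 : qs (@E6 R) cE6.
Proof. exact: qsB (qs_cst 1) (qsZ 504 (qs_sig 5)). Qed.

Lemma sigc1 e : sigc R e 1 = 1.
Proof. by rewrite /sigc /sigma /= big_seq1 exp1n. Qed.

Let s n : C := - 24 * sigc R 1 n.
Let s' n : C := 24 * sigc R 1 n.
Let d := expcoef s.
Let e := expcoef s'.

Let ts : tame s. Proof. exact/tameZ/tame_sigc. Qed.
Let ts' : tame s'. Proof. exact/tameZ/tame_sigc. Qed.
Let td : tame d. Proof. exact: tame_expcoef. Qed.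
Let te : tame e. Proof. exact: tame_expcoef. Qed.

(** The product of all (1 - q^n)^24 and its inverse, defined by their logarithmic
    derivatives; this avoids infinite products and shows that there are no zeros. *)
Definition eta24 tau := peval d (qexp tau).
Definition eta24V tau := peval e (qexp tau).
Definition Delta tau := qexp tau * eta24 tau.

Lemma qs_eta24 : qs eta24 d. Proof. by split. Qed.
Lemma qs_eta24V : qs eta24V e. Proof. by split. Qed.

Lemma qs_Delta : qs Delta (qshift d).
Proof.
split; first exact: tame_qshift.
by move=> tau ut; rewrite peval_qshift// cabs_qexp_lt1.
Qed.

Lemma theta_eta24 tau : uhp tau ->
  peval (theta d) (qexp tau) = (E2 tau - 1) * eta24 tau.
Proof.
move=> ut; have q1 := cabs_qexp_lt1 ut.
have -> : theta d = conv s d by apply/funext => n; rewrite theta_expcoef// /s mulr0.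
rewrite pevalM// /eta24; congr (_ * _).
rewrite E2_peval// /s pevalZ//; last exact: tame_sigc.
ring.
Qed.

Lemma theta_eta24V tau : uhp tau ->
  peval (theta e) (qexp tau) = (1 - E2 tau) * eta24V tau.
Proof.
move=> ut; have q1 := cabs_qexp_lt1 ut.
have -> : theta e = conv s' e by apply/funext => n; rewrite theta_expcoef// /s' mulr0.
rewrite pevalM// /eta24V; congr (_ * _).
rewrite E2_peval// /s' pevalZ//; last exact: tame_sigc.
ring.
Qed.

Lemma eta24K tau : uhp tau -> eta24 tau * eta24V tau = 1.
Proof.
move=> ut; have q1 := cabs_qexp_lt1 ut.
have h := qsM qs_eta24 qs_eta24V.
have T0 := twopii_neq0 R.
have z0 n : theta (conv d e) n = 0.
  apply: (peval_eq0 (tame_theta (proj1 h))) => t ht.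
  have h1 := qs_cder h ht.
  have h2 := cderM (qs_cder qs_eta24 ht) (qs_cder qs_eta24V ht).
  have := cder_unique h1 h2; rewrite theta_eta24// theta_eta24V// => E.
  apply: (mulfI T0); rewrite E mulr0; ring.
rewrite /eta24 /eta24V -pevalM// -[RHS](@peval_const R 1 (qexp tau)).
congr peval; apply/funext => -[|n]; first by rewrite conv0 mulr1.
apply/eqP; have := z0 n.+1; rewrite /theta => /eqP.
by rewrite mulf_eq0 pnatr_eq0.
Qed.

Lemma Delta_neq0 tau : uhp tau -> Delta tau != 0.
Proof.
move=> ut; rewrite /Delta mulf_neq0 ?qexp_neq0//; apply/eqP => h.
by have := eta24K ut; rewrite h mul0r => /esym/eqP; rewrite oner_eq0.
Qed.

Lemma Delta_cder tau : uhp tau -> cder Delta tau (T * E2 tau * Delta tau).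
Proof.
move=> ut; apply: cder_eq (cderM (qexp_cder tau) (qs_cder qs_eta24 ut)).
rewrite theta_eta24// /Delta; ring.
Qed.

Lemma inv_cder tau : uhp tau -> cder (fun t => - t^-1) tau (tau ^- 2).
Proof.
move=> ut; apply: cder_eq (cderN (cderV (uhp_neq0 ut) (cder_id tau))).
by rewrite mulNr opprK mul1r.
Qed.

(** The discriminant is modular of weight 12 since the logarithmic derivatives
    of both sides agree, and both sides agree at the fixed point i. *)
Lemma Delta_inv tau : uhp tau -> Delta (- tau^-1) = tau ^+ 12 * Delta tau.
Proof.
have T0 := twopii_neq0 R.
pose g t := Delta (- t^-1) * (t ^+ 12 * Delta t)^-1.
have gd t : uhp t -> cder g t 0.
  move=> ut; have t0 := uhp_neq0 ut; have D0 := Delta_neq0 ut.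
  have n0 : t ^+ 12 * Delta t != 0 by rewrite mulf_neq0 ?expf_neq0.
  have h1 := cder_comp (inv_cder ut) (Delta_cder (uhp_inv ut)).
  have h2 := cderM (cderX 12 (cder_id t)) (Delta_cder ut).
  apply: cder_eq (cderM h1 (cderV (f := fun w => w ^+ 12 * Delta w) n0 h2)).
  rewrite E2_inv//= mulr1.
  move: (Delta (- t^-1)) (Delta t) D0 (E2 t) (twopii R) T0 {h1 h2 n0} => a b b0 x u u0.
  by field; rewrite b0 u0 t0.
move=> ut; have ui : uhp ('i : C) by rewrite /uhp /= ltr01.
have := cder0_cst gd ut ui; rewrite /g.
have i2 : ('i : C) * 'i = -1 by rewrite -expr2 sqr_i.
have i0 := uhp_neq0 ui.
have -> : - ('i : C)^-1 = 'i.
  by apply: (mulIf i0); rewrite mulNr mulVf// i2.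
have -> : ('i : C) ^+ 12 = 1.
  have -> : ('i : C) ^+ 12 = ('i * 'i) ^+ 6 by ring.
  by rewrite i2; ring.
have key (x y u : C) : y != 0 -> u != 0 -> x / y = u / (1 * u) -> x = y.
  by move=> y0 u0; rewrite mul1r (mulfV u0) => h; rewrite -[RHS]mul1r -h divfK.
have n0 : tau ^+ 12 * Delta tau != 0.
  by rewrite mulf_neq0 ?Delta_neq0// expf_neq0// uhp_neq0.
exact: (key _ _ _ n0 (Delta_neq0 ui)).
Qed.

End Discriminant.

(** * Scalar modular forms *)

Section ScalarForms.
Variable R : realType.
Local Notation C := R[i].
Local Notation T := (twopii R).
Implicit Types (z h tau : C) (m n : nat) (f g : C -> C) (a b c : nat -> C) (w : int).

(** Invariance under tau -> tau + 1 is contained in the existence of the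
    q-expansion. *)
Definition smod w f c :=
  qs f c /\ forall tau, uhp tau -> f (- tau^-1) = tau ^ w * f tau.

Lemma smodB w f g a b : smod w f a -> smod w g b ->
  smod w (fun t => f t - g t) (fun n => a n - b n).
Proof.
move=> [h1 h2] [h3 h4]; split; first exact: qsB.
by move=> tau ut; rewrite h2// h4// mulrBr.
Qed.

Lemma smodZ w f a z : smod w f a -> smod w (fun t => z * f t) (fun n => z * a n).
Proof.
move=> [h1 h2]; split; first exact: qsZ.
by move=> tau ut; rewrite h2// mulrCA.
Qed.

Lemma smodM w w' f g a b : smod w f a -> smod w' g b ->
  smod (w + w') (fun t => f t * g t) (conv a b).
Proof.
move=> [h1 h2] [h3 h4]; split; first exact: qsM.
by move=> tau ut; rewrite h2// h4// expfzDr ?uhp_neq0// mulrACA.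
Qed.

Lemma smod_cst z : smod 0 (fun=> z) (pconst z).
Proof. by split; [exact: qs_cst|move=> tau _; rewrite expr0z mul1r]. Qed.

Lemma Im_inv tau : complex.Im (- tau^-1) = complex.Im tau / cabs tau ^+ 2.
Proof. by rewrite sqr_cabs; case: tau => x y /=; rewrite opprK. Qed.

(** There are no nonzero forms of negative weight: y^w |f|^2 is invariant, hence
    bounded, and Cauchy's estimates for the coefficients tend to 0 as y does. *)
Lemma smod_neg w f c : w < 0 -> smod w f c -> forall n, c n = 0.
Proof.
move=> w0 [[tc fc] fS].
pose k := `|w|%N; have wk : w = - k%:Z by rewrite /k; lia.
have k0 : (0 < k)%N by rewrite /k; lia.
pose G tau := cabs (f tau) ^+ 2 / complex.Im tau ^+ k.
have GS tau : uhp tau -> G (- tau^-1) = G tau.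
  move=> ut; have t0 := uhp_neq0 ut; have ct : cabs tau != 0 by rewrite cabs_eq0.
  have y0 : complex.Im tau != 0 by rewrite gt_eqF.
  rewrite /G fS// cabsM cabs_exprz Im_inv wk -exprz_inv exprMn expr_div_n.
  rewrite -exprnP -!exprM -[(2 * k)%N]mulnC exprVn.
  have : cabs tau ^+ (k * 2) != 0 by rewrite expf_neq0.
  have : complex.Im tau ^+ k != 0 by rewrite expf_neq0.
  move: (cabs tau ^+ _) (complex.Im tau ^+ k) => u v u0 v0.
  by field; rewrite u0 v0.
have GT tau : uhp tau -> G (tau + 1) = G tau.
  move=> ut; rewrite /G fc ?qexpS -?fc//; last exact: uhpS.
  by rewrite -(rmorph1 (real_complex R)) ImDr.
pose r : R := expR (- pi); have p0 := @pi_gt0 R.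
have r01 : 0 < r < 1 by rewrite expR_gt0 expR_lt1 oppr_lt0.
have [B B0 hB] := tame_bound tc r01.
pose K := B ^+ 2 * 2 ^+ k.
have Gtop tau : 1 / 2 <= complex.Im tau -> G tau <= K.
  move=> y2; have y0 : 0 < complex.Im tau by lra.
  have ut : uhp tau by [].
  have qr : cabs (qexp tau) <= r.
    rewrite cabs_qexp /r ler_expR lerN2; nra.
  have fB : cabs (f tau) <= B.
    rewrite fc//; apply: dominated_csum; apply: dominated_le hB => n.
    rewrite cabsM cabsX ler_wpM2l ?cabs_ge0// lerXn2r ?nnegrE ?cabs_ge0//; lra.
  rewrite /G /K; apply: ler_pM; rewrite ?sqr_ge0 ?invr_ge0 ?exprn_ge0//; try lra.
    by rewrite lerXn2r ?nnegrE ?cabs_ge0.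
  rewrite -exprVn lerXn2r ?nnegrE ?invr_ge0//; try lra.
  by rewrite invf_ple ?posrE//; lra.
have Gall : forall N tau, uhp tau -> 2^-1 ^+ N.+1 <= complex.Im tau -> G tau <= K.
  elim=> [|N IH].
    by move=> tau _; rewrite expr1 => h; apply: Gtop; lra.
  move=> tau ut h.
  pose P t := uhp t -> 2^-1 ^+ N.+2 <= complex.Im t -> G t <= K.
  suff H : P tau by exact: H.
  move: tau ut {h}; apply: strip_reduction => tau.
    have e1 : complex.Im (tau + 1) = complex.Im tau.
      by rewrite -(rmorph1 (real_complex R)) ImDr.
    rewrite /P /uhp /= e1; split=> H ut h; first by rewrite -GT//; exact: H.
    by rewrite GT//; exact: H.
  move=> ut hx _ h.
  case: (leP (1 / 2) (complex.Im tau)) => [|y2]; first exact: Gtop.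
  rewrite -GS//; apply: IH; first exact: uhp_inv.
  rewrite Im_inv; have y0 : 0 < complex.Im tau by [].
  have t2 : cabs tau ^+ 2 <= 2^-1.
    rewrite sqr_cabs -[complex.Re tau ^+ 2]real_normK ?num_real//.
    have : `|complex.Re tau| ^+ 2 <= (1 / 2) ^+ 2 by rewrite lerXn2r ?nnegrE.
    nra.
  rewrite ler_pdivlMr ?exprn_gt0 ?cabs_gt0 ?uhp_neq0//.
  have h2 : 0 <= 2^-1 :> R by rewrite invr_ge0.
  by have := ler_wpM2l (exprn_ge0 N.+1 h2) t2; rewrite -exprSr => /le_trans; apply.
have fle tau : uhp tau -> cabs (f tau) ^+ 2 <= K * complex.Im tau ^+ k.
  move=> ut; have y0 : 0 < complex.Im tau by [].
  have [N hN] : exists N, 2^-1 ^+ N.+1 <= complex.Im tau.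
    have h : (fun N : nat => (2^-1 : R) ^+ N) @ \oo --> (0 : R).
      by apply: cvg_expr; rewrite ger0_norm; lra.
    have /(@cvgrPdist_lt _ R^o) /(_ _ y0) [N _ hN] := h.
    exists N; have := hN N.+1 (leqnSn N).
    by rewrite /= sub0r normrN ger0_norm ?exprn_ge0// => /ltW.
  by have := Gall N tau ut hN; rewrite /G ler_pdivrMr ?exprn_gt0.
have K0 : 0 <= K by rewrite mulr_ge0// ?sqr_ge0// exprn_ge0.
move=> n; apply/eqP; rewrite -cabs_eq0; apply/eqP.
pose x := cabs (c n) ^+ 2; pose E := expR (2 * pi) ^+ n ^+ 2 : R.
have E0 : 0 < E by rewrite !exprn_gt0// expR_gt0.
have xle (y : R) : 0 < y <= 1 -> x <= K * E * y.
  move=> /andP[y0 y1].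
  have h1 t : cabs (peval c (qexp (t +i* y))) <= Num.sqrt (K * y ^+ k).
    rewrite -fc//; have := fle (t +i* y) y0; rewrite /= => h.
    rewrite -[leLHS]ger0_norm ?cabs_ge0// -sqrtr_sqr ler_sqrt//.
    by rewrite mulr_ge0// exprn_ge0// ltW.
  have := coef_bound tc y0 h1 n.
  rewrite -(@ler_pXn2r _ 2) ?nnegrE ?sqrtr_ge0 ?mulr_ge0 ?cabs_ge0 ?exprn_ge0 ?expR_ge0//.
  rewrite sqr_sqrtr; last by rewrite mulr_ge0// exprn_ge0// ltW.
  rewrite exprMn -/x => h2.
  have h3 : y ^+ k <= y.
    by case: (k) k0 => // j _; rewrite exprS ler_piMr ?(ltW y0)// exprn_ile1 ?(ltW y0).
  have h4 : 1 <= E * (expR (- (2 * pi * y)) ^+ n) ^+ 2.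
    rewrite /E -exprMn -exprMn -expRD.
    rewrite exprn_ege1// exprn_ege1// -[leLHS]expR0 ler_expR; nra.
  have x0 : 0 <= x by exact: sqr_ge0.
  have h5 : E * (x * (expR (- (2 * pi * y)) ^+ n) ^+ 2) <= E * (K * y).
    apply: (ler_wpM2l (ltW E0)); apply: le_trans h2 _; exact: ler_wpM2l.
  have h6 : x * 1 <= x * (E * (expR (- (2 * pi * y)) ^+ n) ^+ 2) by exact: ler_wpM2l.
  lra.
have x0 : x <= 0.
  rewrite leNgt; apply/negP => xp.
  have KE : 0 <= K * E by rewrite mulr_ge0// ltW.
  pose y : R := Num.min 1 (x / (2 * (K * E + 1))).
  have y0 : 0 < y by rewrite lt_min ltr01 divr_gt0//; lra.
  have y1 : y <= 1 by rewrite ge_min lexx.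
  have y2 : y * (2 * (K * E + 1)) <= x.
    by rewrite -ler_pdivlMr ?ge_min ?lexx ?orbT//; lra.
  have := xle y; rewrite y0 y1 => /(_ isT); nra.
by apply/eqP; rewrite -sqrf_eq0 eq_le x0 sqr_ge0.
Qed.

(** The quotient by the discriminant has a q-expansion because the inverse of
    [eta24] has one and the constant term of f is 0. *)
Lemma smod_cusp w f c : smod w f c -> c 0%N = 0 ->
  exists g, exists2 b, smod (w - 12) g b &
    forall tau, uhp tau -> f tau = Delta tau * g tau.
Proof.
move=> [[tc fc] fS] c0.
have q1 := @cabs_qexp_lt1 R.
have h1 : qs (fun t => peval (fun n => c n.+1) (qexp t)) (fun n => c n.+1).
  by split=> //; exact: tame_shift.
have h2 := qsM h1 (@qs_eta24V R).
pose p t := peval (fun n => c n.+1) (qexp t).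
have fD tau : uhp tau -> f tau = Delta tau * (p tau * eta24V tau).
  move=> ut; rewrite fc// peval_recl// ?c0 ?add0r; last exact: q1.
  rewrite -/(p tau) -[LHS]mulr1 -(eta24K ut) /Delta.
  by move: (p tau) (eta24 tau) (eta24V tau) (qexp tau) => x y z q; ring.
exists (fun t => p t * eta24V t), (conv (fun n => c n.+1) (expcoef (fun n => 24 * sigc R 1 n))) => //.
split=> // tau ut; have ui := uhp_inv ut.
apply: (mulfI (Delta_neq0 ui)); rewrite -fD// fS// fD// Delta_inv//.
have t0 := uhp_neq0 ut; rewrite [LHS]mulrA.
have -> : tau ^ w = tau ^ (w - 12) * tau ^+ 12.
  by rewrite exprnP -expfzDr// subrK.
by move: (tau ^ _) (tau ^+ 12) (Delta tau) (p tau * _) => x y z u; ring.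
Qed.

End ScalarForms.

(** * Scalar modular forms of level one *)

Section ScalarRing.
Variable R : realType.
Local Notation C := R[i].
Local Notation T := (twopii R).
Implicit Types (z h tau : C) (m n : nat) (f g : C -> C) (a b c : nat -> C) (w : int).

Lemma smod_small w f c : smod w f c -> w < 12 -> c 0%N = 0 ->
  forall tau, uhp tau -> f tau = 0.
Proof.
move=> hf w12 c0 tau ut; have [g [b hg fg]] := smod_cusp hf c0.
rewrite fg//; have b0 : b = pconst 0.
  apply/funext => n; rewrite (smod_neg _ hg) ?subr_lt0//.
  by case: n.
by move: hg => [[_ ->]]// _; rewrite b0 peval_const mulr0.
Qed.

Lemma smod_eq w f g a b : smod w f a -> smod w g b -> w < 12 -> a 0%N = b 0%N ->
  forall tau, uhp tau -> f tau = g tau.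
Proof.
move=> hf hg w12 ab tau ut; apply/eqP; rewrite -subr_eq0; apply/eqP.
by apply: (smod_small (smodB hf hg)) => //; rewrite ab subrr.
Qed.

Lemma theta_inv f c tau d : qs f c -> uhp tau ->
  cder (fun t => f (- t^-1)) tau d ->
  T * peval (theta c) (qexp (- tau^-1)) * tau ^- 2 = d.
Proof.
move=> hf ut h; apply: cder_unique h.
exact: cder_comp (inv_cder ut) (qs_cder hf (uhp_inv ut)).
Qed.

Lemma qs_theta f c : qs f c -> qs (fun t => peval (theta c) (qexp t)) (theta c).
Proof. by move=> [h _]; split=> //; exact: tame_theta. Qed.

(** An Eisenstein series is determined up to a factor by its weight, and its
    normalization by comparing it with a form with known first coefficients;
    this avoids the evaluation of zeta(4) and zeta(6). *)
Lemma eis_norm k s F c u : (4 <= k < 12)%N -> ~~ odd k -> s != 0 :> C ->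
  (forall tau, uhp tau -> eis k s (- tau^-1) = tau ^+ k * eis k s tau) ->
  smod k F c -> c 0%N = 1 -> c 1%N = u ->
  forall tau, uhp tau -> F tau = 1 + u * sigma_series k.-1 tau.
Proof.
move=> /andP[k4 k12] ek s0 eS hF c0 c1.
have T0 := twopii_neq0 R.
pose D : C := (- T) ^+ k / s; pose Z : C := zetaval R k.
have D0 : D != 0 by rewrite mulf_neq0 ?invr_eq0// expf_neq0// oppr_eq0.
have hE : smod k (eis k s) (fun n => pconst Z n + D * sigc R k.-1 n).
  split; last by move=> tau ut; rewrite eS.
  apply: qsD (qs_cst Z) (qsZ D _); split=> //; exact: tame_sigc.
have hZ := smodZ Z hF.
have w12 : (k%:Z < 12)%R by rewrite ltz_nat.
have ZF : forall tau, uhp tau -> eis k s tau = Z * F tau.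
  by apply: (smod_eq hE hZ w12); rewrite /= mulr0 addr0 c0 mulr1.
have : 0 + D * sigc R k.-1 1 = Z * c 1%N := qs_inj (proj1 hE) (proj1 hZ) ZF 1.
rewrite add0r c1 sigc1 mulr1 => DZ.
have Z0 : Z != 0 by apply/eqP => Z0; move: D0; rewrite DZ Z0 mul0r eqxx.
move=> tau ut; apply: (mulfI Z0); rewrite -ZF// /eis -/Z -/D DZ sigma_seriesE//.
by rewrite mulrDr mulr1 mulrA.
Qed.

Lemma cE2_0 : cE2 R 0 = 1. Proof. by rewrite /cE2 /= mulr0 subr0. Qed.
Lemma cE2_1 : cE2 R 1 = - 24. Proof. by rewrite /cE2 sigc1 /= mulr1 sub0r. Qed.
Lemma cE4_0 : cE4 R 0 = 1. Proof. by rewrite /cE4 /= mulr0 addr0. Qed.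
Lemma cE4_1 : cE4 R 1 = 240. Proof. by rewrite /cE4 sigc1 /= mulr1 add0r. Qed.
Lemma cE6_0 : cE6 R 0 = 1. Proof. by rewrite /cE6 /= mulr0 subr0. Qed.
Lemma cE6_1 : cE6 R 1 = - 504. Proof. by rewrite /cE6 sigc1 /= mulr1 sub0r. Qed.

(** Ramanujan's identity 12 q dE_2/dq = E_2^2 - E_4: the weight 4 form
    E_2^2 - 12 q dE_2/dq is modular because the defects of both terms cancel. *)
Lemma smod_E4 : smod 4 (@E4 R) (cE4 R).
Proof.
have T0 := twopii_neq0 R.
pose D t := peval (theta (cE2 R)) (qexp t).
have DS tau : uhp tau -> D (- tau^-1) =
    tau ^+ 4 * D tau + 2 / T * tau ^+ 3 * E2 tau + 12 / T ^+ 2 * tau ^+ 2.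
  move=> ut; have t0 := uhp_neq0 ut.
  have h1 := cderD (cderM (cderX 2 (cder_id tau)) (qs_cder (qs_E2 R) ut))
    (cderZ (12 / T) (cder_id tau)).
  have h2 := cder_uhp (g := fun t => E2 (- t^-1)) ut (fun t vt => esym (E2_inv vt)) h1.
  have := theta_inv (qs_E2 R) ut h2; rewrite -/(D _) -/(D tau) /=.
  move: (D _) (D tau) (E2 tau) (twopii R) T0 {h1 h2} => x y e u u0 h.
  have -> : x = (u * x * tau ^- 2) * tau ^+ 2 / u by field; rewrite u0 t0.
  by rewrite h; field.
pose F t := E2 t * E2 t - 12 * D t.
have hF : smod 4 F (fun n => conv (cE2 R) (cE2 R) n - 12 * theta (cE2 R) n).
  split; first by apply: qsB (qsM (qs_E2 R) (qs_E2 R)) (qsZ 12 (qs_theta (qs_E2 R))).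
  move=> tau ut; rewrite /F DS// E2_inv// -exprnP.
  move: (D tau) (E2 tau) (twopii R) T0 => y e u u0; by field.
have [h1 h2] := pdiff4 R; have s0 : (6 : C) != 0 by rewrite pnatr_eq0.
have EF : forall tau, uhp tau -> F tau = E4 tau.
  apply: (@eis_norm 4 6 F _ 240 isT isT s0 _ hF).
  - by move=> tau ut; apply: eis_inv4.
  - by rewrite conv0 cE2_0 /theta mul0r mulr0 subr0 mulr1.
  - rewrite conv1 cE2_0 /theta cE2_1; ring.
split; first exact: qs_E4.
by move=> tau ut; rewrite -!EF//; [exact: (proj2 hF)|exact: uhp_inv].
Qed.

(** The weight 6 form E_2 E_4 - 3 q dE_4/dq is modular for the same reason. *)
Lemma smod_E6 : smod 6 (@E6 R) (cE6 R).
Proof.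
have T0 := twopii_neq0 R.
pose D t := peval (theta (cE4 R)) (qexp t).
have DS tau : uhp tau -> D (- tau^-1) =
    tau ^+ 6 * D tau + 4 / T * tau ^+ 5 * E4 tau.
  move=> ut; have t0 := uhp_neq0 ut.
  have h1 := cderM (cderX 4 (cder_id tau)) (qs_cder (qs_E4 R) ut).
  have h2 := cder_uhp (g := fun t => E4 (- t^-1)) ut
    (fun t vt => esym (proj2 smod_E4 t vt)) h1.
  have := theta_inv (qs_E4 R) ut h2; rewrite -/(D _) -/(D tau) /=.
  move: (D _) (D tau) (E4 tau) (twopii R) T0 {h1 h2} => x y e u u0 h.
  have -> : x = (u * x * tau ^- 2) * tau ^+ 2 / u by field; rewrite u0 t0.
  by rewrite h; field.
pose F t := E2 t * E4 t - 3 * D t.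
have hF : smod 6 F (fun n => conv (cE2 R) (cE4 R) n - 3 * theta (cE4 R) n).
  split; first by apply: qsB (qsM (qs_E2 R) (qs_E4 R)) (qsZ 3 (qs_theta (qs_E4 R))).
  move=> tau ut; rewrite /F DS// E2_inv// (proj2 smod_E4)// -!exprnP.
  move: (D tau) (E2 tau) (E4 tau) (twopii R) T0 => y e e' u u0; by field.
have [h1 h2] := pdiff6 R; have s0 : (120 : C) != 0 by rewrite pnatr_eq0.
have EF : forall tau, uhp tau -> F tau = E6 tau.
  move=> tau ut; rewrite /E6 -mulNr.
  apply: (@eis_norm 6 120 F _ (- 504) isT isT s0 _ hF) => //.
  - by move=> t vt; apply: eis_inv4.
  - by rewrite conv0 cE2_0 cE4_0 /theta mul0r mulr0 subr0 mulr1.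
  - rewrite conv1 cE2_0 cE4_0 /theta cE2_1 cE4_1; ring.
split; first exact: qs_E6.
by move=> tau ut; rewrite -!EF//; [exact: (proj2 hF)|exact: uhp_inv].
Qed.

Lemma E46_Delta tau : uhp tau -> E4 tau ^+ 3 - E6 tau ^+ 2 = 1728 * Delta tau.
Proof.
move: tau; pose F t : C := E4 t * (E4 t * E4 t) - E6 t * E6 t.
have hF := smodB (smodM smod_E4 (smodM smod_E4 smod_E4)) (smodM smod_E6 smod_E6).
set c := (fun n : nat => _) in hF.
have c0 : c 0%N = 0 by rewrite /c !conv0 cE4_0 cE6_0; ring.
have [g [b hg Fg]] := smod_cusp hF c0.
have gE : forall tau, uhp tau -> g tau = b 0%N.
  by apply: smod_eq hg (smod_cst (b 0%N)) _ _.
have b0 : b 0%N = 1728.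
  have e : c 1%N = b 0%N * 1.
    apply: (qs_inj (proj1 hF) (qsZ (b 0%N) (qs_Delta R)) _ 1) => t ut.
    by rewrite Fg// gE// mulrC.
  by rewrite -[LHS]mulr1 -e /c !conv1 !conv0 cE4_0 cE6_0 cE4_1 cE6_1; ring.
move=> tau ut; have := Fg tau ut; rewrite gE// b0 [RHS]mulrC => <-; ring.
Qed.

(** The forms that are values of polynomials in E_2, E_4, E_6; if D holds the
    polynomial does not involve E_2. *)
Definition rep (D : Prop) f :=
  exists P : Qring R, (D -> dE2 P = 0) /\ forall tau, uhp tau -> f tau = Qval P tau.

Lemma eq_rep D f g : (forall tau, uhp tau -> f tau = g tau) -> rep D f -> rep D g.
Proof. by move=> fg [P [h1 h2]]; exists P; split=> // tau ut; rewrite -fg// h2. Qed.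

Lemma repD D f g : rep D f -> rep D g -> rep D (fun t => f t + g t).
Proof.
move=> [P [h1 h2]] [Q [h3 h4]]; exists (P + Q); split.
  by move=> d; rewrite /dE2 mderivD [X in X + _]h1// [X in _ + X]h3// addr0.
by move=> tau ut; rewrite h2// h4// /Qval mevalD.
Qed.

Lemma repM D f g : rep D f -> rep D g -> rep D (fun t => f t * g t).
Proof.
move=> [P [h1 h2]] [Q [h3 h4]]; exists (P * Q); split.
  move=> d; rewrite /dE2 mderivM [X in X * _ + _]h1// [X in _ + _ * X]h3//.
  by rewrite mul0r mulr0 addr0.
by move=> tau ut; rewrite h2// h4// /Qval mevalM.
Qed.

Lemma rep_cst D z : rep D (fun=> z).
Proof.
exists (mpolyC 3 z); split=> [_|tau _]; first by rewrite /dE2 mderivC.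
by rewrite /Qval mevalC.
Qed.

Lemma repX D f n : rep D f -> rep D (fun t => f t ^+ n).
Proof.
move=> hf; elim: n => [|n IH]; first exact: rep_cst.
by apply: eq_rep (repM hf IH) => tau _; rewrite exprS.
Qed.

Lemma repZ D f z : rep D f -> rep D (fun t => z * f t).
Proof. exact/repM/rep_cst. Qed.

Definition qX (i : 'I_3) : Qring R := mpolyX _ (mnm1 i).

Lemma QvalX i tau : Qval (qX i) tau = [:: E2 tau; E4 tau; E6 tau]`_i.
Proof. by rewrite /Qval mevalXU. Qed.

Lemma dE2X i : dE2 (qX i) = (i == 0)%:R.
Proof.
rewrite /dE2 /qX mderivX mnm1E; case: eqP => [->|_]; last by rewrite scale0r.
by rewrite scale1r -mpolyX0; congr mpolyX; apply/mnmP => j; rewrite mnmBE subnn mnm0E.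
Qed.

Lemma rep_E4 D : rep D (@E4 R).
Proof. by exists (qX 1); split=> [_|tau _]; rewrite ?dE2X ?QvalX. Qed.
Lemma rep_E6 D : rep D (@E6 R).
Proof. by exists (qX (lift 0 1)); split=> [_|tau _]; rewrite ?dE2X ?QvalX. Qed.
Lemma rep_E2 : rep False (@E2 R).
Proof. by exists (qX 0); split=> [//|tau _]; rewrite QvalX. Qed.

Lemma rep_Delta D : rep D (@Delta R).
Proof.
have h := repD (repX 3 (rep_E4 D)) (repZ (-1) (repX 2 (rep_E6 D))).
apply: eq_rep (repZ 1728^-1 h) => tau ut.
have n0 : (1728 : C) != 0 by rewrite pnatr_eq0.
by rewrite mulN1r E46_Delta// mulrA mulVf// mul1r.
Qed.

Lemma smodX w f c n : smod w f c -> c 0%N = 1 ->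
  exists2 b, smod (w * n%:Z) (fun t => f t ^+ n) b & b 0%N = 1.
Proof.
move=> hf c0; elim: n => [|n [b hb b0]].
  by exists (pconst 1) => //; rewrite mulr0; exact: smod_cst.
exists (conv c b); last by rewrite conv0 c0 b0 mulr1.
have := smodM hf hb.
have -> : (fun t => f t * f t ^+ n) = (fun t => f t ^+ n.+1).
  by apply/funext => t; rewrite exprS.
by rewrite intS mulrDr mulr1.
Qed.

Lemma smod_odd w f c tau : smod w f c -> odd `|w|%N -> uhp tau -> f tau = 0.
Proof.
move=> [_ fS] ow ut; have t0 := uhp_neq0 ut; have ui := uhp_inv ut.
have := fS _ ui; rewrite invrN invrK opprK (fS _ ut) mulrA.
have -> : (- tau^-1) ^ w * tau ^ w = -1.
  rewrite -exprMz_comm ?unitfE ?oppr_eq0 ?invr_eq0//; last by rewrite /GRing.comm mulrC.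
  rewrite mulNr mulVf//; case: (w) ow => n /=.
    by move=> on; rewrite -exprnP -signr_odd on.
  by move=> on; rewrite /exprz -signr_odd /= on expr1 invrN invr1.
rewrite mulN1r => /eqP; rewrite -subr_eq0 opprK -mulr2n mulrn_eq0 /=.
by move/eqP.
Qed.

(** There is no form of weight 2: with constant term c its square would be c^2 E_4
    and its cube c^3 E_6, contradicting that E_4^3 and E_6^2 are different. *)
Lemma smod_two f c tau : smod 2 f c -> uhp tau -> f tau = 0.
Proof.
move=> hf; suff c0 : c 0%N = 0 by exact: (smod_small hf).
have h2 := smodM hf hf; have h3 := smodM hf h2.
have f2 : forall t, uhp t -> f t * f t = c 0%N ^+ 2 * E4 t.
  by apply: (smod_eq h2 (smodZ _ smod_E4)) => //; rewrite conv0 cE4_0 mulr1.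
have f3 : forall t, uhp t -> f t * (f t * f t) = c 0%N ^+ 3 * E6 t.
  apply: (smod_eq h3 (smodZ _ smod_E6)) => //.
  by rewrite !conv0 cE6_0 mulr1 !exprS expr0 mulr1.
have ui : uhp ('i : C) by rewrite /uhp /= ltr01.
have e : c 0%N ^+ 6 * (1728 * Delta ('i : C)) = 0.
  rewrite -E46_Delta//; move: (f2 _ ui) (f3 _ ui).
  move: (f _) (E4 _) (E6 _) (c 0%N) => x a b u e2 e3.
  have -> : u ^+ 6 * (a ^+ 3 - b ^+ 2) = (u ^+ 2 * a) ^+ 3 - (u ^+ 3 * b) ^+ 2 by ring.
  by rewrite -e2 -e3; ring.
have key (x y : C) : y != 0 -> x ^+ 6 * (1728 * y) = 0 -> x = 0.
  move=> y0 /eqP; rewrite !mulf_eq0 (negbTE y0) pnatr_eq0 !orbF.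
  by rewrite !orbb => /eqP.
exact: key (Delta_neq0 ui) e.
Qed.

(** Subtracting a multiple of the monomial E_4^b E_6^c of the same weight gives
    a cusp form, which is divisible by the discriminant. *)
Theorem smod_rep D w f c : smod w f c -> rep D f.
Proof.
move: {2}`|w|%N (leqnn `|w|) => n; elim/ltn_ind: n w f c => n IH w f c wn hf.
have zero : (forall tau, uhp tau -> f tau = 0) -> rep D f.
  by move=> h; apply: eq_rep (rep_cst D 0) => tau ut; rewrite h.
case: (ltP w 0) => [w0|w0].
  apply: zero => tau ut; have c0 := smod_neg w0 hf.
  by apply: (smod_small hf) => //; exact: lt_trans w0 _.
case: (boolP (odd `|w|)) => [ow|ew]; first by apply: zero => tau; exact: (smod_odd hf ow).
case: (eqVneq w 0) => [w00|wn0].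
  rewrite w00 in hf; apply: eq_rep (rep_cst D (c 0%N)) => tau ut.
  by rewrite (smod_eq hf (smod_cst (c 0%N))).
case: (eqVneq w 2) => [w2|wn2].
  by rewrite w2 in hf; apply: zero => tau; exact: (smod_two hf).
have [b [d wE]] : exists b d : nat, w = 4 * b%:Z + 6 * d%:Z.
  case: (boolP (4 %| `|w|)%N) => h4; [exists (`|w| %/ 4)%N, 0%N|exists ((`|w| - 6) %/ 4)%N, 1%N];
    lia.
have [x hx x0] := smodX b smod_E4 cE4_0; have [y hy y0] := smodX d smod_E6 cE6_0.
have hm := smodM hx hy; rewrite -wE in hm.
have hd := smodB hf (smodZ (c 0%N) hm).
have [|g [e hg fg]] := smod_cusp hd.
  by rewrite conv0 x0 y0 !mulr1 subrr.
have rg : rep D g.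
  case: (ltP w 12) => w12.
    apply: eq_rep (rep_cst D 0) => tau ut; symmetry.
    have w1 : w - 12 < 0 by rewrite subr_lt0.
    by apply: (smod_small hg (lt_trans w1 _) (smod_neg w1 hg 0%N) ut).
  apply: (IH `|w - 12|%N _ (w - 12) g e) => //; lia.
have := repD (repM (rep_Delta D) rg)
  (repZ (c 0%N) (repM (repX b (rep_E4 D)) (repX d (rep_E6 D)))).
by apply: eq_rep => tau ut; rewrite -fg// subrK.
Qed.

End ScalarRing.

(** * Transformation laws for the modular group *)

Section ModularGroup.
Variable R : realType.
Local Notation C := R[i].
Local Notation T := (twopii R).
Implicit Types (z h t tau x y : C) (m : nat) (f g : C -> C) (w a b c d n : int).

(** SL_2(Z) is generated by tau -> -1/tau and the translations: the entry c
    decreases under a translation making |d| < |c|, followed by the inversion.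
    The induction is on right multiplication. *)
Lemma SL2_gen (P : int -> int -> int -> int -> Prop) : P 1 0 0 1 ->
  (forall a b c d, P a b c d -> P b (- a) d (- c)) ->
  (forall n a b c d, P a b c d -> P a (b + n * a) c (d + n * c)) ->
  forall a b c d, a * d - b * c = 1 -> P a b c d.
Proof.
move=> P1 PS PT a b c d.
move: {2}`|c|%N (leqnn `|c|) => k.
elim/ltn_ind: k a b c d => k IH a b c d ck det.
case: (eqVneq c 0) => [c0|c0].
  subst c; rewrite mulr0 subr0 in det; have : (a = 1 /\ d = 1) \/ (a = -1 /\ d = -1).
    have : (`|a| * `|d|)%N = 1%N by rewrite -abszM det.
    by move/eqP; rewrite muln_eq1 => /andP[/eqP h1 /eqP h2]; move: det; lia.
  case=> -[-> ->].
    by have := PT b _ _ _ _ P1; rewrite !mulr1 !mulr0 add0r addr0.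
  have := PT (- b) _ _ _ _ (PS _ _ _ _ (PS _ _ _ _ P1)).
  by rewrite !oppr0 !mulr0 addr0 add0r mulrNN mulr1.
have e1 := divz_eq d c; have e2 := modz_ge0 d c0; have e3 := ltz_mod d c0.
have k1 : (`|(d %% c)%Z| < k)%N by move: ck e2 e3; set r := (d %% c)%Z; lia.
have e4 : (b + - (d %/ c)%Z * a) * - c - - a * (d %% c)%Z = 1.
  have -> : (d %% c)%Z = d - (d %/ c)%Z * c by rewrite {2}e1 addrAC subrr add0r.
  by rewrite -det; ring.
have := IH _ k1 _ _ _ _ (leqnn _) e4.
move/PS/PS/PS/(PT (d %/ c)%Z); rewrite !opprK; congr P; last by rewrite {3}e1 addrC.
by ring.
Qed.

Lemma SL2_ind (P : int -> int -> int -> int -> Prop) : P 1 0 0 1 ->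
  (forall a b c d, a * d - b * c = 1 -> P a b c d -> P b (- a) d (- c)) ->
  (forall n a b c d, a * d - b * c = 1 -> P a b c d -> P a (b + n * a) c (d + n * c)) ->
  forall a b c d, a * d - b * c = 1 -> P a b c d.
Proof.
move=> P1 PS PT a b c d det.
suff : a * d - b * c = 1 /\ P a b c d by case.
move: a b c d det; apply: SL2_gen.
- by split.
- move=> a b c d [h1 h2]; split; last exact: PS.
  by rewrite -h1; ring.
- move=> n a b c d [h1 h2]; split; last exact: PT.
  by rewrite -h1; ring.
Qed.

Definition jj c d t : C := c%:~R * t + d%:~R.
Definition mob a b c d t : C := (a%:~R * t + b%:~R) / jj c d t.

Lemma jjS c d t : t != 0 -> jj d (- c) t = t * jj c d (- t^-1).
Proof. by move=> t0; rewrite /jj rmorphN /=; field. Qed.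

Lemma jjT n c d t : jj c (d + n * c) t = jj c d (t + n%:~R).
Proof. by rewrite /jj rmorphD rmorphM /=; ring. Qed.

Lemma mobS a b c d t : t != 0 -> mob b (- a) d (- c) t = mob a b c d (- t^-1).
Proof.
move=> t0; rewrite /mob jjS// invfM mulrA; congr (_ / _).
by rewrite rmorphN /=; field.
Qed.

Lemma mobT n a b c d t : mob a (b + n * a) c (d + n * c) t = mob a b c d (t + n%:~R).
Proof.
by rewrite /mob jjT; congr (_ / _); rewrite rmorphD rmorphM /=; ring.
Qed.

Lemma uhpT n t : uhp t -> uhp (t + n%:~R).
Proof.
case: n => n ut; first exact: uhpDn.
by rewrite NegzE mulrNz; exact: uhpBn.
Qed.

Lemma qserT n f t : qser f -> uhp t -> f (t + n%:~R) = f t.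
Proof.
move=> hf; have e m z : uhp z -> f (z + m%:R) = f z.
  move=> uz; elim: m => [|m IH]; first by rewrite addr0.
  by rewrite -natr1 addrA qserS//; exact: uhpDn.
case: n => n ut; first exact: e.
rewrite NegzE mulrNz -(e n.+1) ?subrK//; exact: uhpBn.
Qed.

Lemma SL2_uhp a b c d t : a * d - b * c = 1 -> uhp t ->
  jj c d t != 0 /\ uhp (mob a b c d t).
Proof.
move=> det; move: a b c d det t.
apply: (SL2_ind (P := fun a b c d => forall t, uhp t -> jj c d t != 0 /\ uhp (mob a b c d t))).
- by move=> t ut; rewrite /mob /jj !mul1r !mul0r add0r addr0 divr1 oner_neq0.
- move=> a b c d _ IH t ut; have t0 := uhp_neq0 ut; have [h1 h2] := IH _ (uhp_inv ut).
  by rewrite jjS// mobS// mulf_neq0.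
- by move=> n a b c d _ IH t ut; rewrite jjT mobT; apply/IH/uhpT.
Qed.

Lemma expMz x y w : x != 0 -> y != 0 -> (x * y) ^ w = x ^ w * y ^ w.
Proof.
by move=> x0 y0; rewrite exprMz_comm ?unitfE//; exact: mulrC.
Qed.

Lemma smod_SL2 w f e a b c d t : smod w f e -> a * d - b * c = 1 -> uhp t ->
  f (mob a b c d t) = jj c d t ^ w * f t.
Proof.
move=> [hf fS] det; move: a b c d det t.
apply: (SL2_ind (P := fun a b c d => forall t, uhp t ->
  f (mob a b c d t) = jj c d t ^ w * f t)).
- by move=> t ut; rewrite /mob /jj !mul1r !mul0r add0r addr0 divr1 exp1rz mul1r.
- move=> a b c d det IH t ut; have t0 := uhp_neq0 ut; have ui := uhp_inv ut.
  have [h1 _] := SL2_uhp det ui.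
  by rewrite jjS// mobS// (IH _ ui) fS// expMz// mulrA [_ ^ w * t ^ w]mulrC.
- move=> n a b c d _ IH t ut; rewrite jjT mobT IH; last exact: uhpT.
  have hq : qser f by exists e.
  by rewrite (qserT n hq ut).
Qed.

(** The constant in the transformation law of E_2. *)
Definition kap : C := 12 / T.

Lemma kap_neq0 : kap != 0.
Proof. by rewrite mulf_neq0 ?invr_eq0 ?twopii_neq0// pnatr_eq0. Qed.

Lemma E2_SL2 a b c d t : a * d - b * c = 1 -> uhp t ->
  E2 (mob a b c d t) = jj c d t ^+ 2 * (E2 t + kap * (c%:~R / jj c d t)).
Proof.
move=> det; move: a b c d det t.
apply: (SL2_ind (P := fun a b c d => forall t, uhp t ->
  E2 (mob a b c d t) = jj c d t ^+ 2 * (E2 t + kap * (c%:~R / jj c d t)))).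
- move=> t ut; rewrite /mob /jj !mul1r !mul0r add0r addr0 divr1 mulr0 addr0.
  by rewrite expr1n mul1r.
- move=> a b c d det IH t ut; have t0 := uhp_neq0 ut; have ui := uhp_inv ut.
  have [h1 _] := SL2_uhp det ui.
  rewrite jjS// mobS// (IH _ ui) E2_inv// -/kap.
  have -> : d%:~R = jj c d (- t^-1) + c%:~R / t.
    by rewrite /jj; field.
  move: (jj _ _ _) h1 (E2 t) kap (c%:~R) => j j0 x k cc.
  by field; rewrite t0 j0.
- move=> n a b c d _ IH t ut; rewrite jjT mobT IH; last exact: uhpT.
  have hq : qser (@E2 R) by eexists; exact: qs_E2.
  by rewrite (qserT n hq ut).
Qed.

Lemma E4_SL2 a b c d t : a * d - b * c = 1 -> uhp t ->
  E4 (mob a b c d t) = jj c d t ^+ 4 * E4 t.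
Proof.
by move=> det ut; have := smod_SL2 (smod_E4 R) det ut; rewrite (_ : 4 = Posz 4).
Qed.

Lemma E6_SL2 a b c d t : a * d - b * c = 1 -> uhp t ->
  E6 (mob a b c d t) = jj c d t ^+ 6 * E6 t.
Proof.
by move=> det ut; have := smod_SL2 (smod_E6 R) det ut; rewrite (_ : 6 = Posz 6).
Qed.

End ModularGroup.

(** * Algebraic independence *)

Section Independence.
Variable R : realType.
Local Notation C := R[i].
Implicit Types (z x y t tau : C) (P : Qring R) (p : {poly C}).

Lemma poly_many_roots p :
  (forall rs : seq C, exists2 x, x \notin rs & p.[x] = 0) -> p = 0.
Proof.
move=> h; apply/eqP; apply: contraT => p0.
have : exists2 rs : seq C, uniq rs /\ size rs = size p & all (root p) rs.
  elim: (size p) => [|n [rs [h1 h2] h3]]; first by exists [::].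
  have [x x1 x2] := h rs; exists (x :: rs); first by rewrite /= x1 h1 h2.
  by rewrite /= h3 andbT; apply/rootP.
by move=> [rs [h1 h2] h3]; have := max_poly_roots p0 h3 h1; rewrite h2 ltnn.
Qed.

Lemma inj_avoid (u : nat -> C) (rs : seq C) : injective u -> exists n, u n \notin rs.
Proof.
move=> ui; apply: contrapT => /forallNP h.
have : size (map u (iota 0 (size rs).+1)) = (size rs).+1 by rewrite size_map size_iota.
have : (size (map u (iota 0 (size rs).+1)) <= size rs)%N.
  apply: uniq_leq_size; first by rewrite map_inj_uniq// iota_uniq.
  by move=> _ /mapP[n _ ->]; apply/negPn/negP/h.
by move=> h1 h2; rewrite h2 ltnn in h1.
Qed.

(** Along a polynomial curve P becomes a polynomial in the parameter, here one with
    infinitely many zeros. *)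
Lemma meval_curve P (q : 'I_3 -> {poly C}) :
  (forall rs : seq C, exists2 x, x \notin rs & meval (fun i => (q i).[x]) P = 0) ->
  \sum_(m <- msupp P) mcoeff m P *: \prod_i q i ^+ m i = 0.
Proof.
move=> h; apply: poly_many_roots => rs; have [x x1 x2] := h rs; exists x => //.
rewrite -x2 mevalE horner_sum; apply: eq_bigr => m _.
by rewrite hornerZ horner_prod; congr (_ * _); apply: eq_bigr => i _; rewrite horner_exp.
Qed.

Lemma meval_curve0 P (q : 'I_3 -> {poly C}) x :
  \sum_(m <- msupp P) mcoeff m P *: \prod_i q i ^+ m i = 0 ->
  meval (fun i => (q i).[x]) P = 0.
Proof.
move=> /(congr1 (fun p => p.[x])); rewrite horner0 => <-.
rewrite mevalE horner_sum; apply: eq_bigr => m _.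
by rewrite hornerZ horner_prod; congr (_ * _); apply: eq_bigr => i _; rewrite horner_exp.
Qed.

Definition vec3 (A : Type) (x y z : A) : 'I_3 -> A := fun i => nth z [:: x; y] i.

Lemma vec3_horner (a b c : {poly C}) x i :
  (vec3 a b c i).[x] = vec3 a.[x] b.[x] c.[x] i.
Proof. by case: i => -[|[|[|]]]. Qed.

Lemma meval_vec3 P (a b c : {poly C}) (fa fb fc : C -> C) :
  (forall x, a.[x] = fa x) -> (forall x, b.[x] = fb x) -> (forall x, c.[x] = fc x) ->
  (forall rs : seq C, exists2 x, x \notin rs & meval (vec3 (fa x) (fb x) (fc x)) P = 0) ->
  forall x, meval (vec3 (fa x) (fb x) (fc x)) P = 0.
Proof.
move=> ha hb hc h x; rewrite -(@meval_curve0 P (vec3 a b c) x).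
  by apply: meval_eq => i; rewrite vec3_horner ha hb hc.
apply: meval_curve => rs; have [y y1 y2] := h rs; exists y => //.
by rewrite -y2; apply: meval_eq => i; rewrite vec3_horner ha hb hc.
Qed.

Lemma natS_inj : injective (fun n => n.+1%:R : C).
Proof. by move=> a b /eqP; rewrite eqr_nat => /eqP[]. Qed.

(** Substituting x, x^N, x^(N^2) with N large separates the monomials. *)
Lemma meval_torus P :
  (forall x y z, y != 0 -> z != 0 -> meval (vec3 x y z) P = 0) -> P = 0.
Proof.
move=> h; pose N := (\sum_(m <- msupp P) mdeg m).+1.
have hN m i : m \in msupp P -> (m i < N)%N.
  move=> hm; rewrite ltnS (@leq_trans (mdeg m))//.
    by rewrite mdegE (bigD1 i)//= leq_addr.
  by rewrite (big_rem m hm)/= leq_addr.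
pose o2 : 'I_3 := lift 0 1.
pose e (m : multinom 3) := (m 0%R + N * m 1%R + N ^ 2 * m o2)%N.
have := @meval_curve P (vec3 'X 'X^N 'X^(N ^ 2)).
move=> E; have {}E : \sum_(m <- msupp P) mcoeff m P *: 'X^(e m) = 0 :> {poly C}.
  rewrite -[RHS]E.
    apply: eq_bigr => m _; congr (_ *: _).
    rewrite !big_ord_recl big_ord0 mulr1 /vec3/= -!exprM -!exprD /e addnA.
    by congr ('X^(_ + _ * m _ + _ * m _)); exact: val_inj.
  move=> rs; have [n hn] := @inj_avoid (fun n => n.+1%:R) rs natS_inj.
  exists n.+1%:R => //; rewrite -(h n.+1%:R (n.+1%:R ^+ N) (n.+1%:R ^+ (N ^ 2))) ?expf_neq0 ?pnatr_eq0//.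
  by apply: meval_eq => -[[|[|[|]]]]//= i; rewrite /vec3 /= ?hornerX ?hornerXn.
apply/mpolyP => m; rewrite mcoeff0; apply/eqP; rewrite mcoeff_eq0; apply/negP => hm.
have := congr1 (fun p : {poly C} => p`_(e m)) E; rewrite coef0 coef_sum (big_rem m hm) /=.
rewrite coefZ coefXn eqxx mulr1 big1_seq ?addr0.
  by move/eqP; rewrite mcoeff_eq0 hm.
move=> m' /= hm'; rewrite coefZ coefXn.
have m'P := mem_rem hm'.
case: eqP => [em|]; last by rewrite mulr0.
suff mm : m = m' by move: hm'; rewrite mm mem_rem_uniqF ?msupp_uniq.
have e0 := hN m 0 hm; have e0' := hN m' 0 m'P.
have e1 := hN m 1 hm; have e1' := hN m' 1 m'P.
have dig a b u v : (u < N)%N -> (v < N)%N -> (u + N * a = v + N * b)%N -> u = v /\ a = b.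
  move=> hu hv h1; have := congr1 (modn^~ N) h1.
  rewrite (addnC u) (addnC v) ![(N * _)%N]mulnC !modnMDl !modn_small// => uv; split=> //.
  by move: h1; rewrite uv => /addnI /eqP; rewrite eqn_pmul2l// => /eqP.
have [] := dig (m 1%R + N * m o2)%N (m' 1%R + N * m' o2)%N _ _ e0 e0'.
  by move: em; rewrite /e expnS expn1; move: (N) => N'; clear; lia.
move=> m0 h1; have [m1 m2] := dig _ _ _ _ e1 e1' h1.
apply/mnmP => -[[|[|[|]]]]//= i.
- by rewrite (_ : Ordinal i = 0)//; exact: val_inj.
- by rewrite (_ : Ordinal i = 1)//; exact: val_inj.
- by rewrite (_ : Ordinal i = o2)//; exact: val_inj.
Qed.

Lemma peval_near0 (c : nat -> C) : tame c ->
  exists2 d : R, 0 < d & forall z, cabs z < d -> cabs (peval c z - c 0%N) <= 1 / 2.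
Proof.
move=> hc; have z1 : cabs (0 : C) < 1 by rewrite cabs0.
have e0 : peval c 0 = c 0%N by rewrite peval_recl// mul0r addr0.
have /cderP/(_ 1 ltr01)[d d0 hd] := peval_cder hc z1.
set D := peval (dcoef c) 0 in hd; have D0 := cabs_ge0 D.
exists (Num.min d (2 * (1 + cabs D))^-1).
  by rewrite lt_min d0 invr_gt0; lra.
move=> z; rewrite lt_min => /andP[zd zD]; have := hd z zd.
rewrite add0r e0 mul1r => h.
have -> : peval c z - c 0%N = (peval c z - c 0%N - z * D) + z * D by rewrite subrK.
apply: le_trans (cabsD _ _) _; rewrite cabsM.
have zz := cabs_ge0 z; have : cabs z * (2 * (1 + cabs D)) <= 1.
  by rewrite -ler_pdivlMr ?mul1r ?(ltW zD)//; lra.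
nra.
Qed.

Lemma cabs_near1 z : cabs (z - 1) <= 1 / 2 -> 1 / 2 <= cabs z /\ cabs z <= 3 / 2.
Proof.
have c1 : cabs (1 : C) = 1 by rewrite -[1]/(1%:R) cabs_nat.
have := le_cabsB z 1; have := le_cabsB 1 (1 - z).
by rewrite subKr c1 [cabs (1 - z)]cabsC; lra.
Qed.

(** Near the cusp E_4^3/E_6^2 = 1 + 1728 Delta/E_6^2 tends to 1 without
    reaching it. *)
Lemma jinv_values (rs : seq C) : exists tau,
  [/\ uhp tau, E4 tau != 0, E6 tau != 0 & E4 tau ^+ 3 / E6 tau ^+ 2 \notin rs].
Proof.
have h0 : 0 < 1 / 2 :> R by lra.
have [e e0 he] : exists2 e : R, 0 < e & forall x, x \in rs -> x != 1 -> e <= cabs (x - 1).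
  elim: rs => [|x rs [e e0 he]]; first by exists 1.
  case: (eqVneq x 1) => [->|x1].
    by exists e => // y; rewrite inE => /orP[/eqP ->|/he//]; rewrite eqxx.
  have x10 : 0 < cabs (x - 1) by rewrite cabs_gt0 subr_eq0.
  exists (Num.min e (cabs (x - 1))); first by rewrite lt_min e0.
  move=> y; rewrite inE ge_min => /orP[/eqP ->|/he h /h ->//].
  by rewrite lexx orbT.
have [t4 f4] := qs_E4 R; have [t6 f6] := qs_E6 R; have [td fd] := qs_eta24 R.
have [d4 p4 h4] := peval_near0 t4; have [d6 p6 h6] := peval_near0 t6.
have [dd pd hd] := peval_near0 td.
(* 10368 = 1728 * (3 / 2) / (1 / 2)^2 *)
have [K KE] : exists K : R, K = 10368 by exists 10368.
have K0 : 0 < K by rewrite KE ltr0n.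
pose r := Num.min (Num.min d4 d6) (Num.min (Num.min dd 1) (e / K)) / 2.
have m0 : 0 < Num.min (Num.min d4 d6) (Num.min (Num.min dd 1) (e / K)).
  by rewrite !lt_min p4 p6 pd ltr01 divr_gt0.
have r0 : 0 < r by rewrite divr_gt0.
have : r < Num.min (Num.min d4 d6) (Num.min (Num.min dd 1) (e / K)).
  by rewrite /r ltr_pdivrMr// ltr_pMr// ltr1n.
rewrite !lt_min => /and3P[/andP[r4 r6] /andP[rd r1] re].
have [y y0 qy] : exists2 y : R, 0 < y & cabs (qexp (0 +i* y)) = r.
  by apply: qexp_onto; rewrite r0.
exists (0 +i* y); set tau : C := 0 +i* y.
have ut : uhp tau by [].
have a4 : cabs (E4 tau - 1) <= 1 / 2 by rewrite f4// -(cE4_0 R) h4// qy.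
have a6 : cabs (E6 tau - 1) <= 1 / 2 by rewrite f6// -(cE6_0 R) h6// qy.
have ad : cabs (eta24 tau - 1) <= 1 / 2 by rewrite fd// hd// qy.
have [b4 _] := cabs_near1 a4; have [b6 _] := cabs_near1 a6.
have [_ bd] := cabs_near1 ad.
have n4 : E4 tau != 0 by rewrite -cabs_gt0; exact: lt_le_trans b4.
have n6 : E6 tau != 0 by rewrite -cabs_gt0; exact: lt_le_trans b6.
split=> //; apply/negP => /he; have -> : E4 tau ^+ 3 / E6 tau ^+ 2 = 1 + 1728 * Delta tau / E6 tau ^+ 2.
  rewrite -E46_Delta//; move: (E4 tau) (E6 tau) n6 => u v v0; by field.
rewrite addrAC subrr add0r -subr_eq0 addrAC subrr add0r.
have bD : cabs (Delta tau) <= r * (3 / 2).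
  by rewrite /Delta cabsM qy; apply: ler_wpM2l bd; exact: ltW.
have rK : r * K < e by rewrite -ltr_pdivlMr.
move: (Delta tau) (Delta_neq0 ut) (E6 tau) n6 b6 bD => D D0 v v0 bv bD.
rewrite !mulf_neq0 ?invr_eq0 ?expf_neq0 ?pnatr_eq0// => /(_ isT).
rewrite !cabsM cabsV cabsX cabs_nat; apply/negP; rewrite -ltNge.
rewrite ltr_pdivrMr ?exprn_gt0 ?cabs_gt0//.
have v2 : 1 / 4 <= cabs v ^+ 2.
  by clear -bv; move: (cabs v) bv => x bv; nra.
rewrite KE in rK; move: (cabs v ^+ 2) v2 => y2 v2; move: (cabs D) bD => y1 bD.
clear -rK bD v2 e0; nra.
Qed.

(** Transforming a relation by the matrices with bottom row (c, d) makes
    j = c tau + d, and then c, free variables; so E_2 can take any value, and the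
    remaining two variables are free since E_4^3/E_6^2 is not constant. *)
Theorem Qval_inj P : (forall tau, uhp tau -> Qval P tau = 0) -> P = 0.
Proof.
move=> hP; have k0 := kap_neq0 R.
have v3 tau : Qval P tau = meval (vec3 (E2 tau) (E4 tau) (E6 tau)) P.
  by apply: meval_eq => -[[|[|[|]]]].
have A tau (m : nat) j : uhp tau ->
    meval (vec3 (j ^+ 2 * E2 tau + kap R * m.+1%:R * j) (j ^+ 4 * E4 tau) (j ^+ 6 * E6 tau)) P = 0.
  move=> ut; move: j.
  apply: (@meval_vec3 P (E2 tau *: 'X^2 + (kap R * m.+1%:R) *: 'X)
    (E4 tau *: 'X^4) (E6 tau *: 'X^6)) => [x|x|x|rs].
  - rewrite hornerD !hornerZ hornerX hornerXn.
    by move: (E2 tau) (kap R * _) => u v; rewrite mulrC.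
  - by rewrite hornerZ hornerXn mulrC.
  - by rewrite hornerZ hornerXn mulrC.
  have ji : injective (fun n : nat => jj m.+1%:Z (1 + n%:Z * m.+1%:Z) tau).
    move=> x y /addrI /eqP; rewrite eqr_int => /eqP; nia.
  have [n hn] := inj_avoid rs ji; eexists; first exact: hn.
  have det : 1 * (1 + n%:Z * m.+1%:Z) - n%:Z * m.+1%:Z = 1 by ring.
  have [j0 um] := SL2_uhp det ut.
  rewrite -(hP _ um) v3 E2_SL2// E4_SL2// E6_SL2//.
  apply: meval_eq => i; rewrite /vec3; congr (nth _ [:: _; _] i).
  by move: (jj _ _ _) j0 => x x0; field.
have B tau (c : C) j : uhp tau ->
    meval (vec3 (j ^+ 2 * E2 tau + kap R * c * j) (j ^+ 4 * E4 tau) (j ^+ 6 * E6 tau)) P = 0.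
  move=> ut; move: c.
  apply: (@meval_vec3 P ((j ^+ 2 * E2 tau)%:P + (kap R * j) *: 'X)
    (j ^+ 4 * E4 tau)%:P (j ^+ 6 * E6 tau)%:P) => [x|x|x|rs].
  - by rewrite !hornerE; ring.
  - by rewrite hornerC.
  - by rewrite hornerC.
  have [n hn] := inj_avoid rs natS_inj; exists n.+1%:R => //.
  exact: A.
have D tau x j : uhp tau -> j != 0 ->
    meval (vec3 x (j ^+ 4 * E4 tau) (j ^+ 6 * E6 tau)) P = 0.
  move=> ut j0; rewrite -(B tau ((x - j ^+ 2 * E2 tau) / (kap R * j)) j ut).
  apply: meval_eq => i; rewrite /vec3; congr (nth _ [:: _; _] i).
  by move: (E2 _) (kap R) k0 => u k k0; field; rewrite k0 j0.
have F x s t : s != 0 -> meval (vec3 x (s ^+ 2 * t) (s ^+ 3 * t)) P = 0.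
  move=> s0; move: t.
  apply: (@meval_vec3 P x%:P (s ^+ 2 *: 'X) (s ^+ 3 *: 'X)) => [u|u|u|rs].
  - by rewrite hornerC.
  - by rewrite !hornerE.
  - by rewrite !hornerE.
  have [tau [ut n4 n6 nrs]] := jinv_values rs; exists (E4 tau ^+ 3 / E6 tau ^+ 2) => //.
  have h := sqr_sqrtc (s * E4 tau / E6 tau).
  have j0 : sqrtc (s * E4 tau / E6 tau) != 0.
    by rewrite -sqrf_eq0 h !mulf_neq0 ?invr_eq0.
  rewrite -(D tau x _ ut j0); apply: meval_eq => i; rewrite /vec3.
  set q := sqrtc _ in h j0 *.
  have q4 : q ^+ 4 = (s * E4 tau / E6 tau) ^+ 2 by rewrite -h -exprM.
  have q6 : q ^+ 6 = (s * E4 tau / E6 tau) ^+ 3 by rewrite -h -exprM.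
  congr (nth _ [:: _; _] i); rewrite ?q4 ?q6; move: (E4 tau) (E6 tau) n4 n6 => u v u0 v0;
    by field.
apply: meval_torus => x y z y0 z0.
have s0 : z / y != 0 by rewrite mulf_neq0 ?invr_eq0.
rewrite -(F x (z / y) (y ^+ 3 / z ^+ 2) s0); apply: meval_eq => i; rewrite /vec3.
by congr (nth _ [:: _; _] i); field; rewrite y0 z0.
Qed.

End Independence.

(** * Scalar quasi-modular forms *)

Section Quasi.
Variable R : realType.
Local Notation C := R[i].
Implicit Types (z x y t tau : C) (f : C -> C) (Q : nat -> C -> C) (w : int) (s n : nat).

(** The transformation law alone, without conditions on the functions. *)
Definition qlaw w s f Q := forall (a b c d : int) tau, a * d - b * c = 1 -> uhp tau ->
  f (mob a b c d tau) =
  jj c d tau ^ w * \sum_(n < s.+1) (c%:~R / jj c d tau) ^+ n * Q n tau.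

Lemma coef_linX (u v : C) n k : (n <= k)%N ->
  ((u *: 'X + v%:P) ^+ n)`_k = if k == n then u ^+ n else 0.
Proof.
elim: n k => [|n IH] k; first by rewrite expr0 coef1; case: (k == 0%N).
case: k => // k nk; rewrite exprS mulrDl coefD -scalerAl coefZ coefXM coefCM /= IH//.
rewrite (IH k.+1) ?(ltnW nk)// [X in v * X]ifN ?mulr0 ?addr0; last by rewrite gtn_eqF.
by rewrite eqSS; case: eqP => _; rewrite ?mulr0// exprS.
Qed.

(** The law for gamma gamma' can be evaluated in two ways. Both are polynomials
    in the value of X for gamma, which takes infinitely many values, and their top
    coefficients give the transformation law of the last component function. *)
Lemma quasi_top w s f Q : (forall n, qser (Q n)) -> qlaw w s f Q ->
  exists e, smod (w - 2 * s%:Z) (Q s) e.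
Proof.
move=> hQ law; have [e he] := hQ s; exists e; split=> // t ut.
have t0 := uhp_neq0 ut; have ui := uhp_inv ut.
pose p := \sum_(n < s.+1) Q n (- t^-1) *: 'X^n
  - t ^ w *: \sum_(n < s.+1) Q n t *: (t ^- 2 *: 'X + (t^-1)%:P) ^+ n.
have p0 : p = 0.
  apply: poly_many_roots => rs.
  (* the matrices with rows (1, 0) and (m, 1) take distinct values of X at -1/t *)
  pose J (m : nat) : C := jj m 1 (- t^-1).
  have JE m : J m = 1 - m%:R / t by rewrite /J /jj mulrN addrC.
  have det (m : nat) : 1 * 1 - 0 * m%:Z = 1 by rewrite mul0r subr0 mulr1.
  have J0 m : J m != 0 by have [] := SL2_uhp (det m) ui.
  have ji : injective (fun m : nat => m%:R / J m).
    move=> m n /eqP; rewrite eqr_div// !JE => /eqP h; apply/eqP.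
    rewrite -(eqr_nat C); apply/eqP.
    have : m%:R * (1 - n%:R / t) - n%:R * (1 - m%:R / t) = m%:R - n%:R :> C by field.
    by rewrite h subrr => /esym/eqP; rewrite subr_eq0 => /eqP.
  have [m hm] := inj_avoid rs ji; exists (m%:R / J m) => //.
  have det' : 0 * (- m%:Z) - (- 1) * 1 = 1 by ring.
  have := law 0 (- 1) 1 (- m%:Z) t det' ut.
  rewrite (mobS 1 0 m%:Z 1 t0) (jjS m%:Z 1 t0) (law 1 0 m%:Z 1 _ (det m) ui) -/(J m).
  rewrite expMz// [t ^ w * _]mulrC -mulrA => /(mulfI (expfz_neq0 _ (J0 m))) E.
  rewrite /p hornerD hornerN hornerZ !horner_sum; apply/eqP; rewrite subr_eq0; apply/eqP.
  transitivity (\sum_(n < s.+1) (m%:~R / J m) ^+ n * Q n (- t^-1)).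
    by apply: eq_bigr => n _; rewrite hornerZ hornerXn mulrC.
  rewrite E; congr (_ * _); apply: eq_bigr => n _.
  rewrite hornerZ horner_exp mulrC; congr (_ * _ ^+ n).
  rewrite hornerD hornerZ hornerX hornerC mul1r.
  have -> : m%:R = (1 - J m) * t by rewrite JE; field.
  by move: (J m) (J0 m) => x x0; field; rewrite t0 x0.
have := congr1 (fun p : {poly C} => p`_s) p0.
rewrite coef0 /p coefB coefZ !coef_sum => /eqP; rewrite subr_eq0 => /eqP.
rewrite big_ord_recr big1 /= ?add0r; last first.
  by move=> i _; rewrite coefZ coefXn gtn_eqF ?mulr0.
rewrite coefZ coefXn eqxx mulr1 => ->.
rewrite big_ord_recr big1 /= ?add0r; last first.
  by move=> i _; rewrite coefZ coef_linX ?(ltnW (ltn_ord i))// gtn_eqF ?mulr0.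
rewrite coefZ coef_linX// eqxx expfzDr// -mulrA; congr (_ * _).
rewrite mulrC; congr (_ * _).
by rewrite -exprVn -exprM -exprz_inv -exprnP mulnC.
Qed.

(** Subtracting E_2^s times the top component lowers s, since E_2 itself has
    the constant top component kap. *)
Theorem quasi_rep w s f Q : (forall n, qser (Q n)) -> qlaw w s f Q -> rep False f.
Proof.
elim: s f Q => [|s IH] f Q hQ law; have [e he] := quasi_top hQ law.
  rewrite mulr0 subr0 in he; apply: eq_rep (smod_rep False he) => t ut.
  have := law 1 0 0 1 t erefl ut; rewrite big_ord1 expr0 mul1r.
  by rewrite /mob /jj !mul1r !mul0r add0r addr0 divr1 exp1rz mul1r.
have [k kE] : exists k, k = kap R by exists (kap R).
have k0 : k != 0 by rewrite kE kap_neq0.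
pose M t := k ^- s.+1 * (E2 t ^+ s.+1 * Q s.+1 t).
have rM : rep False M.
  exact/repZ/repM/(smod_rep False he)/repX/rep_E2.
pose Q' n t := Q n t - k ^- s.+1 * k ^+ n * 'C(s.+1, n)%:R * (E2 t ^+ (s.+1 - n) * Q s.+1 t).
have hQ' n : qser (Q' n).
  apply/qserB/qserZ/qserM; [exact: hQ| |exact: hQ].
  apply: qserX; eexists; exact: qs_E2.
have rf : rep False (fun t => f t - M t).
  apply: (IH _ Q' hQ') => a b c d t det ut.
  have [j0 um] := SL2_uhp det ut; have t0 := uhp_neq0 ut.
  rewrite (law _ _ _ _ _ det ut) /M E2_SL2// (smod_SL2 he det ut) -kE.
  move: (jj c d t) j0 => j j0; move: (c%:~R / j) => X.
  have jw : (j ^+ 2) ^+ s.+1 * j ^ (w - 2 * s.+1%:Z) = j ^ w.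
    by rewrite -exprM exprnP -expfzDr// PoszM addrC subrK.
  have -> : (j ^+ 2 * (E2 t + k * X)) ^+ s.+1 * (j ^ (w - 2 * s.+1%:Z) * Q s.+1 t) =
     j ^ w * ((E2 t + k * X) ^+ s.+1 * Q s.+1 t).
    by rewrite exprMn mulrACA jw.
  rewrite mulrCA -mulrBr; congr (_ * _); clear jw.
  transitivity (\sum_(n < s.+2) X ^+ n * Q' n t).
    rewrite exprDn mulr_suml mulr_sumr -sumrB; apply: eq_bigr => n _.
    rewrite mulrBr; congr (_ - _); rewrite exprMn -mulr_natr.
    move: (E2 t ^+ _) (X ^+ n) (k ^+ n) (k ^- _) (Q _ t) (_%:R) => e1 e2 e3 e4 e5 e6.
    by ring.
  rewrite big_ord_recr /= [X in _ + _ * X](_ : _ = 0) ?mulr0 ?addr0//.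
  rewrite /Q' subnn expr0 mul1r binn mulr1.
  by move: (k ^+ s.+1) (expf_neq0 s.+1 k0) => u u0; rewrite mulVf// mul1r subrr.
apply: eq_rep (repD rf rM) => t ut; by rewrite subrK.
Qed.

End Quasi.

(** * The grading of a quasi-vertex operator algebra *)

Section Grading.
Variables (R : realType) (V : lmodType R[i]) (A : qvoa V).
Local Notation C := R[i].
Local Notation gc := (gcomp A).
Local Notation L := (L1 A).
Implicit Types (u v : V) (n k N : int) (s : seq int) (z x y : C).

Lemma fsum_seq (I : choiceType) (F : I -> V) (s : seq I) : uniq s ->
  (forall i, i \notin s -> F i = 0) -> \sum_(i \in [set: I]) F i = \sum_(i <- s) F i.
Proof.
move=> us h; rewrite (fsbigE s)// => [|i _]; last exact: h.
by apply: eq_bigl => i; rewrite in_setT.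
Qed.

Lemma gr_lin n a u v : gr A n u -> gr A n v -> gr A n (a *: u + v).
Proof.
have [d [e ->]] := gr_findim A n; move=> [x ->] [y ->]; exists (fun i => a * x i + y i).
rewrite scaler_sumr -big_split; apply: eq_bigr => i _.
by rewrite scalerDl scalerA.
Qed.

Lemma gr0 n : gr A n 0.
Proof.
have [d [e ->]] := gr_findim A n; exists (fun=> 0).
by rewrite big1// => i _; rewrite scale0r.
Qed.

Lemma gr_scale n a u : gr A n u -> gr A n (a *: u).
Proof. by move=> h; have := gr_lin a h (gr0 n); rewrite addr0. Qed.

Lemma gr_gcomp v n : gr A n (gc v n).
Proof. by rewrite /gcomp; case: cid => c [[h _ _] _] /=. Qed.

Lemma gcomp_fin v : exists s, [/\ uniq s, forall n, n \notin s -> gc v n = 0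
  & v = \sum_(n <- s) gc v n].
Proof.
rewrite /gcomp; case: cid => c [[h fs vE] _] /=.
have /finite_seqP[s sE] := fs.
have hs n : n \notin undup s -> c n = 0.
  apply: contraNeq => nc; rewrite mem_undup.
  have : [set n | c n != 0] n by [].
  by rewrite sE.
exists (undup s); split=> //; first exact: undup_uniq.
by rewrite {1}vE; apply: fsum_seq => //; exact: undup_uniq.
Qed.

Lemma gcomp_uniq v (c : int -> V) s : uniq s -> (forall n, gr A n (c n)) ->
  (forall n, n \notin s -> c n = 0) -> v = \sum_(n <- s) c n -> forall n, gc v n = c n.
Proof.
move=> us h1 h2 h3; rewrite /gcomp; case: cid => d [_ ud] /= n.
rewrite (ud c)//; split=> //; last by rewrite h3; symmetry; exact: fsum_seq.
apply: (sub_finite_set (B := [set` s])) => // m /= cm.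
by apply: contraNT cm => ms; rewrite h2.
Qed.

Lemma gcomp_lin a u v n : gc (a *: u + v) n = a *: gc u n + gc v n.
Proof.
have [s [us s0 uE]] := gcomp_fin u; have [t [ut t0 vE]] := gcomp_fin v.
have E w r : uniq r -> (forall n, n \notin r -> gc w n = 0) -> w = \sum_(n <- r) gc w n ->
    (forall n, n \in r -> n \in undup (s ++ t)) -> w = \sum_(n <- undup (s ++ t)) gc w n.
  move=> ur r0 wE sub; rewrite {1}wE -(fsum_seq ur r0).
  apply: fsum_seq; first exact: undup_uniq.
  by move=> i; apply: contraNeq => nz; apply: sub; apply: contraNT nz => /r0 ->.
apply: (@gcomp_uniq _ (fun n => a *: gc u n + gc v n) (undup (s ++ t))).
- exact: undup_uniq.
- by move=> m; apply: gr_lin; exact: gr_gcomp.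
- by move=> m; rewrite mem_undup mem_cat negb_or => /andP[/s0 -> /t0 ->]; rewrite scaler0 addr0.
- rewrite big_split -scaler_sumr /=; congr (_ *: _ + _).
    by apply: (E u s us s0 uE) => m; rewrite mem_undup mem_cat => ->.
  by apply: (E v t ut t0 vE) => m; rewrite mem_undup mem_cat => ->; rewrite orbT.
Qed.

Lemma gcomp0 n : gc 0 n = 0.
Proof. by have := gcomp_lin (-1) 0 0 n; rewrite scaler0 addr0 scaleN1r addNr. Qed.

Lemma gcompZ a u n : gc (a *: u) n = a *: gc u n.
Proof. by have := gcomp_lin a u 0 n; rewrite !addr0 gcomp0 addr0. Qed.

Lemma gcompD u v n : gc (u + v) n = gc u n + gc v n.
Proof. by have := gcomp_lin 1 u v n; rewrite !scale1r. Qed.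

Lemma gcomp_sum (I : Type) (r : seq I) (F : I -> V) n :
  gc (\sum_(i <- r) F i) n = \sum_(i <- r) gc (F i) n.
Proof.
elim: r => [|i r IH]; first by rewrite !big_nil gcomp0.
by rewrite !big_cons gcompD IH.
Qed.

Lemma gcomp_hom k v n : gr A k v -> gc v n = if n == k then v else 0.
Proof.
move=> h; apply: (@gcomp_uniq _ (fun n => if n == k then v else 0) [:: k]) => //.
- by move=> m; case: eqP => [->//|_]; exact: gr0.
- by move=> m; rewrite inE => /negbTE ->.
- by rewrite big_seq1 eqxx.
Qed.

Lemma gcomp_inj u v : (forall n, gc u n = gc v n) -> u = v.
Proof.
move=> h; have [s [us s0 uE]] := gcomp_fin u.
have [t [ut t0 vE]] := gcomp_fin v.
rewrite uE vE -(fsum_seq us s0) -(fsum_seq ut t0).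
by apply: eq_fsbigr => n _; exact: h.
Qed.

Definition low : int := sval (cid (gr_below A)).

Lemma gr_low n v : n < low -> gr A n v -> v = 0.
Proof. by rewrite /low; case: cid => N0 /= h /h ->. Qed.

Lemma gcomp_L1 v n : gc (L v) n = L (gc v (n + 1)).
Proof.
have [s [us s0 vE]] := gcomp_fin v.
apply: (@gcomp_uniq _ (fun n => L (gc v (n + 1))) (map (fun n => n - 1) s)).
- by rewrite map_inj_uniq// => x y /addIr.
- by move=> m; have := L1_gr (gr_gcomp v (m + 1)); rewrite addrK.
- move=> m hm; rewrite s0 ?linear0//; apply: contra hm => hm.
  by apply/mapP; exists (m + 1); rewrite ?addrK.
- rewrite big_map {1}vE raddf_sum; apply: eq_bigr => m _.
  by rewrite subrK.
Qed.

Lemma filtr_lin N a u v : filtr A N u -> filtr A N v -> filtr A N (a *: u + v).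
Proof. by move=> hu hv n hn; rewrite gcomp_lin hu// hv// scaler0 addr0. Qed.

Lemma filtr0 N : filtr A N 0.
Proof. by move=> n _; rewrite gcomp0. Qed.

Lemma filtrZ N a u : filtr A N u -> filtr A N (a *: u).
Proof. by move=> h n hn; rewrite gcompZ h// scaler0. Qed.

Lemma filtrD N u v : filtr A N u -> filtr A N v -> filtr A N (u + v).
Proof. by move=> hu hv n hn; rewrite gcompD hu// hv// addr0. Qed.

Lemma filtr_sum N (I : Type) (r : seq I) (F : I -> V) :
  (forall i, filtr A N (F i)) -> filtr A N (\sum_(i <- r) F i).
Proof. by move=> h n hn; rewrite gcomp_sum big1// => i _; exact: h. Qed.

Lemma filtr_le N N' u : N <= N' -> filtr A N u -> filtr A N' u.
Proof. by move=> h hu n hn; apply: hu; exact: le_lt_trans hn. Qed.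

Lemma filtr_hom N k u : gr A k u -> k <= N -> filtr A N u.
Proof.
by move=> h kN n hn; rewrite (gcomp_hom _ h) gt_eqF// (le_lt_trans kN).
Qed.

Lemma filtr_ex v : exists N, filtr A N v.
Proof.
have [s [us s0 vE]] := gcomp_fin v; exists (\sum_(n <- s) `|n|) => n hn; apply: s0.
apply: contraL hn => ns; rewrite -leNgt (big_rem _ ns)/=.
by rewrite (le_trans (ler_norm n))// lerDl sumr_ge0.
Qed.

Lemma filtr_L1 N v : filtr A N v -> filtr A N (L v).
Proof.
move=> h n hn; rewrite gcomp_L1 h ?linear0//.
by rewrite (lt_trans hn)// ltrDl.
Qed.

Lemma gcomp_iter m v n : gc (iter m L v) n = iter m L (gc v (n + m%:Z)).
Proof.
elim: m n => [|m IH] n; first by rewrite addr0.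
rewrite iterS gcomp_L1 IH /=; congr (L (iter m L (gc v _))).
by rewrite -addrA -intS.
Qed.

Lemma iter_lin m a u v : iter m L (a *: u + v) = a *: iter m L u + iter m L v.
Proof. by elim: m => //= m ->; rewrite linearP. Qed.

Lemma iter0 m : iter m L 0 = 0.
Proof. by elim: m => //= m ->; rewrite linear0. Qed.

Lemma filtr_iter N m v : filtr A N v -> filtr A N (iter m L v).
Proof. by move=> h; elim: m => //= m; exact: filtr_L1. Qed.

(** L(1) lowers degrees, which are bounded below by [low] and above by N. *)
Definition nilb N : nat := `|N - low|.+1.

Lemma L1_nil N m v : filtr A N v -> (nilb N <= m)%N -> iter m L v = 0.
Proof.
move=> h hm; apply: gcomp_inj => n; rewrite gcomp0.
case: (ltP n low) => [nl|nl]; first exact: gr_low nl (gr_gcomp _ _).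
by rewrite gcomp_iter h ?iter0//; move: hm; rewrite /nilb; lia.
Qed.

Lemma filtr_decomp N m v : filtr A N v -> (nilb N <= m)%N ->
  v = \sum_(0 <= i < m) gc v (low + i%:Z).
Proof.
move=> h hm; have [s [us s0 {1}->]] := gcomp_fin v.
rewrite -(fsum_seq us s0) -(big_map (fun i : nat => low + i%:Z) xpredT (gc v)).
apply: fsum_seq; first by rewrite map_inj_uniq ?iota_uniq// => x y /addrI[].
move=> n hn; case: (ltP n low) => [nl|nl]; first exact: gr_low nl (gr_gcomp _ _).
apply: h; rewrite ltNge; apply: contra hn => nN.
apply/mapP; exists `|n - low|%N; last by lia.
by rewrite mem_index_iota /=; move: hm; rewrite /nilb; lia.
Qed.


(** ** The exponential of L(1) *)

Lemma expL1_trunc m z v : iter m L v = 0 ->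
  expL1 A z v = \sum_(0 <= n < m) (z ^+ n / n`!%:R) *: iter n L v.
Proof.
move=> h; apply: fsum_seq; first exact: iota_uniq.
move=> n; rewrite mem_index_iota /= -leqNgt => mn.
by rewrite -(subnK mn) iterD h iter0 scaler0.
Qed.

Lemma expL1E N z v : filtr A N v ->
  expL1 A z v = \sum_(0 <= n < nilb N) (z ^+ n / n`!%:R) *: iter n L v.
Proof. by move=> h; apply: expL1_trunc; exact: L1_nil h _. Qed.

Lemma expL1_lin z a u v : expL1 A z (a *: u + v) = a *: expL1 A z u + expL1 A z v.
Proof.
have [N hN] := filtr_ex u; have [N' hN'] := filtr_ex v.
have h1 : filtr A (Num.max N N') u by apply: filtr_le hN; rewrite le_max lexx.
have h2 : filtr A (Num.max N N') v by apply: filtr_le hN'; rewrite le_max lexx orbT.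
rewrite (expL1E z h1) (expL1E z h2) (expL1E z (filtr_lin a h1 h2)).
rewrite scaler_sumr -big_split; apply: eq_bigr => n _ /=.
by rewrite iter_lin scalerDr !scalerA mulrC.
Qed.

Lemma expL1_0 z : expL1 A z 0 = 0.
Proof. by rewrite (expL1_trunc (m := 0%N))// big_geq. Qed.

Lemma expL1Z z a u : expL1 A z (a *: u) = a *: expL1 A z u.
Proof. by have := expL1_lin z a u 0; rewrite !addr0 expL1_0 addr0. Qed.

Lemma expL1_sum z (I : Type) (r : seq I) (F : I -> V) :
  expL1 A z (\sum_(i <- r) F i) = \sum_(i <- r) expL1 A z (F i).
Proof.
elim: r => [|i r IH]; first by rewrite !big_nil expL1_0.
by rewrite !big_cons -[F i]scale1r expL1_lin IH !scale1r.
Qed.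

Lemma filtr_expL1 N z v : filtr A N v -> filtr A N (expL1 A z v).
Proof.
move=> h; rewrite (expL1E z h); apply: filtr_sum => n; exact/filtrZ/filtr_iter.
Qed.

Lemma sum_triangle (F : nat -> nat -> V) m :
  (forall i j, (m <= i + j)%N -> F i j = 0) ->
  \sum_(0 <= i < m) \sum_(0 <= j < m) F i j =
  \sum_(0 <= k < m) \sum_(0 <= i < k.+1) F i (k - i)%N.
Proof.
move=> h.
transitivity (\sum_(0 <= k < m) \sum_(0 <= i < m | (i <= k)%N) F i (k - i)%N).
  rewrite [RHS](exchange_big_dep_nat xpredT)//=; apply: eq_big_nat => i /andP[_ im].
  rewrite -(big_nat_widenl i 0 m xpredT)// [RHS](_ : _ = \sum_(0 <= j < m - i) F i j).
  rewrite (big_cat_nat (n := (m - i)%N)) ?leq_subr//= [X in _ + X]big_nat_cond.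
  rewrite [X in _ + X]big1 ?addr0// => j /andP[/andP[hj _] _].
  by apply: h; rewrite -leq_subLR.
  by rewrite -{1}(add0n i) big_addn; apply: eq_bigr => j _; rewrite addnK.
apply: eq_big_nat => k /andP[_ km].
by rewrite [RHS](big_nat_widen _ _ m)//.
Qed.

Lemma expL1D x y v : expL1 A x (expL1 A y v) = expL1 A (x + y) v.
Proof.
have [N h] := filtr_ex v; rewrite (expL1E _ (filtr_expL1 y h)).
rewrite !(expL1E _ h); set m := nilb N.
transitivity (\sum_(0 <= i < m) \sum_(0 <= j < m)
   (x ^+ i / i`!%:R * (y ^+ j / j`!%:R)) *: iter (i + j) L v).
  apply: eq_bigr => i _.
  have it r (F : nat -> V) : iter i L (\sum_(j <- r) F j) = \sum_(j <- r) iter i L (F j).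
    elim: r => [|j r IH]; first by rewrite !big_nil iter0.
    by rewrite !big_cons -[F j]scale1r iter_lin IH !scale1r.
  rewrite it scaler_sumr; apply: eq_bigr => j _.
  by rewrite -[_ *: iter j L v]addr0 iter_lin iter0 addr0 scalerA -iterD.
rewrite (sum_triangle (F := fun i j => (x ^+ i / i`!%:R * (y ^+ j / j`!%:R)) *: iter (i + j) L v)).
  apply: eq_big_nat => k _; rewrite addrC exprDn !big_mkord mulr_suml scaler_suml.
  apply: eq_bigr => i _; have ik : (i <= k)%N by rewrite -ltnS.
  rewrite subnKC//; congr (_ *: _).
  rewrite -[_ *+ 'C(k, i)]mulr_natr -(bin_fact ik) !natrM.
  have c0 : ('C(k, i)%:R : C) != 0 by rewrite pnatr_eq0 -lt0n bin_gt0.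
  have f1 : (i`!%:R : C) != 0 by rewrite pnatr_eq0 -lt0n fact_gt0.
  have f2 : ((k - i)`!%:R : C) != 0 by rewrite pnatr_eq0 -lt0n fact_gt0.
  move: ('C(k, i)%:R) (i`!%:R) ((k - i)`!%:R) (x ^+ i) (y ^+ _) c0 f1 f2 => c f g a b c0 f0 g0.
  by field; rewrite c0 f0 g0.
by move=> i j hij; rewrite (L1_nil h hij) scaler0.
Qed.

Lemma expL1_id v : expL1 A 0 v = v.
Proof.
have [N h] := filtr_ex v; rewrite (expL1E _ h) big_nat_recl// big1 ?addr0.
  by rewrite expr0 fact0 divr1 scale1r.
by move=> i _; rewrite expr0n /= mul0r scale0r.
Qed.

Lemma gcomp_pow2L0 z v n : gc (pow2L0 A z v) n = z ^ (2 * n) *: gc v n.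
Proof.
have [s [us s0 vE]] := gcomp_fin v.
apply: (@gcomp_uniq _ (fun n => z ^ (2 * n) *: gc v n) s) => //.
- by move=> m; apply: gr_scale; exact: gr_gcomp.
- by move=> m /s0 ->; rewrite scaler0.
- by apply: fsum_seq => // m /s0 ->; rewrite scaler0.
Qed.

Lemma pow2L0_lin z a u v : pow2L0 A z (a *: u + v) = a *: pow2L0 A z u + pow2L0 A z v.
Proof.
apply: gcomp_inj => n; rewrite gcomp_lin !gcomp_pow2L0 gcomp_lin scalerDr !scalerA.
by rewrite mulrC.
Qed.

Lemma pow2L0_0 z : pow2L0 A z 0 = 0.
Proof. by apply: gcomp_inj => n; rewrite gcomp_pow2L0 gcomp0 scaler0. Qed.

Lemma pow2L0Z z a u : pow2L0 A z (a *: u) = a *: pow2L0 A z u.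
Proof. by have := pow2L0_lin z a u 0; rewrite !addr0 pow2L0_0 addr0. Qed.

Lemma pow2L0_hom z k u : gr A k u -> pow2L0 A z u = z ^ (2 * k) *: u.
Proof.
move=> h; apply: gcomp_inj => n; rewrite gcomp_pow2L0 gcompZ (gcomp_hom n h).
by case: eqP => [->//|_]; rewrite !scaler0.
Qed.

Lemma pow2L0_1 v : pow2L0 A 1 v = v.
Proof. by apply: gcomp_inj => n; rewrite gcomp_pow2L0 exp1rz scale1r. Qed.

Lemma iter_pow2L0 m z v : z != 0 ->
  iter m L (pow2L0 A z v) = z ^+ (2 * m) *: pow2L0 A z (iter m L v).
Proof.
move=> z0; apply: gcomp_inj => n.
rewrite gcomp_iter gcompZ !gcomp_pow2L0 gcomp_iter scalerA.
rewrite -[_ *: gc v _]addr0 iter_lin iter0 addr0; congr (_ *: _).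
by rewrite exprnP -expfzDr// PoszM -mulrDr addrC.
Qed.

Lemma pow2L0_expL1 z x v : z != 0 ->
  pow2L0 A z (expL1 A (z ^+ 2 * x) v) = expL1 A x (pow2L0 A z v).
Proof.
move=> z0; have [N h] := filtr_ex v.
have h' : filtr A N (pow2L0 A z v).
  by move=> n hn; rewrite gcomp_pow2L0 h// scaler0.
rewrite (expL1E _ h) (expL1E _ h').
have ps r (F : nat -> V) : pow2L0 A z (\sum_(j <- r) F j) = \sum_(j <- r) pow2L0 A z (F j).
  elim: r => [|j r IH]; first by rewrite !big_nil pow2L0_0.
  by rewrite !big_cons -[F j]scale1r pow2L0_lin IH !scale1r.
rewrite ps; apply: eq_bigr => n _; rewrite pow2L0Z iter_pow2L0// scalerA.
by congr (_ *: _); rewrite exprMn -exprM [RHS]mulrC mulrA.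
Qed.

End Grading.

(** * Coordinates *)

Section Coordinates.
Variables (R : realType) (V : lmodType R[i]) (A : qvoa V).
Local Notation C := R[i].
Local Notation gc := (gcomp A).
Local Notation L := (L1 A).
Implicit Types (u v : V) (k N : int) (z x y tau : C) (f g : C -> V).

Lemma mk_scalar (F : V -> C) : (forall a u v, F (a *: u + v) = a * F u + F v) ->
  exists l : {scalar V}, forall v, l v = F v.
Proof.
move=> h; pose l : {scalar V} := HB.pack F (GRing.isLinear.Build _ _ _ _ F h).
by exists l.
Qed.

(** A spanning family of minimal size is free, so that its coefficients are linear
    functions. *)
Lemma gr_basis (n : int) : exists d (e : 'I_d -> V) (l : 'I_d -> {scalar V}),
  [/\ forall i, gr A n (e i), forall v, gc v n = \sum_i l i v *: e i
    & forall i u v, gc u n = gc v n -> l i u = l i v].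
Proof.
have [d [e]] := gr_findim A n; elim/ltn_ind: d e => d IH e grE.
case: (pselect (forall x : 'I_d -> C, \sum_i x i *: e i = 0 -> forall i, x i = 0)) => free.
  have he i : gr A n (e i).
    rewrite grE; exists (fun j => (j == i)%:R); rewrite (bigD1 i)//= eqxx scale1r.
    by rewrite big1 ?addr0// => j /negbTE ->; rewrite scale0r.
  have ex v : exists x : 'I_d -> C, gc v n = \sum_i x i *: e i.
    by have := gr_gcomp A v n; rewrite grE.
  pose co v := sval (cid (ex v)).
  have coE v : gc v n = \sum_i co v i *: e i by rewrite /co; case: cid.
  have uniq_co (x : 'I_d -> C) v : gc v n = \sum_i x i *: e i -> forall i, co v i = x i.
    move=> h i; apply/eqP; rewrite -subr_eq0; apply/eqP.
    apply: (free (fun i => co v i - x i)).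
    under eq_bigr do rewrite scalerBl.
    by rewrite sumrB -coE h subrr.
  have hl i : exists l : {scalar V}, forall v, l v = co v i.
    apply: mk_scalar => a u v; apply: (uniq_co (fun i => a * co u i + co v i)).
    rewrite gcomp_lin !coE scaler_sumr -big_split; apply: eq_bigr => j _.
    by rewrite scalerDl scalerA.
  exists d, e, (fun i => sval (cid (hl i))); split=> // [v|i u v h].
    by rewrite coE; apply: eq_bigr => i _; case: cid => l /= ->.
  by case: cid => l /= lE; rewrite !lE; apply: uniq_co; rewrite h coE.
move/existsNP: free => [x /not_implyP[xe /existsNP[i0 /eqP xi0]]].
case: d => [|d] in e grE IH x xe i0 xi0 *; first by case: (i0).
apply: (IH d (ltnSn d) (fun i => e (lift i0 i))).
rewrite grE; apply/seteqP; split=> _ [y ->].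
  exists (fun i => y (lift i0 i) - y i0 / x i0 * x (lift i0 i)).
  have -> : \sum_i y i *: e i = \sum_i (y i - y i0 / x i0 * x i) *: e i.
    under [RHS]eq_bigr do rewrite scalerBl -scalerA.
    by rewrite sumrB -scaler_sumr xe scaler0 subr0.
  by rewrite (bigD1_ord i0)//= divfK// subrr scale0r add0r.
exists (fun i => if unlift i0 i is Some j then y j else 0).
rewrite [RHS](bigD1_ord i0)//= unlift_none scale0r add0r.
by apply: eq_bigr => i _; rewrite liftK.
Qed.

(** A homogeneous basis vector of the N-th step of the filtration with its
    coordinate functional; the latter only sees the component of degree [hdeg]. *)
Record hcoord N := HCoord {
  hdeg : int ; hfun : {scalar V} ; hvec : V ;
  hvecP : gr A hdeg hvec ; hvecN : filtr A N hvec ;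
  hfunP : forall u v, gc u hdeg = gc v hdeg -> hfun u = hfun v }.

Lemma filtr_basis N : exists B : seq (hcoord N),
  forall v, filtr A N v -> v = \sum_(x <- B) hfun x v *: hvec x.
Proof.
case: (ltP N (low A)) => Nl.
  exists [::] => v h; rewrite big_nil; apply: gcomp_inj => n; rewrite gcomp0.
  case: (ltP n (low A)) => [nl|nl]; first exact: gr_low nl (gr_gcomp _ _ _).
  by apply: h; exact: lt_le_trans nl.
have step (n : int) : n <= N -> exists B : seq (hcoord N),
    forall v, gc v n = \sum_(x <- B) hfun x v *: hvec x.
  move=> nN; have [d [e [l [h1 h2 h3]]]] := gr_basis n.
  exists [seq HCoord (h1 i) (filtr_hom (h1 i) nN) (h3 i) | i <- enum 'I_d] => v.
  by rewrite big_map big_enum /= h2.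
have [B hB] : exists B : seq (hcoord N), forall v,
    \sum_(0 <= i < nilb A N) gc v (low A + i%:Z) = \sum_(x <- B) hfun x v *: hvec x.
  have : (nilb A N <= nilb A N)%N by [].
  elim: {1 3}(nilb A N) => [|m IH] hm.
    by exists [::] => v; rewrite big_geq// big_nil.
  have [B hB] := IH (ltnW hm); have [|B' hB'] := step (low A + m%:Z).
    by move: hm; rewrite /nilb; lia.
  by exists (B ++ B') => v; rewrite big_nat_recr//= hB hB' big_cat.
by exists B => v h; rewrite -hB; exact: filtr_decomp h _.
Qed.

Lemma hfun_pow2L0 N (x : hcoord N) z v :
  hfun x (pow2L0 A z v) = z ^ (2 * hdeg x) * hfun x v.
Proof.
rewrite -[RHS](linearZ_LR (hfun x)); apply: hfunP.
by rewrite gcomp_pow2L0 gcompZ.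
Qed.

(** * Vector-valued functions with a q-expansion *)

(** Holomorphy and q-expansion in the N-th step, in the form in which
    closure under sums and products is immediate. *)
Definition nice N f := (forall tau, uhp tau -> filtr A N (f tau)) /\
  exists c : nat -> V, (forall n, filtr A N (c n)) /\
    forall l : {scalar V}, qs (fun t => l (f t)) (fun n => l (c n)).

Lemma eq_nice N f g : (forall tau, uhp tau -> f tau = g tau) -> nice N f -> nice N g.
Proof.
move=> fg [h1 [c [h2 h3]]]; split; first by move=> t ut; rewrite -fg//; exact: h1.
by exists c; split=> // l; apply: eq_qs (h3 l) => t ut; rewrite fg.
Qed.

Lemma nice_le N N' f : N <= N' -> nice N f -> nice N' f.
Proof.
move=> NN [h1 [c [h2 h3]]]; split; first by move=> t ut; exact: filtr_le NN (h1 t ut).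
by exists c; split=> // n; exact: filtr_le NN (h2 n).
Qed.

Lemma niceD N f g : nice N f -> nice N g -> nice N (fun t => f t + g t).
Proof.
move=> [h1 [c [h2 h3]]] [k1 [d [k2 k3]]]; split.
  by move=> t ut; apply: filtrD; [exact: h1|exact: k1].
exists (fun n => c n + d n); split=> [n|l]; first exact: filtrD.
have := qsD (h3 l) (k3 l).
have -> : (fun t => l (f t) + l (g t)) = (fun t => l (f t + g t)).
  by apply/funext => t; rewrite linearD.
by have -> : (fun n => l (c n) + l (d n)) = (fun n => l (c n + d n))
  by apply/funext => t; rewrite linearD.
Qed.

Lemma niceZ N (F : C -> C) v : qser F -> filtr A N v -> nice N (fun t => F t *: v).
Proof.
move=> [c hc] hv; split; first by move=> t _; exact: filtrZ.
exists (fun n => c n *: v); split=> [n|l]; first exact: filtrZ.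
have := qsZ (l v) hc.
have -> : (fun t => l v * F t) = (fun t => l (F t *: v)).
  by apply/funext => t; rewrite linearZ_LR mulrC.
by have -> : (fun n => l v * c n) = (fun n => l (c n *: v))
  by apply/funext => n; rewrite linearZ_LR mulrC.
Qed.

Lemma nice0 N : nice N (fun=> 0).
Proof.
have := niceZ (qser_cst (0 : C)) (@filtr0 _ _ A N).
by apply: eq_nice => t _; rewrite scale0r.
Qed.

Lemma nice_sum N (I : Type) (r : seq I) (F : I -> C -> V) :
  (forall i, nice N (F i)) -> nice N (fun t => \sum_(i <- r) F i t).
Proof.
move=> h; elim: r => [|i r IH].
  by apply: eq_nice (nice0 N) => t _; rewrite big_nil.
by apply: eq_nice (niceD (h i) IH) => t _; rewrite big_cons.
Qed.

Lemma qs_of_series (F : C -> C) (a : nat -> C) :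
  (forall tau, uhp tau -> series (fun n => a n * qexp tau ^+ n : C^o) @ \oo --> (F tau : C^o)) ->
  qs F a.
Proof.
move=> h.
have h' tau : uhp tau -> csums (fun n => a n * qexp tau ^+ n) (F tau).
  by move=> ut; apply/ctendsP; exact: h.
split; last by move=> tau ut; rewrite /peval (csumE (h' tau ut)).
move=> r r01; have [y y0 qy] := qexp_onto r01.
have /(@cvgrPdist_lt _ R^o)/(_ 1 ltr01)[N _ hN] := h' (0 +i* y) y0.
pose t i := a i * qexp (0 +i* y) ^+ i.
exists (2 + \sum_(0 <= i < N) cabs (t i)) => n.
have -> : cabs (a n) * r ^+ n = cabs (t n) by rewrite /t cabsM cabsX qy.
case: (ltnP n N) => nN.
  rewrite (big_cat_nat (n := n))//= ?(ltnW nN)// [X in _ + (_ + X)]big_ltn//.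
  have s1 : 0 <= \sum_(0 <= i < n) cabs (t i) by rewrite sumr_ge0// => i _; exact: cabs_ge0.
  have s2 : 0 <= \sum_(n.+1 <= i < N) cabs (t i) by rewrite sumr_ge0// => i _; exact: cabs_ge0.
  by move: (cabs (t n)) s1 s2 => u; lra.
have := hN n nN; have := hN n.+1 (leqW nN); rewrite /= !sub0r !normrN !ger0_norm ?cabs_ge0//.
rewrite big_nat_recr//= -/(t n); set S := \sum_(0 <= i < n) _; set l := F _ => h1 h2.
have := cabsB (S + t n - l) (S - l).
have -> : S + t n - l - (S - l) = t n by ring.
have s3 : 0 <= \sum_(0 <= i < N) cabs (t i) by rewrite sumr_ge0// => i _; exact: cabs_ge0.
move: h1 h2 s3; move: (cabs (t n)) (cabs _) (cabs _) (\sum_(_ <= _ < _) _) => u1 u2 u3 u4.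
by lra.
Qed.

Lemma niceP N f : nice N f <-> holomorphic A N f /\ has_qexpansion A N f.
Proof.
split=> [[h1 [c [h2 h3]]]|[[h1 _] [c [h2 h3]]]]; last first.
  split=> //; exists c; split=> // l.
  by apply: (qs_of_series (F := fun t => l (f t)) (a := fun n => l (c n))) => t; exact: h3.
split; first split=> // l tau ut.
  by have [] := qs_cder (h3 l) ut.
exists c; split=> // l tau ut; have [tc fc] := h3 l.
apply/ctendsP; rewrite fc//.
exact: (asum_cvg (tame_summable tc (cabs_qexp_lt1 ut))).
Qed.

Lemma nice_qser N f (l : {scalar V}) : nice N f -> qser (fun t => l (f t)).
Proof. by move=> [_ [c [_ h]]]; exists (fun n => l (c n)); exact: h. Qed.

Lemma qser_expL1 N f (F : C -> C) (l : {scalar V}) : nice N f -> qser F ->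
  qser (fun t => l (expL1 A (F t) (f t))).
Proof.
move=> hf hF.
have h n : qser (fun t => F t ^+ n / n`!%:R * l (iter n L (f t))).
  have [l' l'E] := @mk_scalar (fun v => l (iter n L v)) (fun a u v =>
    etrans (congr1 l (iter_lin A n a u v)) (linearP l a _ _)).
  apply: qserM; last by apply: eq_qser (nice_qser l' hf) => t _; rewrite l'E.
  apply: eq_qser (qserZ (n`!%:R^-1) (qserX n hF)) => t _; exact: mulrC.
apply: eq_qser (qser_sum (index_iota 0 (nilb A N)) h) => t ut.
rewrite (expL1E (F t) (proj1 hf t ut)) linear_sum; apply: eq_bigr => n _.
exact: (esym (linearZ_LR l _ _)).
Qed.

Lemma nice_expL1 N v (F G : C -> C) : filtr A N v -> qser F -> qser G ->
  nice N (fun t => F t *: expL1 A (G t) v).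
Proof.
move=> hv hF hG.
have h n : nice N (fun t => (F t * (n`!%:R^-1 * G t ^+ n)) *: iter n L v).
  by apply: niceZ; [apply: qserM hF _; apply/qserZ/qserX|exact: filtr_iter].
apply: eq_nice (nice_sum (index_iota 0 (nilb A N)) h) => t _.
rewrite (expL1E (G t) hv) scaler_sumr; apply: eq_bigr => n _.
by rewrite scalerA [n`!%:R^-1 * _]mulrC.
Qed.

End Coordinates.

(** * Vector-valued forms *)

Section VectorForms.
Variables (R : realType) (V : lmodType R[i]) (A : qvoa V).
Local Notation C := R[i].
Local Notation gc := (gcomp A).
Local Notation L := (L1 A).
Local Notation kp := (kap R).
Implicit Types (u v e : V) (k N w : int) (tau : C) (f h : C -> V) (g : 'M[int]_2) (D : Prop).

Lemma SL2ZE (g : 'M[int]_2) : SL2Z g <-> g 0 0 * g 1 1 - g 0 1 * g 1 0 = 1.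
Proof.
have E : \det g = g 0 0 * g 1 1 - g 0 1 * g 1 0.
  rewrite (expand_det_row g 0) !big_ord_recl big_ord0 /cofactor !det_mx11 !mxE /=.
  rewrite expr0 expr1 mul1r mulN1r addr0 mulrN.
  by congr (g _ _ * g _ _ - g _ _ * g _ _); exact: val_inj.
by rewrite /SL2Z /= E.
Qed.

Lemma slashE k f (g : 'M[int]_2) tau : SL2Z g -> uhp tau ->
  slash A k f g tau = jj (g 1 0) (g 1 1) tau ^ (- k) *:
    expL1 A (Xfac g tau) (pow2L0 A (jj (g 1 0) (g 1 1) tau)
      (f (mob (g 0 0) (g 0 1) (g 1 0) (g 1 1) tau))).
Proof.
move=> /SL2ZE det ut; have [j0 _] := SL2_uhp det ut.
rewrite /slash -[jfac g tau]/(jj (g 1 0) (g 1 1) tau) -pow2L0_expL1//.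
have -> : jj (g 1 0) (g 1 1) tau ^+ 2 * Xfac g tau = (g 1 0)%:~R * jj (g 1 0) (g 1 1) tau.
  rewrite /Xfac -[jfac g tau]/(jj (g 1 0) (g 1 1) tau).
  by move: (jj _ _ _) j0 => j j0; field.
by [].
Qed.

Lemma SL2Z_ex (a b c d : int) : a * d - b * c = 1 -> exists2 g : 'M[int]_2, SL2Z g &
  [/\ g 0 0 = a, g 0 1 = b, g 1 0 = c & g 1 1 = d].
Proof.
move=> det; pose g : 'M[int]_2 := \matrix_(i, j)
  (if i == 0 then if j == 0 then a else b else if j == 0 then c else d).
by exists g; [apply/SL2ZE; rewrite !mxE|rewrite !mxE].
Qed.

Lemma slash1 k f tau : slash A k f 1%:M tau = f tau.
Proof.
rewrite /slash /jfac /moebius /jfac !mxE /= mul0r add0r mul1r addr0 divr1.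
by rewrite exp1rz scale1r mul0r expL1_id pow2L0_1.
Qed.

Lemma SL2Z1 : SL2Z (1%:M : 'M[int]_2).
Proof. exact: det1. Qed.

(** Indexing the component functions by all natural numbers lets forms with
    different numbers of components be added. *)
Definition qmf k f := exists N (s : nat) (Q : nat -> C -> V),
  [/\ forall n, nice A N (Q n), forall n, (s < n)%N -> forall tau, Q n tau = 0
    & forall g tau, SL2Z g -> uhp tau ->
        slash A k f g tau = \sum_(0 <= n < s.+1) Xfac g tau ^+ n *: Q n tau].

Lemma qmfP k f : qmf k f <-> quasi_modular_form A k f.
Proof.
split=> [[N [s [Q [h1 h2 h3]]]]|[N [s [Q [h1 h2 h3]]]]].
  have fQ tau : uhp tau -> Q 0%N tau = f tau.
    move=> ut; have := h3 _ tau SL2Z1 ut; rewrite slash1 big_nat_recl// big1.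
      by rewrite addr0 expr0 scale1r => ->.
    by move=> i _; rewrite /Xfac mxE /= mul0r expr0n /= scale0r.
  have /niceP[hf _] := eq_nice fQ (h1 0%N).
  exists N, s, (fun i => Q i); split; first exact: hf.
    by move=> n; apply/niceP; exact: h1.
  move=> g tau hg ut.
  by rewrite h3// big_mkord.
exists N, s, (fun n tau => if insub n is Some i then Q i tau else 0); split.
- move=> n; case: insubP => [i _ _|_]; first by apply/niceP; exact: h2.
  exact: nice0.
- by move=> n sn tau; rewrite insubF// ltnS leqNgt sn.
- move=> g tau hg ut; rewrite h3// big_mkord; apply: eq_bigr => i _.
  by rewrite insubT //= => hi; congr (_ *: Q _ _); exact: val_inj.
Qed.

Lemma slashD k f h (g : 'M[int]_2) tau :
  slash A k (fun t => f t + h t) g tau = slash A k f g tau + slash A k h g tau.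
Proof.
rewrite /slash; set a := f _; set b := h _; set x := _%:~R * _.
have -> : expL1 A x (a + b) = expL1 A x a + expL1 A x b.
  by rewrite -[a]scale1r expL1_lin !scale1r.
rewrite -[expL1 A x a]scale1r pow2L0_lin !scale1r scalerDr.
by [].
Qed.

Lemma qmfD k f h : qmf k f -> qmf k h -> qmf k (fun t => f t + h t).
Proof.
move=> [N [s [Q [h1 h2 h3]]]] [N' [s' [Q' [h1' h2' h3']]]].
exists (Num.max N N'), (maxn s s'), (fun n t => Q n t + Q' n t); split.
- move=> n; apply: niceD; [apply: nice_le (h1 n)|apply: nice_le (h1' n)].
    by rewrite le_max lexx.
  by rewrite le_max lexx orbT.
- by move=> n; rewrite gtn_max => /andP[n1 n2] t; rewrite h2// h2'// addr0.
- move=> g tau hg ut; rewrite slashD h3// h3'//.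
  under [RHS]eq_bigr do rewrite scalerDr.
  have widen m (F : nat -> V) : (m.+1 <= (maxn s s').+1)%N -> (forall n, (m < n)%N -> F n = 0) ->
      \sum_(0 <= n < m.+1) F n = \sum_(0 <= n < (maxn s s').+1) F n.
    move=> hm hF; rewrite [RHS](big_cat_nat (n := m.+1))//= [X in _ + X]big_nat_cond.
    by rewrite [X in _ + X]big1 ?addr0// => i /andP[/andP[hi _] _]; exact: hF.
  rewrite big_split /=; congr (_ + _); apply: widen; rewrite ?ltnS ?leq_maxl ?leq_maxr// => n hn.
    by rewrite h2// scaler0.
  by rewrite h2'// scaler0.
Qed.

Definition mf k f := exists N, nice A N f /\
  forall g tau, SL2Z g -> uhp tau -> slash A k f g tau = f tau.

Lemma mfP k f : mf k f <-> modular_form A k f.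
Proof.
split=> [[N [/niceP[h1 h2] h3]]|[N [h1 h2 h3]]]; first by exists N.
by exists N; split=> //; exact/niceP.
Qed.

Lemma mfD k f h : mf k f -> mf k h -> mf k (fun t => f t + h t).
Proof.
move=> [N [h1 h2]] [N' [h1' h2']]; exists (Num.max N N'); split.
  apply: niceD; [apply: nice_le h1|apply: nice_le h1'].
    by rewrite le_max lexx.
  by rewrite le_max lexx orbT.
by move=> g tau hg ut; rewrite slashD h2// h2'.
Qed.

Lemma slash_cst0 k (g : 'M[int]_2) tau : slash A k (fun=> 0) g tau = 0.
Proof. by rewrite /slash expL1_0 pow2L0_0 scaler0. Qed.

Lemma mf0 k : mf k (fun=> 0).
Proof. by exists 0; split=> [|g tau _ _]; [exact: nice0|exact: slash_cst0]. Qed.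

Lemma qmf0 k : qmf k (fun=> 0).
Proof.
exists 0, 0%N, (fun _ _ => 0); split=> // [n|g tau _ _]; first exact: nice0.
by rewrite slash_cst0 big1// => i _; rewrite scaler0.
Qed.

(** ** Sums of forms of different weights *)

Section SumSpaces.
Variable P : int -> set (C -> V).
Hypothesis P0 : forall k, P k (fun=> 0).
Hypothesis PD : forall k f h, P k f -> P k h -> P k (fun t => f t + h t).

Lemma sum_spaces_eq f h : eq_uhp f h -> sum_spaces P f -> sum_spaces P h.
Proof.
move=> fh [s [F [h1 h2 h3]]]; exists s, F; split=> // t ut.
by rewrite -fh// h3.
Qed.

Lemma sum_spaces1 k f : P k f -> sum_spaces P f.
Proof.
move=> h; exists [:: k], (fun=> f); split=> // [n|t _]; last by rewrite big_seq1.
by rewrite inE => /eqP ->.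
Qed.

Lemma sum_spaces0 : sum_spaces P (fun=> 0).
Proof. exact: sum_spaces1 (P0 0). Qed.

Lemma sum_spacesD f h : sum_spaces P f -> sum_spaces P h ->
  sum_spaces P (fun t => f t + h t).
Proof.
move=> [s [F [us h1 h2]]] [s' [F' [us' h1' h2']]].
pose G (r : seq int) (H : int -> C -> V) n t := if n \in r then H n t else 0.
have PG r H : (forall n, n \in r -> P n (H n)) -> forall n, P n (G r H n).
  by move=> hr n; rewrite /G; case: (boolP (n \in r)) => [/hr//|_]; exact: P0.
have sumG r H t : uniq r -> (forall n, n \in r -> n \in undup (s ++ s')) ->
    \sum_(n <- r) H n t = \sum_(n <- undup (s ++ s')) G r H n t.
  move=> ur sub; transitivity (\sum_(n <- r) G r H n t).
    by rewrite !big_seq; apply: eq_bigr => n nr; rewrite /G nr.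
  have r0 n : n \notin r -> G r H n t = 0 by rewrite /G => /negbTE ->.
  rewrite -(fsum_seq ur r0); apply: fsum_seq; first exact: undup_uniq.
  by move=> n hn; apply: r0; apply: contra hn; exact: sub.
exists (undup (s ++ s')), (fun n t => G s F n t + G s' F' n t); split.
- exact: undup_uniq.
- by move=> n _; apply: PD; exact: PG.
- move=> t ut; rewrite h2// h2'// big_split /=; congr (_ + _); apply: sumG => // n hn.
    by rewrite mem_undup mem_cat hn.
  by rewrite mem_undup mem_cat hn orbT.
Qed.

Lemma sum_spaces_sum (I : Type) (r : seq I) (F : I -> C -> V) :
  (forall i, sum_spaces P (F i)) -> sum_spaces P (fun t => \sum_(i <- r) F i t).
Proof.
move=> h; elim: r => [|i r IH].
  by apply: sum_spaces_eq sum_spaces0 => t _; rewrite big_nil.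
by apply: sum_spaces_eq (sum_spacesD (h i) IH) => t _; rewrite big_cons.
Qed.

End SumSpaces.

(** ** From forms to tensors *)

(** The term kap X in the law of E_2 cancels the factor exp (X L(1)) of the slash
    action. *)
Lemma coord_law N N' k s f (Q : nat -> C -> V) (x : hcoord A N') :
  (forall g tau, SL2Z g -> uhp tau ->
    slash A k f g tau = \sum_(0 <= n < s.+1) Xfac g tau ^+ n *: Q n tau) ->
  (forall n, nice A N (Q n)) ->
  qlaw (k - 2 * hdeg x) s (fun t => hfun x (expL1 A (kp^-1 * E2 t) (f t)))
    (fun n t => hfun x (expL1 A (kp^-1 * E2 t) (Q n t))).
Proof.
move=> law hQ a b c d t det ut; have k0 := kap_neq0 R.
have [g hg [ga gb gc' gd]] := SL2Z_ex det.
have [j0 um] := SL2_uhp det ut.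
have := law g t hg ut; rewrite slashE// ga gb gc' gd.
have -> : Xfac g t = c%:~R / jj c d t by rewrite /Xfac -/(jj _ _ _) /jfac gc' gd.
set X := c%:~R / _; set j := jj c d t in j0 X *; set m := mob a b c d t in um *.
have E2m : E2 m = j ^+ 2 * (E2 t + kp * X) by exact: E2_SL2.
clearbody m; clearbody X; clearbody j; move: (E2 t) E2m => y E2m.
have jk : j ^ k * j ^ (- k) = 1 by rewrite -expfzDr// subrr.
move/(congr1 (fun v => j ^ k *: expL1 A (kp^-1 * y) v)).
rewrite expL1Z scalerA jk scale1r expL1D.
have -> : kp^-1 * y + X = kp^-1 * (y + kp * X) by rewrite mulrDr mulKf.
rewrite -pow2L0_expL1//.
have -> : j ^+ 2 * (kp^-1 * (y + kp * X)) = kp^-1 * E2 m.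
  by rewrite E2m mulrCA.
move/(congr1 (hfun x)); rewrite hfun_pow2L0 => E.
apply: (mulfI (expfz_neq0 (2 * hdeg x) j0)); rewrite E mulrA -expfzDr//.
rewrite addrC subrK linearZ_LR; congr (_ * _).
rewrite expL1_sum linear_sum big_mkord; apply: eq_bigr => n _.
by rewrite expL1Z linearZ_LR.
Qed.

Lemma nice_E2 : qser (fun t => kp^-1 * @E2 R t).
Proof. apply: qserZ; eexists; exact: qs_E2. Qed.

(** The coefficient of L(1)^n e in exp (- E_2 L(1) / kap) applied to P (x) e. *)
Definition expterm (P : Qring R) n : Qring R :=
  ((- kp^-1) ^+ n / n`!%:R) *: (P * qX R 0 ^+ n).

Lemma Qval_expterm P n tau :
  Qval (expterm P n) tau = Qval P tau * ((- (kp^-1 * E2 tau)) ^+ n / n`!%:R).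
Proof.
rewrite /expterm /Qval mevalZ mevalM rmorphXn /= -/(Qval P tau) -/(Qval (qX R 0) tau) QvalX /=.
by rewrite -mulNr exprMn mulrAC mulrA [_ * Qval _ _]mulrC !mulrA.
Qed.

Lemma mderiv_qX0 n : dE2 (qX R 0 ^+ n.+1) = n.+1%:R *: qX R 0 ^+ n.
Proof.
have e1 : mderiv 0 (qX R 0) = 1 by have := dE2X R 0; rewrite eqxx.
elim: n => [|n IH]; first by rewrite expr1 expr0 scale1r -e1.
rewrite /dE2 exprS mderivM e1 mul1r -/(dE2 _) IH -scalerAr -exprS.
by rewrite -[X in X + _]scale1r -scalerDl -[1]/(1%:R) -natrD.
Qed.

Lemma dE2_expterm P n : dE2 P = 0 ->
  kp *: dE2 (expterm P n) = if n is m.+1 then - expterm P m else 0.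
Proof.
move=> dP; have k0 := kap_neq0 R.
have dp : mderiv 0 P = 0 by exact: dP.
rewrite /expterm /dE2 mderivZ mderivM dp mul0r add0r.
case: n => [|n].
  have -> : mderiv 0 (qX R 0 ^+ 0) = 0 by exact: (mderivC (0 : 'I_3) (1 : C)).
  by rewrite mulr0 !scaler0.
have -> : mderiv 0 (qX R 0 ^+ n.+1) = n.+1%:R *: qX R 0 ^+ n by exact: mderiv_qX0.
rewrite -scalerAr !scalerA -scaleNr; congr (_ *: _).
rewrite factS natrM exprS.
have f0 : (n`!%:R : C) != 0 by rewrite pnatr_eq0 -lt0n fact_gt0.
have n0 : (n.+1%:R : C) != 0 by rewrite pnatr_eq0.
move: kp k0 (n`!%:R) f0 (n.+1%:R) n0 => a a0 b b0 c c0.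
by move: ((- a^-1) ^+ n) => u; field; rewrite a0 b0 c0.
Qed.

(** If P does not involve E_2, the derivative of the n-th term of
    exp (- E_2 L(1) / kap) (P (x) e) cancels L(1) of the preceding term. *)
Lemma telescope (W : lmodType C) (B : Qring R -> V -> W) P e m :
  (forall v, linear (B^~ v)) -> (forall p, linear (B p)) -> dE2 P = 0 ->
  \sum_(0 <= n < m.+1) (B (kp *: dE2 (expterm P n)) (iter n L e)
     + B (expterm P n) (L (iter n L e))) = B (expterm P m) (iter m.+1 L e).
Proof.
move=> Bl Br dP; have B0 v : B 0 v = 0.
  by have := Bl v (-1) 0 0; rewrite scaler0 addr0 scaleN1r addNr.
have BN p v : B (- p) v = - B p v.
  by have := Bl v (-1) p 0; rewrite addr0 B0 addr0 !scaleN1r.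
elim: m => [|m IH]; first by rewrite big_nat1 dE2_expterm// B0 add0r.
rewrite big_nat_recr//= IH (@dE2_expterm P m.+1)// BN addrA.
by rewrite [X in X + _](_ : _ = 0) ?add0r// subrr.
Qed.

(** The tensor is obtained from the coordinates of exp (E_2 L(1) / kap) f by the
    inverse exponential. *)
Lemma tensor_of D N f : (forall tau, uhp tau -> filtr A N (f tau)) ->
  (forall x : hcoord A N, rep D (fun t => hfun x (expL1 A (kp^-1 * E2 t) (f t)))) ->
  exists t : tensor V, eq_uhp f (tensor_fun t) /\ (D -> tensor_eq (Lambda A t) [::]).
Proof.
move=> fN hrep; have [B hB] := filtr_basis A N.
pose P (x : hcoord A N) := sval (cid (hrep x)).
have PP (x : hcoord A N) : (D -> dE2 (P x) = 0) /\
    forall tau, uhp tau -> hfun x (expL1 A (kp^-1 * E2 tau) (f tau)) = Qval (P x) tau.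
  by rewrite /P; case: cid.
exists [seq (expterm (P x) n, iter n L (hvec x)) | x <- B, n <- iota 0 (nilb A N)]; split.
  move=> tau ut; rewrite /tensor_fun big_allpairs_dep /=.
  have -> : f tau = expL1 A (- (kp^-1 * E2 tau)) (expL1 A (kp^-1 * E2 tau) (f tau)).
    by rewrite expL1D addNr expL1_id.
  rewrite {1}(hB _ (filtr_expL1 _ (fN tau ut))) expL1_sum; apply: eq_bigr => x _.
  rewrite expL1Z (expL1E _ (hvecN x)) scaler_sumr /index_iota subn0.
  apply: eq_bigr => n _; rewrite (proj2 (PP x))// scalerA Qval_expterm.
  by [].
move=> d W Bi Bl Br; set t := [seq _ | _ <- _, _ <- _].
rewrite /Lambda big_cat !big_map big_nil /= -big_split /= /t {t}.
rewrite big_allpairs_dep big1//= => x _.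
have := telescope (hvec x) `|(N - low A)%R|%N Bl Br (proj1 (PP x) d).
rewrite /index_iota subn0 => ->.
rewrite (L1_nil (hvecN x))//.
by have := Br (expterm (P x) `|N - low A|%N) (-1) 0 0; rewrite scaler0 addr0 scaleN1r addNr.
Qed.

Theorem quasi_tensor k f : qmf k f -> exists t : tensor V, eq_uhp f (tensor_fun t).
Proof.
move=> [N [s [Q [h1 h2 h3]]]].
have fQ tau : uhp tau -> Q 0%N tau = f tau.
  move=> ut; have := h3 _ tau SL2Z1 ut; rewrite slash1 big_nat_recl// big1.
    by rewrite addr0 expr0 scale1r => ->.
  by move=> i _; rewrite /Xfac mxE /= mul0r expr0n /= scale0r.
have hrep (x : hcoord A N) : rep False (fun t => hfun x (expL1 A (kp^-1 * E2 t) (f t))).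
  apply: (quasi_rep _ (coord_law x h3 h1)) => n.
  exact: qser_expL1 (h1 n) nice_E2.
have fN tau : uhp tau -> filtr A N (f tau).
  by move=> ut; rewrite -fQ//; exact: (proj1 (h1 0%N)).
by have [t [h _]] := tensor_of fN hrep; exists t.
Qed.

Theorem modular_tensor k f : mf k f ->
  exists t : tensor V, eq_uhp f (tensor_fun t) /\ tensor_eq (Lambda A t) [::].
Proof.
move=> [N [h1 h2]].
have law g tau : SL2Z g -> uhp tau ->
    slash A k f g tau = \sum_(0 <= n < 1) Xfac g tau ^+ n *: f tau.
  by move=> hg ut; rewrite big_nat1 expr0 scale1r h2.
have hrep (x : hcoord A N) : rep True (fun t => hfun x (expL1 A (kp^-1 * E2 t) (f t))).
  have h := coord_law (Q := fun=> f) x law (fun=> h1).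
  have [|e he] := quasi_top _ h; first by move=> _; exact: qser_expL1 h1 nice_E2.
  exact: smod_rep he.
by have [t [ht1 ht2]] := tensor_of (proj1 h1) hrep; exists t; split=> //; exact: ht2.
Qed.

(** ** From tensors to forms *)

Definition o2 : 'I_3 := lift 0 1.

Definition mono (m : multinom 3) tau : C :=
  E2 tau ^+ m 0 * (E4 tau ^+ m 1 * E6 tau ^+ m o2).

Definition mwt (m : multinom 3) : int := (m 0)%:Z + 2 * (m 1)%:Z + 3 * (m o2)%:Z.

Lemma Qval_mono P tau : Qval P tau = \sum_(m <- msupp P) mcoeff m P * mono m tau.
Proof.
rewrite /Qval mevalE; apply: eq_bigr => m _; congr (_ * _).
rewrite !big_ord_recl big_ord0 mulr1 /mono /=.
by congr (_ ^+ (m _) * (_ ^+ (m _) * _ ^+ (m _))); exact: val_inj.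
Qed.

Lemma mono_SL2 m (a b c d : int) tau : a * d - b * c = 1 -> uhp tau ->
  mono m (mob a b c d tau) = jj c d tau ^ (2 * mwt m) *
   ((E2 tau + kp * (c%:~R / jj c d tau)) ^+ m 0 * (E4 tau ^+ m 1 * E6 tau ^+ m o2)).
Proof.
move=> det ut; have [j0 _] := SL2_uhp det ut.
rewrite /mono E2_SL2// E4_SL2// E6_SL2//.
move: (jj c d tau) j0 => j j0; move: (c%:~R / j) => X.
rewrite [(j ^+ 2 * _) ^+ _]exprMn [(j ^+ 4 * _) ^+ _]exprMn [(j ^+ 6 * _) ^+ _]exprMn.
have -> : j ^ (2 * mwt m) = j ^+ 2 ^+ m 0 * (j ^+ 4 ^+ m 1 * j ^+ 6 ^+ m o2).
  rewrite -!exprM -!exprD exprnP /mwt; congr (j ^ _); lia.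
move: (j ^+ 2 ^+ _) (j ^+ 4 ^+ _) (j ^+ 6 ^+ _) => x2 x4 x6.
move: (E4 tau ^+ _) (E6 tau ^+ _) ((E2 tau + _) ^+ _) => y4 y6 y2.
by ring.
Qed.

(** The exponential with E_2 transforms like a form of weight 2d without
    further components: the shift of E_2 cancels the exponential in the slash
    action. *)
Lemma slash_exp w (F : C -> C) (Phi : C) e (d : int) g tau : gr A d e -> SL2Z g -> uhp tau ->
  F (mob (g 0 0) (g 0 1) (g 1 0) (g 1 1) tau) = jj (g 1 0) (g 1 1) tau ^ w * Phi ->
  slash A (w + 2 * d) (fun t => F t *: expL1 A (- (kp^-1 * E2 t)) e) g tau =
  Phi *: expL1 A (- (kp^-1 * E2 tau)) e.
Proof.
move=> he hg ut FE; rewrite slashE// FE; have /SL2ZE det := hg.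
have [j0 _] := SL2_uhp det ut; have k0 := kap_neq0 R.
have E2m := E2_SL2 det ut.
rewrite -[(g 1 0)%:~R / jj (g 1 0) (g 1 1) tau]/(Xfac g tau) in E2m.
rewrite E2m; move: (Xfac g tau) (E2 tau) => X y {E2m FE}.
move: (jj _ _ _) j0 => j j0.
have -> : - (kp^-1 * (j ^+ 2 * (y + kp * X))) = j ^+ 2 * (- (kp^-1 * y) - X).
  by move: kp k0 => u u0; field.
rewrite pow2L0Z pow2L0_expL1// (pow2L0_hom _ he) !expL1Z expL1D [X + _]addrC subrK !scalerA.
congr (_ *: _).
have jk : j ^ (- (w + 2 * d)) * j ^ w * j ^ (2 * d) = 1.
  by rewrite -!expfzDr//; move: (2 * d) => dd; rewrite (_ : - (w + dd) + w + dd = 0) ?expr0z//; lia.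
by rewrite -[RHS]mul1r -jk; move: (j ^ _) (j ^ w) (j ^ (2 * d)) => x1 x2 x3; ring.
Qed.

Lemma qser_mono m : qser (mono m).
Proof.
by apply: qserM; [|apply: qserM]; apply: qserX; eexists;
  [exact: qs_E2|exact: qs_E4|exact: qs_E6].
Qed.

Lemma nice_E2N : qser (fun t => - (kp^-1 * @E2 R t)).
Proof. by apply: eq_qser (qserZ (-1) nice_E2) => t _; rewrite mulN1r. Qed.

Lemma mono_mf (z : C) (m : multinom 3) e (d : int) : gr A d e -> m 0 = 0%N ->
  mf (2 * (mwt m + d)) (fun t => (z * mono m t) *: expL1 A (- (kp^-1 * E2 t)) e).
Proof.
move=> he m0; exists d; split.
  apply: nice_expL1; [exact: (filtr_hom he)|apply: qserZ; exact: qser_mono|exact: nice_E2N].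
move=> g tau hg ut; rewrite mulrDr; apply: slash_exp => //.
have /SL2ZE det := hg.
by rewrite mono_SL2// m0 expr0 mulrCA /mono m0 expr0.
Qed.

Lemma mono_qmf (z : C) (m : multinom 3) e (d : int) : gr A d e ->
  qmf (2 * (mwt m + d)) (fun t => (z * mono m t) *: expL1 A (- (kp^-1 * E2 t)) e).
Proof.
move=> he; pose c n t := z * (kp ^+ n * 'C(m 0, n)%:R) *
   (E2 t ^+ (m 0 - n) * (E4 t ^+ m 1 * E6 t ^+ m o2)).
exists d, (m 0), (fun n t => c n t *: expL1 A (- (kp^-1 * E2 t)) e); split.
- move=> n; apply: nice_expL1; [exact: (filtr_hom he)| |exact: nice_E2N].
  apply: qserZ; apply: qserM; [|apply: qserM]; apply: qserX; eexists;
  [exact: qs_E2|exact: qs_E4|exact: qs_E6].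
- by move=> n hn t; rewrite /c bin_small// !mulr0 mul0r scale0r.
move=> g tau hg ut; rewrite mulrDr.
have /SL2ZE det := hg.
rewrite (slash_exp (Phi := z * ((E2 tau + kp * Xfac g tau) ^+ m 0 * (E4 tau ^+ m 1 * E6 tau ^+ m o2))) he hg ut); last first.
  by rewrite mono_SL2// mulrCA.
under eq_bigr do rewrite scalerA.
rewrite -scaler_suml; congr (_ *: _).
rewrite exprDn -(big_mkord xpredT (fun i => (E2 tau ^+ (m 0 - i) * (kp * Xfac g tau) ^+ i) *+ 'C(m 0, i))).
rewrite mulr_suml mulr_sumr; apply: eq_bigr => i _.
rewrite /c exprMn -mulr_natr.
move: (E2 tau ^+ _) (kp ^+ i) (Xfac g tau ^+ i) (E4 tau ^+ _) (E6 tau ^+ _) ('C(m 0, i)%:R) => x1 x2 x3 x4 x5 x6.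
by ring.
Qed.

Lemma filtr_all (t : tensor V) : exists N, forall y, y \in t -> filtr A N y.2.
Proof.
elim: t => [|y t [N hN]]; first by exists 0.
have [N' hN'] := filtr_ex A y.2; exists (Num.max N N') => z; rewrite inE => /orP[/eqP ->|zt].
  by apply: filtr_le hN'; rewrite le_max lexx orbT.
by apply: filtr_le (hN z zt); rewrite le_max lexx.
Qed.

(** The coordinate along x of exp (E_2 L(1) / kap) (q (x) v), truncated at order M
    so as to be bilinear in q and v. *)
Definition coordpoly M N (x : hcoord A N) (q : Qring R) v : Qring R :=
  \sum_(0 <= n < M) ((kp^-1) ^+ n / n`!%:R * hfun x (iter n L v)) *: (qX R 0 ^+ n * q).

Lemma coordpoly_lin M N (x : hcoord A N) :
  (forall v, linear ((coordpoly M x)^~ v)) /\ (forall q, linear (coordpoly M x q)).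
Proof.
split=> [v a p q|q a u v]; rewrite /coordpoly scaler_sumr -big_split; apply: eq_bigr => n _ /=.
  by rewrite mulrDr -scalerAr scalerDr !scalerA mulrC.
rewrite iter_lin linearP /= mulrDr scalerDl scalerA; congr (_ *: _ + _).
by rewrite mulrCA.
Qed.

(** The exponential conjugates the lowering operator to kap d/dE_2. *)
Lemma dE2_coordpoly N (x : hcoord A N) q v : filtr A N v ->
  kp *: dE2 (coordpoly (nilb A N) x q v) =
  coordpoly (nilb A N) x (kp *: dE2 q) v + coordpoly (nilb A N) x q (L v).
Proof.
move=> hv; have k0 := kap_neq0 R; rewrite /nilb; set M := `|N - low A|%N.
have dX n : dE2 (qX R 0 ^+ n * q) = n%:R *: (qX R 0 ^+ n.-1 * q) + qX R 0 ^+ n * dE2 q.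
  rewrite /dE2 mderivM; congr (_ + _); case: n => [|n].
    have -> : mderiv 0 (qX R 0 ^+ 0) = 0 by exact: (mderivC (0 : 'I_3) (1 : C)).
    by rewrite mul0r scale0r.
  by rewrite -/(dE2 _) mderiv_qX0 scalerAl.
have -> : dE2 (coordpoly M.+1 x q v) = \sum_(0 <= n < M.+1)
    ((kp^-1) ^+ n / n`!%:R * hfun x (iter n L v)) *: dE2 (qX R 0 ^+ n * q).
  rewrite /coordpoly /dE2 raddf_sum; apply: eq_bigr => n _.
  exact: mderivZ.
rewrite scaler_sumr.
under eq_bigr do rewrite dX !scalerDr.
rewrite big_split /= addrC; congr (_ + _).
  apply: eq_bigr => n _; rewrite -scalerAr !scalerA; congr (_ *: _).
  exact: mulrC.
rewrite big_nat_recl//= !scale0r !scaler0 add0r /coordpoly big_nat_recr//=.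
rewrite [X in _ = _ + X](_ : _ = 0); last first.
  rewrite -iterSr (L1_nil hv)//.
  by rewrite linear0 mulr0 scale0r.
rewrite addr0; apply: eq_bigr => n _; rewrite !scalerA -iterSr /=; congr (_ *: _).
rewrite factS natrM exprS.
have f0 : (n`!%:R : C) != 0 by rewrite pnatr_eq0 -lt0n fact_gt0.
have n0 : (n.+1%:R : C) != 0 by rewrite pnatr_eq0.
move: kp k0 (n`!%:R) f0 (n.+1%:R) n0 (hfun x _) => a a0 b b0 c c0 h.
by move: ((a^-1) ^+ n) => u; field; rewrite a0 b0 c0.
Qed.

Lemma Qval_sum (I : Type) (r : seq I) (F : I -> Qring R) tau :
  Qval (\sum_(i <- r) F i) tau = \sum_(i <- r) Qval (F i) tau.
Proof. by rewrite /Qval raddf_sum. Qed.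

Lemma Qval_coordpoly N (x : hcoord A N) q v tau : filtr A N v ->
  Qval (coordpoly (nilb A N) x q v) tau = Qval q tau * hfun x (expL1 A (kp^-1 * E2 tau) v).
Proof.
move=> hv; rewrite /coordpoly Qval_sum (expL1E _ hv) linear_sum mulr_sumr.
apply: eq_bigr => n _.
have -> : hfun x (((kp^-1 * E2 tau) ^+ n / n`!%:R) *: iter n L v) =
    (kp^-1 * E2 tau) ^+ n / n`!%:R * hfun x (iter n L v) by exact: linearZ_LR.
rewrite /Qval mevalZ mevalM rmorphXn /= -/(Qval q tau) -/(Qval (qX R 0) tau) QvalX /=.
rewrite exprMn; move: (kp^-1 ^+ n) (E2 tau ^+ n) (n`!%:R)^-1 (hfun x _) (Qval q tau) => a b c d e.
by ring.
Qed.

Lemma tensor_filtr N (t : tensor V) tau : (forall y, y \in t -> filtr A N y.2) ->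
  filtr A N (tensor_fun t tau).
Proof.
move=> hN n hn; rewrite /tensor_fun gcomp_sum big_seq big1//= => y yt.
by rewrite gcompZ (hN y yt)// scaler0.
Qed.

Lemma tensor_expand (t : tensor V) : exists N (B : seq (hcoord A N)) (S : hcoord A N -> Qring R),
  eq_uhp (fun tau => \sum_(x <- B) \sum_(m <- msupp (S x))
      (mcoeff m (S x) * mono m tau) *: expL1 A (- (kp^-1 * E2 tau)) (hvec x)) (tensor_fun t) /\
  (tensor_eq (Lambda A t) [::] -> forall x, dE2 (S x) = 0).
Proof.
have [N hN] := filtr_all t; have [B hB] := filtr_basis A N; have k0 := kap_neq0 R.
exists N, B, (fun x => \sum_(y <- t) coordpoly (nilb A N) x y.1 y.2); split.
  move=> tau ut; have fN := tensor_filtr tau hN.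
  have -> : tensor_fun t tau =
      expL1 A (- (kp^-1 * E2 tau)) (expL1 A (kp^-1 * E2 tau) (tensor_fun t tau)).
    by rewrite expL1D addNr expL1_id.
  rewrite (hB _ (filtr_expL1 _ fN)) expL1_sum; apply: eq_bigr => x _.
  rewrite expL1Z -scaler_suml; congr (_ *: _).
  rewrite -Qval_mono Qval_sum /tensor_fun expL1_sum linear_sum.
  rewrite !big_seq; apply: eq_bigr => y yt.
  by rewrite (Qval_coordpoly _ _ _ (hN y yt)) expL1Z [RHS]linearZ_LR.
move=> h x; have [l1 l2] := coordpoly_lin (nilb A N) x.
have := h _ (coordpoly (nilb A N) x) l1 l2.
rewrite /Lambda big_cat !big_map big_nil /= -big_split /= => h0.
have : kp *: dE2 (\sum_(y <- t) coordpoly (nilb A N) x y.1 y.2) = 0.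
  have -> : dE2 (\sum_(y <- t) coordpoly (nilb A N) x y.1 y.2) =
      \sum_(y <- t) dE2 (coordpoly (nilb A N) x y.1 y.2) by rewrite /dE2 raddf_sum.
  rewrite -[RHS]h0 scaler_sumr !big_seq; apply: eq_bigr => y yt.
  exact: dE2_coordpoly (hN y yt).
by move/eqP; rewrite scaler_eq0 (negbTE k0) /= => /eqP.
Qed.

Lemma QV_tensor f : QV A f -> exists t : tensor V, eq_uhp f (tensor_fun t).
Proof.
move=> [s [h [_ h1 h2]]].
suff [t ht] : exists t : tensor V, eq_uhp (fun tau => \sum_(k <- s) h k tau) (tensor_fun t).
  by exists t => tau ut; rewrite h2// ht.
have {}h1 k : k \in s -> qmf (2 * k) (h k) by move=> /h1 ?; exact/qmfP.
elim: s h1 {h2} => [|k s IH] h1.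
  by exists [::] => tau _; rewrite /tensor_fun !big_nil.
have [t ht] := IH (fun n hn => h1 n (mem_behead (s := k :: s) hn)).
have [t' ht'] := quasi_tensor (h1 k (mem_head _ _)).
exists (t' ++ t) => tau ut.
by rewrite big_cons /tensor_fun big_cat /= ht'// ht.
Qed.

Lemma MV_tensor f : MV A f ->
  exists t : tensor V, eq_uhp f (tensor_fun t) /\ tensor_eq (Lambda A t) [::].
Proof.
move=> [s [h [_ h1 h2]]].
suff [t [ht1 ht2]] : exists t : tensor V, eq_uhp (fun tau => \sum_(k <- s) h k tau) (tensor_fun t)
    /\ tensor_eq (Lambda A t) [::].
  by exists t; split=> // tau ut; rewrite h2// ht1.
have {}h1 k : k \in s -> mf k (h k) by move=> /h1 ?; exact/mfP.
elim: s h1 {h2} => [|k s IH] h1.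
  by exists [::]; split=> // tau _; rewrite /tensor_fun !big_nil.
have [t [ht1 ht2]] := IH (fun n hn => h1 n (mem_behead (s := k :: s) hn)).
have [t' [ht1' ht2']] := modular_tensor (h1 k (mem_head _ _)).
exists (t' ++ t); split.
  by move=> tau ut; rewrite big_cons /tensor_fun big_cat /= ht1'// ht1.
move=> W B Bl Br; have := ht2' W B Bl Br; have := ht2 W B Bl Br.
rewrite /Lambda !map_cat !big_cat !big_nil /= => e1 e2.
by rewrite addrACA e1 e2 addr0.
Qed.

Lemma tensor_QV (t : tensor V) f : eq_uhp f (tensor_fun t) -> QV A f.
Proof.
move=> ft; have [N [B [S [h _]]]] := tensor_expand t.
have P0 k : quasi_modular_form A (2 * k) (fun=> 0) by exact/qmfP/qmf0.
have PD k f1 f2 : quasi_modular_form A (2 * k) f1 -> quasi_modular_form A (2 * k) f2 ->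
    quasi_modular_form A (2 * k) (fun t => f1 t + f2 t).
  by move=> /qmfP h1 /qmfP h2; apply/qmfP; exact: qmfD.
apply: sum_spaces_eq (_ : eq_uhp (tensor_fun t) f) _; first by move=> tau ut; rewrite ft.
apply: sum_spaces_eq h _; apply: sum_spaces_sum => // x.
apply: sum_spaces_sum => // m.
apply: (@sum_spaces1 (fun k => quasi_modular_form A (2 * k)) (mwt m + hdeg x)).
apply/qmfP; exact: mono_qmf (hvecP x).
Qed.

Lemma tensor_MV (t : tensor V) f : eq_uhp f (tensor_fun t) ->
  tensor_eq (Lambda A t) [::] -> MV A f.
Proof.
move=> ft ht; have [N [B [S [h hS]]]] := tensor_expand t.
have P0 k : modular_form A k (fun=> 0) by exact/mfP/mf0.
have PD k f1 f2 : modular_form A k f1 -> modular_form A k f2 ->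
    modular_form A k (fun t => f1 t + f2 t).
  by move=> /mfP h1 /mfP h2; apply/mfP; exact: mfD.
apply: sum_spaces_eq (_ : eq_uhp (tensor_fun t) f) _; first by move=> tau ut; rewrite ft.
apply: sum_spaces_eq h _; apply: sum_spaces_sum => // x.
apply: sum_spaces_sum => // m.
case: (eqVneq (m 0) 0%N) => [m0|m0].
  apply: (@sum_spaces1 (modular_form A) (2 * (mwt m + hdeg x))).
  apply/mfP; exact: mono_mf (hvecP x) m0.
have c0 : mcoeff m (S x) = 0.
  have := mcoeff_deriv 0 (mnm_sub m (mnm1 0)) (S x).
  rewrite [mderiv 0 (S x)](hS ht x) mcoeff0 submK; last first.
    by apply/mnm_lepP => i; rewrite mnm1E; case: eqP => [<-|//]; rewrite lt0n.
  by move/esym/eqP; rewrite mulrn_eq0 /= => /eqP.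
by apply: sum_spaces_eq (sum_spaces0 P0) => tau _; rewrite c0 mul0r scale0r.
Qed.

(** Expanding the second factors in a basis, a tensor has coordinates in C[E_2, E_4, E_6],
    and these are determined by their values. *)
Lemma tensor_fun_inj (t u : tensor V) :
  eq_uhp (tensor_fun t) (tensor_fun u) -> tensor_eq t u.
Proof.
move=> tu; have [N hN] := filtr_all (t ++ u); have [B hB] := filtr_basis A N.
pose P (r : tensor V) (x : hcoord A N) := \sum_(y <- r) hfun x y.2 *: y.1.
have PE r x tau : Qval (P r x) tau = hfun x (tensor_fun r tau).
  rewrite /P Qval_sum /tensor_fun linear_sum; apply: eq_bigr => y _.
  by rewrite /Qval mevalZ mulrC [RHS]linearZ_LR.
have Ptu x : P t x = P u x.
  apply/eqP; rewrite -subr_eq0; apply/eqP; apply: Qval_inj => tau ut.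
  rewrite /Qval mevalB -/(Qval (P t x) tau) -/(Qval (P u x) tau) !PE tu// subrr.
  by [].
move=> W b bl br.
have bE (r : tensor V) : (forall y, y \in r -> filtr A N y.2) ->
    \sum_(y <- r) b y.1 y.2 = \sum_(x <- B) b (P r x) (hvec x).
  move=> hr.
  transitivity (\sum_(y <- r) \sum_(x <- B) hfun x y.2 *: b y.1 (hvec x)).
    rewrite !big_seq; apply: eq_bigr => y yr; rewrite {1}(hB _ (hr y yr)).
    elim: (B) => [|x B' IH].
      rewrite !big_nil; have := br y.1 (-1) 0 0.
      by rewrite scaler0 addr0 scaleN1r addNr.
    by rewrite !big_cons br IH.
  rewrite exchange_big /=; apply: eq_bigr => x _.
  rewrite /P; elim: r {hr} => [|y r IH].
    rewrite !big_nil; have := bl (hvec x) (-1) 0 0.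
    by rewrite scaler0 addr0 scaleN1r addNr.
  by rewrite !big_cons (bl (hvec x)) IH.
rewrite !bE.
- by apply: eq_bigr => x _; rewrite Ptu.
- by move=> y yu; apply: hN; rewrite mem_cat yu orbT.
- by move=> y yt; apply: hN; rewrite mem_cat yt.
Qed.

End VectorForms.

Theorem theorem1p1 (R : realType) (V : lmodType R[i]) (A : qvoa V) :
  [/\ (* p (x) v |-> p(tau) v is an isomorphism from Q (x) V onto Q(V) *)
      forall t u : tensor V,
        eq_uhp (tensor_fun t) (tensor_fun u) <-> tensor_eq t u,
      forall f : R[i] -> V,
        QV A f <-> exists t : tensor V, eq_uhp f (tensor_fun t)
    & (* M(V) is the kernel of Lambda on Q(V) *)
      forall f : R[i] -> V,
        MV A f <-> QV A f /\ exists t : tensor V,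
          eq_uhp f (tensor_fun t) /\ tensor_eq (Lambda A t) [::]].
Proof.
split.
- move=> t u; split; first exact: tensor_fun_inj.
  by move=> tu tau _; exact: tensor_fun_eq.
- move=> f; split; first exact: QV_tensor.
  by move=> [t ht]; exact: tensor_QV ht.
- move=> f; split=> [hf|[_ [t [h1 h2]]]]; last exact: tensor_MV h1 h2.
  have [t [h1 h2]] := MV_tensor hf.
  by split; [exact: tensor_QV h1|exists t].
Qed.
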